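(* Let $k$ be an integer not less than $2$. Then there is a constant $C>0$ depending only on $k$ such that for every real number $l\geq 2$, \[ \left\lvert\frac{1}{2\pi i}\sum_{0<|n|\leq k^l}\zeta\left(\frac{2n\pi i}{\log k}\right)\frac{1}{n}\right\rvert\leq C, \] where the sum is over nonzero integers $n$ with $|n|\le k^l$.
   Context: $\zeta$ denotes the (analytically continued) Riemann zeta function. *)

(* Defs.v *)
From Stdlib Require Import Reals ZArith List FinFun Lia Lra.
From Coquelicot Require Import Coquelicot.

Definition Cexp (z : C) : C :=
  (exp (Re z) * cos (Im z), exp (Re z) * sin (Im z)).

Definition analytic_at (f : C -> C) (s0 : C) : Prop :=
  exists (a : nat -> C) (r : R), 0 < r /\
    forall s : C, Cmod (s - s0) < r ->
      is_pseries (K := C_AbsRing) (V := C_NormedModule) a (s - s0)%C (f s).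

(* [zeta] is the analytic continuation to [C \ {1}] of the Dirichlet series
   [sum_(n >= 1) n^(-s)], [Re s > 1], with [n^(-s) = exp (- s * ln n)].  By the
   identity theorem this determines [zeta] except for its value at the pole 1. *)
Definition is_riemann_zeta (zeta : C -> C) : Prop :=
  (forall s : C, 1 < Re s ->
     is_series (K := C_AbsRing) (V := C_NormedModule)
       (fun n : nat => Cexp (- s * ln (INR (S n)))) (zeta s)) /\
  (forall s : C, s <> RtoC 1 -> analytic_at zeta s).

(* [Int_part] is the floor, so [Z.to_nat (Int_part x)] is the floor of [x] for
   [0 <= x], and [0] for [x < 0]. *)
Definition nonzero_ints_upto (x : R) : list Z :=
  let N := Z.to_nat (Int_part x) in
  filter (fun n => negb (n =? 0)%Z)
    (map (fun j => (Z.of_nat j - Z.of_nat N)%Z) (seq 0 (2 * N + 1))).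

Definition Csum_list (f : Z -> C) (s : list Z) : C :=
  fold_right Cplus (RtoC 0) (map f s).

Lemma nonzero_ints_uptoP (x : R) (n : Z) :
  In n (nonzero_ints_upto x) <-> n <> 0%Z /\ IZR (Z.abs n) <= x.
Proof.
unfold nonzero_ints_upto.
rewrite filter_In, in_map_iff, Bool.negb_true_iff, Z.eqb_neq.
destruct (base_Int_part x) as [h1 h2].
split.
- intros [[j [<- hj]] h0]; apply in_seq in hj; split; [exact h0|].
  apply Rle_trans with (2 := h1), IZR_le; lia.
- intros [h0 hx]; split; [|exact h0].
  assert (h : (Z.abs n < Int_part x + 1)%Z)
    by (apply lt_IZR; rewrite plus_IZR; lra).
  exists (Z.to_nat (n + Int_part x)); split; [|apply in_seq]; lia.
Qed.

Lemma nonzero_ints_upto_NoDup (x : R) : NoDup (nonzero_ints_upto x).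
Proof.
apply NoDup_filter, Injective_map_NoDup; [|apply seq_NoDup].
intros i j; lia.
Qed.

(* Main.v *)
Require Import Defs.
From Stdlib Require Import Reals ZArith List.
From Coquelicot Require Import Coquelicot.
From Stdlib Require Import Factorial Lra Lia Psatz.
Open Scope R_scope.

(** Put L = ln k, alpha = 2 pi / L, and let N be the integer part of k ^ l.
    As zeta takes conjugate values at conjugate points, the terms n and - n
    combine, and the quantity to bound is
      (1 / pi) * sum_(1 <= n <= N) Im zeta(i alpha n) / n.

    For M >= t > 0 the value zeta(i t) agrees with the trapezoidal expression
      sum_(m <= M) m^(-it) - M^(-it) / 2 - M^(1 - it) / (1 - it)
    up to O((1 + t) / M), by [zeta_im_approx].  With t = alpha n the imaginary
    part of m^(-it) is - sin(2 pi n log_k m), so that, for M of order N and up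
    to a bounded error and a sign, the quantity becomes
      sum_(m <= M) B_N(log_k m) - integral_0^M B_N(log_k x) dx
    by [zeta_im_trap_average], where B_N = [saw N] is the N-th partial sum of
    the Fourier series of the sawtooth B(v) = 1/2 - {v}.

    With B in place of B_N this difference is bounded: B_N vanishes at the
    integers, which is the mean of the one-sided limits of B, so the sum is a
    trapezoidal sum of B(log_k x) between consecutive powers of k, and on
    [k^j, k^(j+1)] it misses the integral by O(k^(-j)), which is Stirling's
    formula ([saw_defect_step]).  The two integrals differ by O(M / N)
    ([smooth_saw_approx]).

    What is left is the sum over m <= M of the error B - B_N at v = log_k m,
    which is cos((2N+1) pi v) / ((2N+1) pi sin(pi v)) up to a summable term
    ([saw_err2_bound]).  Absolute values would lose a logarithm on the scales
    k^j close to N.  So the integers m = K + i and m = K - i around K = k^j are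
    grouped.  For i <= K / sqrt N the two terms nearly cancel, the error being
    odd in v ([saw_osc_pair_bound]).  For larger i the phase
    (2N+1) pi log_k m has second differences of order N / K^2, and van der
    Corput's second derivative test provides the cancellation
    ([second_derivative_test], [cos_log_sum_bound]).  Each group contributes
    O(sqrt(K / N)) ([window_bound]), and these bounds form a geometric series
    over the powers K = k^j up to a constant times N ([saw_defect_bound]).

    The trapezoidal expression is tied to zeta by uniqueness of analytic
    continuation along the horizontal line Im s = t: the Euler-Maclaurin
    formula gives a function which is real-analytic in Re s >= 0 and coincides
    with the Dirichlet series for Re s > 1 ([analytic_R_identity],
    [zeta_limit]).  Its remainder at s = i t is estimated in the manner of
    Kusmin and Landau ([zeta_im_trap_cauchy]). *)

(** * Finite sums *)

Fixpoint psum (f : nat -> R) (n : nat) : R :=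
  match n with O => 0 | S n => psum f n + f n end.

Lemma psum_S f n : psum f (S n) = psum f n + f n.
Proof. reflexivity. Qed.

Lemma psum_ext f g n : (forall i, (i < n)%nat -> f i = g i) -> psum f n = psum g n.
Proof.
intros h; induction n as [|n IH]; simpl; [easy|].
rewrite IH, h; [easy|lia|intros; apply h; lia].
Qed.

Lemma psum_plus f g n : psum (fun i => f i + g i) n = psum f n + psum g n.
Proof. induction n as [|n IH]; simpl; lra. Qed.

Lemma psum_minus f g n : psum (fun i => f i - g i) n = psum f n - psum g n.
Proof. induction n as [|n IH]; simpl; lra. Qed.

Lemma psum_scal c f n : psum (fun i => c * f i) n = c * psum f n.
Proof. induction n as [|n IH]; simpl; [lra|rewrite IH; ring]. Qed.

Lemma psum_const c n : psum (fun _ => c) n = INR n * c.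
Proof. induction n as [|n IH]; [simpl; lra|]. rewrite S_INR; simpl; lra. Qed.

Lemma psum_le f g n : (forall i, (i < n)%nat -> f i <= g i) -> psum f n <= psum g n.
Proof.
intros h; induction n as [|n IH]; simpl; [lra|].
assert (h1 := h n ltac:(lia)).
assert (h2 : psum f n <= psum g n) by (apply IH; intros; apply h; lia). lra.
Qed.

Lemma psum_abs_le f g n : (forall i, (i < n)%nat -> Rabs (f i) <= g i) ->
  Rabs (psum f n) <= psum g n.
Proof.
intros h; induction n as [|n IH]; simpl; [rewrite Rabs_R0; lra|].
assert (h1 := h n ltac:(lia)).
assert (h2 : Rabs (psum f n) <= psum g n) by (apply IH; intros; apply h; lia).
eapply Rle_trans; [apply Rabs_triang|lra].
Qed.

Lemma psum_split f a n :
  psum f (a + n) = psum f a + psum (fun i => f (a + i)%nat) n.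
Proof.
induction n as [|n IH]; simpl.
- rewrite Nat.add_0_r; lra.
- rewrite Nat.add_succ_r; simpl; rewrite IH; lra.
Qed.

Lemma psum_telescope f n : psum (fun i => f (S i) - f i) n = f n - f 0%nat.
Proof. induction n as [|n IH]; simpl; [lra|rewrite IH; lra]. Qed.

Lemma psum_shift f n : psum f (S n) = f 0%nat + psum (fun i => f (S i)) n.
Proof. change (S n) with (1 + n)%nat; rewrite psum_split; simpl; lra. Qed.

Lemma psum_rev f n : psum (fun i => f (n - 1 - i)%nat) n = psum f n.
Proof.
revert f; induction n as [|n IH]; intros f; [easy|].
rewrite (psum_shift f). rewrite <- IH. simpl psum at 1.
replace (n - 0 - n)%nat with 0%nat by lia. rewrite Rplus_comm; f_equal.
apply psum_ext; intros i hi; f_equal; lia.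
Qed.

(** Summation by parts against a decreasing nonnegative weight: applied to the
    affine majorant [A * INR i + B] of the partial sums, it returns that
    majorant summed against the weight. *)
Lemma psum_abel w z A B n :
  0 <= A -> 0 <= B -> 0 <= w 0%nat ->
  (forall i, (i < n)%nat -> 0 <= w i) ->
  (forall i, (S i < n)%nat -> w (S i) <= w i) ->
  (forall i, (i <= n)%nat -> Rabs (psum z i) <= A * INR i + B) ->
  Rabs (psum (fun i => w i * z i) n) <= A * psum w n + B * w 0%nat.
Proof.
intros hA hB hw0 hw hdec hz.
destruct n as [|n]; [simpl; rewrite Rabs_R0; nra|].
assert (key : forall m, (m <= n)%nat ->
  Rabs (psum (fun i => w i * z i) (S m) - w m * psum z (S m)) <=
  A * psum w (S m) + B * w 0%nat - w m * (A * INR (S m) + B)).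
{ induction m as [|m IH]; intros hm.
  - simpl. replace (0 + w 0%nat * z 0%nat - w 0%nat * (0 + z 0%nat)) with 0 by ring.
    rewrite Rabs_R0; lra.
  - assert (h1 := IH ltac:(lia)).
    assert (h2 := hz (S m) ltac:(lia)).
    assert (h3 := hdec m ltac:(lia)).
    replace (psum (fun i => w i * z i) (S (S m)) - w (S m) * psum z (S (S m)))
      with ((psum (fun i => w i * z i) (S m) - w m * psum z (S m))
            + (w m - w (S m)) * psum z (S m)) by (simpl; ring).
    eapply Rle_trans; [apply Rabs_triang|].
    rewrite Rabs_mult, (Rabs_pos_eq (w m - w (S m))) by lra.
    change (psum w (S (S m))) with (psum w (S m) + w (S m)).
    rewrite (S_INR (S m)). nra. }
assert (h1 := key n ltac:(lia)).
assert (h2 := hz (S n) ltac:(lia)).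
assert (h3 := hw n ltac:(lia)).
assert (h4 : Rabs (w n * psum z (S n)) <= w n * (A * INR (S n) + B)).
{ rewrite Rabs_mult, (Rabs_pos_eq (w n)) by lra. nra. }
replace (psum (fun i => w i * z i) (S n)) with
  ((psum (fun i => w i * z i) (S n) - w n * psum z (S n)) + w n * psum z (S n)) by ring.
eapply Rle_trans; [apply Rabs_triang|lra].
Qed.

Lemma psum_inv_le_sqrt n : psum (fun i => / INR (S i)) n <= 2 * sqrt (INR n).
Proof.
induction n as [|n IH]; [simpl; rewrite sqrt_0; lra|].
change (psum (fun i => / INR (S i)) (S n)) with (psum (fun i => / INR (S i)) n + / INR (S n)).
assert (hn := pos_INR n). rewrite S_INR in *.
set (a := sqrt (INR n)) in *. set (b := sqrt (INR n + 1)).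
assert (ha : 0 <= a) by apply sqrt_pos.
assert (hb : 0 < b) by (apply sqrt_lt_R0; lra).
assert (ea : a * a = INR n) by (apply sqrt_sqrt; lra).
assert (eb : b * b = INR n + 1) by (apply sqrt_sqrt; lra).
rewrite <- eb.
assert (h1 : 1 <= b) by nra. assert (h2 : a <= b) by nra.
assert (h3 : / (b * b) <= / b).
{ apply Rinv_le_contravar; nra. }
assert (h4 : / b <= 2 * (b - a)).
{ apply Rmult_le_reg_l with b; [easy|]. rewrite Rinv_r by lra. nra. }
lra.
Qed.

Lemma inv_sq_le_telescope y : 0 < y -> / (y + 1) ^ 2 <= / y - / (y + 1).
Proof.
intros hy.
replace (/ y - / (y + 1)) with (/ (y * (y + 1))) by (field; lra).
apply Rinv_le_contravar; nra.
Qed.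

Lemma psum_inv_sq_le n : psum (fun i => / (INR (S i))^2) n <= 2.
Proof.
destruct n as [|n]; [simpl; lra|].
assert (h : psum (fun i => / (INR (S i))^2) (S n) <= 2 - / INR (S n)).
{ induction n as [|n IH]; [simpl; lra|].
  change (psum (fun i => / (INR (S i))^2) (S (S n))) with
    (psum (fun i => / (INR (S i))^2) (S n) + / (INR (S (S n)))^2).
  rewrite (S_INR (S n)).
  assert (hy : 0 < INR (S n)) by (apply lt_0_INR; lia).
  assert (h := inv_sq_le_telescope _ hy). lra. }
assert (0 < / INR (S n)) by (apply Rinv_0_lt_compat, lt_0_INR; lia). lra.
Qed.

Lemma psum_pow_le q n : 4 / 3 <= q -> psum (fun j => q ^ j) (S n) <= 4 * q ^ n.
Proof.
intros hq; induction n as [|n IH]; [simpl; lra|].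
change (psum (fun j => q ^ j) (S (S n))) with (psum (fun j => q ^ j) (S n) + q ^ S n).
assert (0 < q ^ n) by (apply pow_lt; lra). simpl (q ^ S n) in *. nra.
Qed.

(** * The second derivative test *)

Definition damped_den r x := (cos x)^2 + r^2 * (sin x)^2.
(** The continuous determination of arctan (r tan x), written as x plus a
    periodic part. *)
Definition damped_angle r x :=
  x + atan ((r - 1) * (sin x * cos x) / ((cos x)^2 + r * (sin x)^2)).
(** A bounded replacement of cot x, equal to cot x times
    r^2 sin^2 x / (cos^2 x + r^2 sin^2 x); it is also (r / 2) sin (2 a) with a the
    [damped_angle] of x. *)
Definition damped_cot r x := r^2 * (sin x * cos x) / damped_den r x.

Lemma cos_sq_add_sin_sq x : (cos x)^2 + (sin x)^2 = 1.
Proof. assert (h := sin2_cos2 x). unfold Rsqr in h. lra. Qed.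

Lemma damped_den_ge1 r x : 1 <= r -> 1 <= damped_den r x.
Proof. intros h; unfold damped_den. assert (h1 := cos_sq_add_sin_sq x).
assert (h2 : 0 <= (r ^ 2 - 1) * (sin x)^2) by (apply Rmult_le_pos; [nra|apply pow2_ge_0]). lra. Qed.

Lemma damped_angle_derive r x : 1 <= r -> is_derive (damped_angle r) x (r / damped_den r x).
Proof.
intros hr. unfold damped_angle.
assert (h0 := cos_sq_add_sin_sq x).
assert (h1 : 0 < (cos x)^2 + r * (sin x)^2)
  by (assert (0 <= (r - 1) * (sin x)^2) by (apply Rmult_le_pos; [lra|apply pow2_ge_0]); lra).
assert (h2 := damped_den_ge1 r x hr). unfold damped_den in *.
auto_derive; [lra|].
set (s := sin x) in *. set (c := cos x) in *.
assert (h3 : 0 < (c^2 + r * s^2)^2 + ((r - 1) * (s * c))^2) by nra.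
assert (e2 : s ^ 2 = 1 - c ^ 2) by lra.
assert (e : (c^2 + r * s^2)^2 + ((r - 1) * (s * c))^2 = c^2 + r^2 * s^2).
{ replace (((r - 1) * (s * c)) ^ 2) with ((r-1)^2 * s^2 * c^2) by ring. rewrite e2. ring. }
transitivity (1 + ((r - 1) * (c * c - s * s) * (c^2 + r * s^2)
     - (r - 1) * (s * c) * (2 * (r - 1) * (s * c)))
  / ((c^2 + r * s^2)^2 + ((r - 1) * (s * c))^2)).
{ field. split; lra. }
rewrite e. apply Rmult_eq_reg_r with (c ^ 2 + r ^ 2 * s ^ 2); [|lra].
field_simplify; [|lra|lra].
replace (s ^ 4) with (s ^ 2 * s ^ 2) by ring. rewrite e2. ring.
Qed.

Lemma damped_cot_derive r x : 1 <= r ->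
  is_derive (damped_cot r) x (r^2 * ((cos x)^2 - r^2 * (sin x)^2) / (damped_den r x)^2).
Proof.
intros hr. unfold damped_cot. assert (h2 := damped_den_ge1 r x hr). unfold damped_den in *.
auto_derive; [lra|].
assert (h0 := cos_sq_add_sin_sq x).
set (s := sin x) in *. set (c := cos x) in *.
assert (e2 : s ^ 2 = 1 - c ^ 2) by lra.
transitivity (r^2 * ((c^2 - s^2) * (c^2 + r^2 * s^2) - 2 * (r^2 - 1) * s^2 * c^2)
  / (c ^ 2 + r ^ 2 * s ^ 2)^2).
{ field. lra. }
f_equal. f_equal. rewrite e2. ring.
Qed.

Lemma damped_cot_bound r x : 1 <= r -> Rabs (damped_cot r x) <= r / 2.
Proof.
intros hr. unfold damped_cot. assert (h2 := damped_den_ge1 r x hr).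
unfold Rdiv; rewrite Rabs_mult, (Rabs_pos_eq (/ _)) by (left; apply Rinv_0_lt_compat; lra).
apply Rmult_le_reg_r with (damped_den r x); [lra|].
rewrite Rmult_assoc, Rinv_l, Rmult_1_r by lra. unfold damped_den.
set (s := sin x). set (c := cos x).
assert (h := pow2_ge_0 (c - r * s)). assert (h' := pow2_ge_0 (c + r * s)).
unfold Rabs; destruct Rcase_abs; nra.
Qed.

Lemma damped_angle_incr_bound r x y : 1 <= r -> damped_angle r y - damped_angle r x <= y - x + PI.
Proof.
intros hr. unfold damped_angle.
match goal with |- y + atan ?a - (x + atan ?b) <= _ =>
 assert (h1 := atan_bound a); assert (h2 := atan_bound b) end. lra.
Qed.

Lemma incr_of_derive (f df : R -> R) a b : a <= b ->
  (forall x, a <= x <= b -> is_derive f x (df x)) ->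
  (forall x, a <= x <= b -> 0 <= df x) -> f a <= f b.
Proof.
intros hab hd hp.
destruct (MVT_gen f a b df) as [c [hc e]].
- intros x hx; rewrite Rmin_left, Rmax_right in hx by lra; apply hd; lra.
- intros x hx; rewrite Rmin_left, Rmax_right in hx by lra.
  apply continuity_pt_filterlim, ex_derive_continuous_pt || apply derivable_continuous_pt.
  exists (df x). apply is_derive_Reals, hd; lra.
- rewrite Rmin_left, Rmax_right in hc by lra.
  assert (h := hp c hc). nra.
Qed.

Lemma damped_angle_le r x y : 1 <= r -> x <= y -> damped_angle r x <= damped_angle r y.
Proof.
intros hr hxy. apply incr_of_derive with (fun x => r / damped_den r x); [easy| |].
- intros z _; now apply damped_angle_derive.
- intros z _. assert (h := damped_den_ge1 r z hr). apply Rdiv_le_0_compat; lra.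
Qed.

(** The derivative of [damped_cot] is
    r^2 (cos^2 - r^2 sin^2) / (cos^2 + r^2 sin^2)^2, which is at most r times the
    derivative r / (cos^2 + r^2 sin^2) of [damped_angle].  The variation of
    [damped_cot] along a monotone sequence is thus read off from the endpoints. *)
Lemma damped_cot_variation r x y : 1 <= r -> x <= y ->
  Rabs (damped_cot r y - damped_cot r x) <= r * (damped_angle r y - damped_angle r x).
Proof.
intros hr hxy.
assert (hb : forall z, Rabs (r^2 * ((cos z)^2 - r^2 * (sin z)^2) / (damped_den r z)^2) <= r * (r / damped_den r z)).
{ intros z. assert (h := damped_den_ge1 r z hr).
  unfold Rdiv. rewrite !Rabs_mult, (Rabs_pos_eq (/ _)) by (left; apply Rinv_0_lt_compat; nra).
  rewrite (Rabs_pos_eq (r^2)) by nra.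
  replace (r * (r * / damped_den r z)) with (r^2 * damped_den r z * / (damped_den r z)^2) by (field; lra).
  apply Rmult_le_compat_r; [left; apply Rinv_0_lt_compat; nra|].
  apply Rmult_le_compat_l; [nra|]. unfold damped_den.
  assert (h1 := pow2_ge_0 (cos z)). assert (h2 := pow2_ge_0 (r * sin z)).
  unfold Rabs; destruct Rcase_abs; nra. }
assert (A : r * damped_angle r x - damped_cot r x <= r * damped_angle r y - damped_cot r y).
{ apply (incr_of_derive (fun z => r * damped_angle r z - damped_cot r z)
   (fun z => r * (r / damped_den r z) - r^2 * ((cos z)^2 - r^2 * (sin z)^2) / (damped_den r z)^2)); [easy| |].
  - intros z _. refine (is_derive_minus (fun z => r * damped_angle r z) (damped_cot r) z _ _ _ _); [|now apply damped_cot_derive].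
    apply is_derive_scal. now apply damped_angle_derive.
  - intros z _. assert (h := hb z). apply Rabs_le_between in h. lra. }
assert (B : r * damped_angle r x + damped_cot r x <= r * damped_angle r y + damped_cot r y).
{ apply (incr_of_derive (fun z => r * damped_angle r z + damped_cot r z)
   (fun z => r * (r / damped_den r z) + r^2 * ((cos z)^2 - r^2 * (sin z)^2) / (damped_den r z)^2)); [easy| |].
  - intros z _. refine (is_derive_plus (fun z => r * damped_angle r z) (damped_cot r) z _ _ _ _); [|now apply damped_cot_derive].
    apply is_derive_scal. now apply damped_angle_derive.
  - intros z _. assert (h := hb z). apply Rabs_le_between in h. lra. }
apply Rabs_le. lra.
Qed.

Lemma sin_diff_le x y : x <= y -> Rabs (sin y - sin x) <= y - x.
Proof.
intros hxy.
assert (A : x - sin x <= y - sin y).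
{ apply (incr_of_derive (fun z => z - sin z) (fun z => 1 - cos z)); [easy| |].
  - intros z _. auto_derive; [easy|ring].
  - intros z _. assert (h := COS_bound z). lra. }
assert (B : x + sin x <= y + sin y).
{ apply (incr_of_derive (fun z => z + sin z) (fun z => 1 + cos z)); [easy| |].
  - intros z _. auto_derive; [easy|ring].
  - intros z _. assert (h := COS_bound z). lra. }
apply Rabs_le; lra.
Qed.

(** Over a step of length 1 / r^2 the denominator changes by a bounded factor,
    so that its inverse at a point is comparable to the mean of the inverse over
    the next step. *)
Lemma damped_den_harnack r x y : 2 <= r ^ 2 -> x <= y <= x + / r ^ 2 -> damped_den r y <= 2 * damped_den r x.
Proof.
intros hr hy. unfold damped_den.
assert (h := sin_diff_le x y ltac:(lra)).
assert (hx1 := cos_sq_add_sin_sq x). assert (hy1 := cos_sq_add_sin_sq y).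
set (s := sin x) in *. set (s' := sin y) in *.
set (d := / r ^ 2) in *.
assert (ed : r ^ 2 * d = 1) by (unfold d; field; nra).
assert (hd : 0 < d) by (unfold d; apply Rinv_0_lt_compat; lra).
assert (h1 : (s' - s) ^ 2 <= d ^ 2).
{ rewrite <- (pow2_abs (s' - s)). apply pow_incr. split; [apply Rabs_pos|lra]. }
assert (h2 : s' ^ 2 <= 2 * s ^ 2 + 2 * d ^ 2) by (assert (h3 := pow2_ge_0 (s' - 2 * s)); nra).
assert (h4 : (r ^ 2 - 1) * s' ^ 2 <= (r ^ 2 - 1) * (2 * s ^ 2 + 2 * d ^ 2))
  by (apply Rmult_le_compat_l; lra).
assert (h5 : (r ^ 2 - 1) * (2 * d ^ 2) <= 1).
{ replace ((r ^ 2 - 1) * (2 * d ^ 2)) with (2 * d * (r ^ 2 * d) - 2 * d ^ 2) by ring.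
  rewrite ed. assert (d <= / 2) by (apply Rinv_le_contravar; lra). nra. }
lra.
Qed.

Lemma damped_angle_step r x y : 1 <= r -> 2 <= r ^ 2 -> x + / r ^ 2 <= y ->
  / damped_den r x <= 2 * r * (damped_angle r y - damped_angle r x).
Proof.
intros hr1 hr hy.
set (d := / r ^ 2) in *.
assert (ed : r ^ 2 * d = 1) by (unfold d; field; nra).
assert (hd : 0 < d) by (unfold d; apply Rinv_0_lt_compat; lra).
assert (hq := damped_den_ge1 r x hr1).
assert (A : damped_angle r x - r / (2 * damped_den r x) * x <= damped_angle r (x + d) - r / (2 * damped_den r x) * (x + d)).
{ apply (incr_of_derive (fun z => damped_angle r z - r / (2 * damped_den r x) * z)
    (fun z => r / damped_den r z - r / (2 * damped_den r x) * 1)); [lra| |].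
  - intros z _.
    refine (is_derive_minus (damped_angle r) (fun z => r / (2 * damped_den r x) * z) z _ _ _ _).
    + now apply damped_angle_derive.
    + auto_derive; [easy|ring].
  - intros z hz. assert (h := damped_den_harnack r x z hr ltac:(fold d; lra)).
    assert (h' := damped_den_ge1 r z hr1).
    assert (/ (2 * damped_den r x) <= / damped_den r z) by (apply Rinv_le_contravar; lra).
    unfold Rdiv. nra. }
assert (B := damped_angle_le r (x + d) y hr1 hy).
assert (C : r / (2 * damped_den r x) * d <= damped_angle r y - damped_angle r x) by lra.
apply (Rmult_le_compat_l (2 * r)) in C; [|lra].
replace (2 * r * (r / (2 * damped_den r x) * d)) with ((r ^ 2 * d) * / damped_den r x) in C by (field; lra).
rewrite ed in C. lra.
Qed.

(** Van der Corput's test, for phases whose half-increments x increase by at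
    least 1 / r^2 at each step.  The identity
    cos a + cos b = cot x (sin b - sin a), with x = (b - a) / 2, would let the sum
    telescope if x stayed away from the multiples of pi.  With [damped_cot]
    instead of cot there is a defect cos^2 x / (cos^2 x + r^2 sin^2 x) at each
    step.  The variation of the coefficients and the sum of the defects are both
    bounded by multiples of r times the increase of [damped_angle], which exceeds
    that of x by at most pi. *)
Lemma second_derivative_test r f n :
  1 <= r -> 2 <= r ^ 2 ->
  let x i := (f (S i) - f i) / 2 in
  (forall i, (S i < S n)%nat -> x i + / r ^ 2 <= x (S i)) ->
  Rabs (psum (fun i => cos (f i) + cos (f (S i))) (S n)) <=
  3 * r + 5 * r * (x n - x 0%nat + PI).
Proof.
intros hr1 hr x hgap.
assert (hd : 0 < / r ^ 2) by (apply Rinv_0_lt_compat; lra).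
set (k i := damped_cot r (x i)).
assert (id : forall i, cos (f i) + cos (f (S i)) =
   k i * (sin (f (S i)) - sin (f i))
   + (cos (x i)) ^ 2 / damped_den r (x i) * (cos (f i) + cos (f (S i)))).
{ intros i. set (m := (f i + f (S i)) / 2).
  assert (e1 : f i = m - x i) by (unfold m, x; field).
  assert (e2 : f (S i) = m + x i) by (unfold m, x; field).
  rewrite e1, e2, cos_minus, cos_plus, sin_minus, sin_plus.
  unfold k, damped_cot. assert (h := damped_den_ge1 r (x i) hr1). 
  apply Rmult_eq_reg_r with (damped_den r (x i)); [|lra].
  unfold damped_den in *. field. lra. }
rewrite (psum_ext _ _ _ (fun i _ => id i)), psum_plus.
assert (B1 : Rabs (psum (fun i => (cos (x i)) ^ 2 / damped_den r (x i) * (cos (f i) + cos (f (S i)))) (S n))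
   <= psum (fun i => 2 * / damped_den r (x i)) (S n)).
{ apply psum_abs_le. intros i _. assert (h := damped_den_ge1 r (x i) hr1).
  assert (h0 : 0 < / damped_den r (x i)) by (apply Rinv_0_lt_compat; lra).
  unfold Rdiv. rewrite !Rabs_mult, (Rabs_pos_eq (/ _)), (Rabs_pos_eq (_ ^ 2)) by (try apply pow2_ge_0; lra).
  assert (h1 := cos_sq_add_sin_sq (x i)). assert (h2 := pow2_ge_0 (sin (x i))). assert (h2' := pow2_ge_0 (cos (x i))).
  assert (h3 : Rabs (cos (f i) + cos (f (S i))) <= 2).
  { apply Rabs_le. assert (hc := COS_bound (f i)). assert (hc' := COS_bound (f (S i))). lra. }
  assert (h4 := Rabs_pos (cos (f i) + cos (f (S i)))).
  apply Rle_trans with (1 * / damped_den r (x i) * 2).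
  - apply Rmult_le_compat; try lra.
    + apply Rmult_le_pos; lra.
    + apply Rmult_le_compat_r; lra.
  - lra. }
assert (B2 : psum (fun i => 2 * / damped_den r (x i)) (S n) <= 4 * r * (damped_angle r (x n) - damped_angle r (x 0%nat)) + 2).
{ assert (h : forall m, (m <= n)%nat -> psum (fun i => 2 * / damped_den r (x i)) m
     <= 4 * r * (damped_angle r (x m) - damped_angle r (x 0%nat))).
  { induction m as [|m IH]; intros hm; [simpl; lra|].
    assert (h1 := IH ltac:(lia)).
    assert (h2 := damped_angle_step r (x m) (x (S m)) hr1 hr (hgap m ltac:(lia))).
    change (psum (fun i => 2 * / damped_den r (x i)) (S m)) with
      (psum (fun i => 2 * / damped_den r (x i)) m + 2 * / damped_den r (x m)). lra. }
  assert (h1 := h n (le_n n)). assert (h2 := damped_den_ge1 r (x n) hr1).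
  assert (/ damped_den r (x n) <= / 1) by (apply Rinv_le_contravar; lra).
  change (psum (fun i => 2 * / damped_den r (x i)) (S n)) with
      (psum (fun i => 2 * / damped_den r (x i)) n + 2 * / damped_den r (x n)). lra. }
assert (sb : forall i, Rabs (sin (f i)) <= 1)
  by (intros i; apply Rabs_le; assert (h := SIN_bound (f i)); lra).
assert (B3 : forall m, (m <= n)%nat ->
  Rabs (psum (fun i => k i * (sin (f (S i)) - sin (f i))) (S m) - k m * sin (f (S m)))
  <= r / 2 + r * (damped_angle r (x m) - damped_angle r (x 0%nat))).
{ induction m as [|m IH]; intros hm.
  - simpl. replace (0 + k 0%nat * (sin (f 1%nat) - sin (f 0%nat)) - k 0%nat * sin (f 1%nat))
      with (- k 0%nat * sin (f 0%nat)) by ring.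
    rewrite Rabs_mult, Rabs_Ropp.
    assert (h := damped_cot_bound r (x 0%nat) hr1). assert (h' := sb 0%nat).
    assert (h3 := Rabs_pos (k 0%nat)). fold (k 0%nat) in h. nra.
  - assert (h1 := IH ltac:(lia)).
    change (psum (fun i => k i * (sin (f (S i)) - sin (f i))) (S (S m))) with
      (psum (fun i => k i * (sin (f (S i)) - sin (f i))) (S m)
        + k (S m) * (sin (f (S (S m))) - sin (f (S m)))).
    assert (hx : x m <= x (S m)) by (assert (h := hgap m ltac:(lia)); lra).
    assert (h2 := damped_cot_variation r _ _ hr1 hx). fold (k m) (k (S m)) in h2.
    match goal with |- Rabs ?e <= _ => replace e with
     ((psum (fun i => k i * (sin (f (S i)) - sin (f i))) (S m) - k m * sin (f (S m)))
       + - (k (S m) - k m) * sin (f (S m))) by ring end.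
    eapply Rle_trans; [apply Rabs_triang|].
    rewrite Rabs_mult, Rabs_Ropp. assert (h3 := sb (S m)).
    assert (h4 := Rabs_pos (k (S m) - k m)). nra. }
assert (B4 := B3 n (le_n n)).
assert (B5 : Rabs (k n * sin (f (S n))) <= r / 2).
{ rewrite Rabs_mult. assert (h := damped_cot_bound r (x n) hr1). fold (k n) in h.
  assert (h' := sb (S n)). assert (h3 := Rabs_pos (k n)). nra. }
assert (B6 := damped_angle_incr_bound r (x 0%nat) (x n) hr1).
set (P := psum (fun i => k i * (sin (f (S i)) - sin (f i))) (S n)) in *.
eapply Rle_trans; [apply Rabs_triang|].
assert (B7 : Rabs P <= r / 2 + r * (damped_angle r (x n) - damped_angle r (x 0%nat)) + r / 2).
{ replace P with ((P - k n * sin (f (S n))) + k n * sin (f (S n))) by ring.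
  eapply Rle_trans; [apply Rabs_triang|]. lra. }
nra.
Qed.

(** * The sawtooth and its Fourier partial sums *)

Definition odd_freq (N : nat) := 2 * INR N + 1.

Definition saw (N : nat) (v : R) :=
  psum (fun n => sin (2 * PI * INR (S n) * v) / (PI * INR (S n))) N.

(** On (0, 1), the sawtooth minus its N-th Fourier partial sum. *)
Definition saw_err (N : nat) (v : R) := / 2 - v - saw N v.

(** The boundary term in one integration by parts of
    sin ((2N+1) pi w) / sin (pi w) over [v, 1/2], an integral whose value is
    [saw_err N v]. *)
Definition saw_osc (N : nat) (v : R) := cos (odd_freq N * PI * v) / (odd_freq N * PI * sin (PI * v)).

Lemma Rmult_pos3 a b c : 0 < a -> 0 < b -> 0 < c -> 0 < a * b * c.
Proof. intros; repeat apply Rmult_lt_0_compat; assumption. Qed.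

Lemma odd_freq_ge1 N : 1 <= odd_freq N.
Proof. unfold odd_freq. assert (h := pos_INR N). lra. Qed.

(** Serves in place of integrating the absolute value of the derivative of f:
    h is an antiderivative of minus a majorant. *)
Lemma dist_le_of_derive (f df h dh : R -> R) a b : a <= b ->
  (forall x, a <= x <= b -> is_derive f x (df x)) ->
  (forall x, a <= x <= b -> is_derive h x (dh x)) ->
  (forall x, a <= x <= b -> Rabs (df x) <= - dh x) ->
  Rabs (f a - f b) <= h a - h b.
Proof.
intros hab hf hh hb.
assert (A : f a - h a <= f b - h b).
{ apply (incr_of_derive (fun z => f z - h z) (fun z => df z - dh z)); [easy| |].
  - intros z hz. now refine (is_derive_minus f h z _ _ (hf z hz) (hh z hz)).
  - intros z hz. assert (e := hb z hz). apply Rabs_le_between in e. lra. }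
assert (B : - f a - h a <= - f b - h b).
{ apply (incr_of_derive (fun z => - f z - h z) (fun z => - df z - dh z)); [easy| |].
  - intros z hz. refine (is_derive_minus (fun z => - f z) h z _ _ _ (hh z hz)).
    now refine (is_derive_opp f z _ (hf z hz)).
  - intros z hz. assert (e := hb z hz). apply Rabs_le_between in e. lra. }
apply Rabs_le; lra.
Qed.

Lemma saw_derive N v :
  is_derive (saw N) v (psum (fun n => 2 * cos (2 * PI * INR (S n) * v)) N).
Proof.
induction N as [|N IH].
- unfold saw; simpl. auto_derive; easy.
- rewrite psum_S.
  refine (is_derive_plus (saw N) (fun v => sin (2 * PI * INR (S N) * v) / (PI * INR (S N))) v _ _ IH _).
  assert (hp := PI_RGT_0). assert (hn : 0 < INR (S N)) by (apply lt_0_INR; lia).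
  set (y := INR (S N)) in *; clearbody y. auto_derive; [easy|]. field. split; lra.
Qed.

Lemma dirichlet_kernel N v :
  psum (fun n => 2 * cos (2 * PI * INR (S n) * v)) N * sin (PI * v) =
  sin (odd_freq N * PI * v) - sin (PI * v).
Proof.
induction N as [|N IH].
- unfold odd_freq; simpl. replace ((2 * 0 + 1) * PI * v) with (PI * v) by ring. ring.
- rewrite psum_S, Rmult_plus_distr_r, IH. unfold odd_freq. rewrite S_INR.
  replace ((2 * (INR N + 1) + 1) * PI * v) with (2 * PI * (INR N + 1) * v + PI * v) by ring.
  replace ((2 * INR N + 1) * PI * v) with (2 * PI * (INR N + 1) * v - PI * v) by ring.
  rewrite sin_minus, sin_plus. ring.
Qed.

Lemma saw_half N : saw N (/ 2) = 0.
Proof.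
unfold saw. rewrite (psum_ext _ (fun _ => 0)), psum_const; [ring|].
intros i _. replace (2 * PI * INR (S i) * / 2) with (INR (S i) * PI) by field.
assert (h : sin (INR (S i) * PI) = 0).
{ apply sin_eq_0_1. exists (Z.of_nat (S i)). now rewrite <- INR_IZR_INZ. }
rewrite h. unfold Rdiv; ring.
Qed.

Lemma cos_half_odd N : cos (odd_freq N * PI * / 2) = 0.
Proof.
unfold odd_freq. replace ((2 * INR N + 1) * PI * / 2) with (PI / 2 + INR N * PI) by field.
rewrite cos_plus, cos_PI2.
assert (h : sin (INR N * PI) = 0).
{ apply sin_eq_0_1. exists (Z.of_nat N). now rewrite <- INR_IZR_INZ. }
rewrite h. ring.
Qed.

Lemma sin_PI_pos v : 0 < v <= / 2 -> 0 < sin (PI * v).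
Proof. intros h. assert (hp := PI_RGT_0). apply sin_gt_0; nra. Qed.

Lemma cos_PI_nonneg v : 0 < v <= / 2 -> 0 <= cos (PI * v).
Proof. intros h. assert (hp := PI_RGT_0). apply cos_ge_0; nra. Qed.

Lemma sin_PI_ge v : 0 <= v <= / 2 -> v <= sin (PI * v).
Proof.
intros h. assert (hp := PI_RGT_0). assert (hp2 := PI2_3_2).
destruct (Rle_dec v (/3)) as [h3|h3].
- assert (A : sin (PI * 0) - 0 <= sin (PI * v) - v).
  { apply (incr_of_derive (fun v => sin (PI * v) - v) (fun v => PI * cos (PI * v) - 1)); [easy| |].
    - intros z _. auto_derive; [easy|ring].
    - intros z hz. assert (hc : / 2 <= cos (PI * z)).
      { replace (/ 2) with (cos (PI / 3)) by (rewrite cos_PI3; lra).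
        apply cos_decr_1; nra. }
      nra. }
  rewrite Rmult_0_r, sin_0 in A. lra.
- apply Rle_trans with (/ 2); [lra|].
  replace (/ 2) with (sin (PI / 6)) by (rewrite sin_PI6; lra).
  apply sin_incr_1; nra.
Qed.

Lemma saw_err_derive N v : 0 < v <= / 2 ->
  is_derive (saw_err N) v (- (sin (odd_freq N * PI * v) / sin (PI * v))).
Proof.
intros hv. assert (hs := sin_PI_pos v hv).
unfold saw_err.
replace (- (sin (odd_freq N * PI * v) / sin (PI * v))) with
  (minus (-1) (psum (fun n => 2 * cos (2 * PI * INR (S n) * v)) N)).
- refine (is_derive_minus (fun v => / 2 - v) (saw N) v _ _ _ (saw_derive N v)).
  auto_derive; [easy|ring].
- change (-1 - psum (fun n => 2 * cos (2 * PI * INR (S n) * v)) N =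
    - (sin (odd_freq N * PI * v) / sin (PI * v))).
  assert (h := dirichlet_kernel N v).
  apply Rmult_eq_reg_r with (sin (PI * v)); [|lra].
  field_simplify; [|lra]. lra.
Qed.

Lemma saw_osc_derive N v : 0 < v <= / 2 ->
  is_derive (saw_osc N) v (- (sin (odd_freq N * PI * v) / sin (PI * v))
    - cos (odd_freq N * PI * v) * cos (PI * v) / (odd_freq N * (sin (PI * v))^2)).
Proof.
intros hv. assert (hs := sin_PI_pos v hv).
assert (hw := odd_freq_ge1 N). assert (hp := PI_RGT_0).
unfold saw_osc. auto_derive.
- apply Rgt_not_eq. apply Rmult_pos3; lra.
- field. repeat split; lra.
Qed.

Lemma Rabs_sin_le x : Rabs (sin x) <= 1.
Proof. apply Rabs_le; assert (h := SIN_bound x); lra. Qed.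
Lemma Rabs_cos_le x : Rabs (cos x) <= 1.
Proof. apply Rabs_le; assert (h := COS_bound x); lra. Qed.

Lemma Rabs_div_le x a c d : Rabs x <= a -> 0 < c <= d -> Rabs (x / d) <= a / c.
Proof.
intros hx hd. unfold Rdiv. rewrite Rabs_mult, Rabs_inv, (Rabs_pos_eq d) by lra.
assert (h := Rabs_pos x).
apply Rmult_le_compat; try lra.
- left; apply Rinv_0_lt_compat; lra.
- apply Rinv_le_contravar; lra.
Qed.

Lemma Rabs_mult_le1 x y : Rabs x <= 1 -> Rabs y <= 1 -> Rabs (x * y) <= 1.
Proof.
intros hx hy. rewrite Rabs_mult. assert (h := Rabs_pos x). assert (h' := Rabs_pos y). nra.
Qed.

Lemma saw_osc_derive_bound N v : 0 < v <= / 2 ->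
  Rabs (- (sin (odd_freq N * PI * v) / sin (PI * v))
    - cos (odd_freq N * PI * v) * cos (PI * v) / (odd_freq N * (sin (PI * v))^2))
  <= / v + / (odd_freq N * v ^ 2).
Proof.
intros hv. assert (hs := sin_PI_pos v hv). assert (hs' := sin_PI_ge v ltac:(lra)).
assert (hw := odd_freq_ge1 N).
unfold Rminus. eapply Rle_trans; [apply Rabs_triang|].
rewrite !Rabs_Ropp.
replace (/ v) with (1 / v) by (field; lra).
replace (/ (odd_freq N * v ^ 2)) with (1 / (odd_freq N * v ^ 2)) by (field; lra).
apply Rplus_le_compat; apply Rabs_div_le.
- apply Rabs_sin_le.
- lra.
- apply Rabs_mult_le1; apply Rabs_cos_le.
- split; [nra|]. apply Rmult_le_compat_l; [lra|]. apply pow_incr; lra.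
Qed.

Definition saw_err2 N v := saw_err N v - saw_osc N v.

Lemma saw_err2_derive N v : 0 < v <= / 2 ->
  is_derive (saw_err2 N) v (cos (odd_freq N * PI * v) * cos (PI * v) / (odd_freq N * (sin (PI * v))^2)).
Proof.
intros hv.
evar_last.
- exact (is_derive_minus (saw_err N) (saw_osc N) v _ _ (saw_err_derive N v hv) (saw_osc_derive N v hv)).
- unfold minus, plus, opp; simpl. ring.
Qed.

Lemma saw_err_half N : saw_err N (/ 2) = 0.
Proof. unfold saw_err; rewrite saw_half; ring. Qed.
Lemma saw_osc_half N : saw_osc N (/ 2) = 0.
Proof. unfold saw_osc; rewrite cos_half_odd. unfold Rdiv; ring. Qed.

(** The derivative of [saw_err2] is dominated by that of
    - 1 / ((2N+1) pi sin (pi v)), and [saw_err2] vanishes at 1/2. *)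
Lemma saw_err2_bound_first N v : 0 < v <= / 2 -> Rabs (saw_err2 N v) <= / (odd_freq N * PI * sin (PI * v)).
Proof.
intros hv. assert (hw := odd_freq_ge1 N). assert (hp := PI_RGT_0).
assert (A : Rabs (saw_err2 N v - saw_err2 N (/2)) <=
  / (odd_freq N * PI * sin (PI * v)) - / (odd_freq N * PI * sin (PI * (/ 2)))).
{ apply (dist_le_of_derive (saw_err2 N)
   (fun v => cos (odd_freq N * PI * v) * cos (PI * v) / (odd_freq N * (sin (PI * v))^2)) (fun z => / (odd_freq N * PI * sin (PI * z)))
   (fun z => - (cos (PI * z) / (odd_freq N * (sin (PI * z))^2))) v (/ 2)); [easy| | |].
  - intros z hz. apply saw_err2_derive; lra.
  - intros z hz. assert (hs := sin_PI_pos z ltac:(lra)). auto_derive.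
    + apply Rgt_not_eq. apply Rmult_pos3; lra.
    + field. repeat split; lra.
  - intros z hz. assert (hs := sin_PI_pos z ltac:(lra)). assert (hc := cos_PI_nonneg z ltac:(lra)).
    rewrite Ropp_involutive. apply Rabs_div_le.
    + rewrite Rabs_mult, (Rabs_pos_eq (cos (PI * z))) by lra.
      assert (a2 := Rabs_cos_le (odd_freq N * PI * z)). nra.
    + split; [nra|lra]. }
unfold saw_err2 at 2 in A. rewrite saw_err_half, saw_osc_half in A.
assert (hs := sin_PI_pos (/2) ltac:(lra)).
assert (0 < / (odd_freq N * PI * sin (PI * (/ 2)))) by (apply Rinv_0_lt_compat; apply Rmult_pos3; lra).
replace (saw_err2 N v - (0 - 0)) with (saw_err2 N v) in A by ring. lra.
Qed.

Lemma saw_err_bound N v : 0 < v <= / 2 -> Rabs (saw_err N v) <= / (odd_freq N * v).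
Proof.
intros hv. assert (hw := odd_freq_ge1 N). assert (hp := PI2_3_2).
assert (hs := sin_PI_pos v hv). assert (hs' := sin_PI_ge v ltac:(lra)).
assert (h := saw_err2_bound_first N v hv).
assert (h2 : Rabs (saw_osc N v) <= / (odd_freq N * PI * sin (PI * v))).
{ unfold saw_osc. replace (/ (odd_freq N * PI * sin (PI * v))) with (1 / (odd_freq N * PI * sin (PI * v)))
    by (unfold Rdiv; ring).
  apply Rabs_div_le; [apply Rabs_cos_le|]. split; [|lra].
  apply Rmult_pos3; lra. }
assert (h3 : / (odd_freq N * PI * sin (PI * v)) <= / (2 * (odd_freq N * v))).
{ apply Rinv_le_contravar; [nra|].
  replace (odd_freq N * PI * sin (PI * v)) with (odd_freq N * (PI * sin (PI * v))) by ring.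
  replace (2 * (odd_freq N * v)) with (odd_freq N * (2 * v)) by ring.
  apply Rmult_le_compat_l; [lra|]. apply Rmult_le_compat; lra. }
rewrite (Rinv_mult 2) in h3.
replace (saw_err N v) with (saw_err2 N v + saw_osc N v) by (unfold saw_err2; ring).
eapply Rle_trans; [apply Rabs_triang|]. lra.
Qed.

(** A second integration by parts: [T] is the next boundary term, and
    [saw_err2 N - T] has derivative O(1 / (N^2 z^3)).  The decay in 1 / v^2 is what
    makes this part of the error summable over m without any cancellation. *)
Lemma saw_err2_bound N v : 0 < v <= / 2 -> Rabs (saw_err2 N v) <= 2 / (odd_freq N * v) ^ 2.
Proof.
intros hv. assert (hw := odd_freq_ge1 N). assert (hp := PI2_3_2).
set (T z := sin (odd_freq N * PI * z) * cos (PI * z) / (odd_freq N ^ 2 * PI * (sin (PI * z))^2)).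
assert (A : Rabs ((saw_err2 N v - T v) - (saw_err2 N (/2) - T (/2))) <=
  3 / 2 / (odd_freq N * v) ^ 2 - 3 / 2 / (odd_freq N * / 2) ^ 2).
{ apply (dist_le_of_derive (fun z => saw_err2 N z - T z)
   (fun z => sin (odd_freq N * PI * z) * (1 + (cos (PI * z))^2) / (odd_freq N ^ 2 * (sin (PI * z))^3))
   (fun z => 3 / 2 / (odd_freq N * z) ^ 2)
   (fun z => - (3 / (odd_freq N ^ 2 * z ^ 3))) v (/ 2)); [lra| | |].
  - intros z hz. assert (hs := sin_PI_pos z ltac:(lra)).
    evar_last.
    + refine (is_derive_minus (saw_err2 N) T z _ _ (saw_err2_derive N z ltac:(lra)) _).
      unfold T. auto_derive; [|reflexivity].
      apply Rgt_not_eq. apply Rmult_pos3; [nra|lra|nra].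
    + unfold minus, plus, opp; simpl.
      assert (e := cos_sq_add_sin_sq (PI * z)).
      set (s := sin (PI * z)) in *. set (c := cos (PI * z)) in *.
      set (X := sin (odd_freq N * PI * z)). set (Y := cos (odd_freq N * PI * z)).
      transitivity (X * (s ^ 2 + 2 * c ^ 2) / (odd_freq N ^ 2 * s ^ 3)).
      { field. repeat split; lra. }
      f_equal. f_equal. lra.
  - intros z hz. assert (0 < odd_freq N * z) by nra. auto_derive; [apply Rgt_not_eq; nra|].
    field. split; nra.
  - intros z hz. assert (hs := sin_PI_pos z ltac:(lra)). assert (hs' := sin_PI_ge z ltac:(lra)).
    rewrite Ropp_involutive.
    assert (hz3 : 0 < z ^ 3) by (apply pow_lt; lra).
    assert (h4 : z ^ 3 <= sin (PI * z) ^ 3) by (apply pow_incr; lra).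
    apply Rabs_div_le; [|split; [apply Rmult_lt_0_compat; nra|apply Rmult_le_compat_l; nra]].
    assert (e := cos_sq_add_sin_sq (PI * z)).
    rewrite Rabs_mult.
    assert (a1 := Rabs_sin_le (odd_freq N * PI * z)). assert (a0 := Rabs_pos (sin (odd_freq N * PI * z))).
    assert (h7 : Rabs (1 + cos (PI * z) ^ 2) <= 3) by (apply Rabs_le; nra).
    assert (h8 := Rabs_pos (1 + cos (PI * z) ^ 2)). nra. }
assert (hT : Rabs (T v) <= / 2 / (odd_freq N * v) ^ 2).
{ assert (hs := sin_PI_pos v hv). assert (hs' := sin_PI_ge v ltac:(lra)).
  replace (/ 2 / (odd_freq N * v) ^ 2) with (1 / (2 * (odd_freq N * v) ^ 2)) by (field; lra).
  unfold T. apply Rabs_div_le.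
  - apply Rabs_mult_le1; [apply Rabs_sin_le|apply Rabs_cos_le].
  - split; [assert (0 < odd_freq N * v) by nra; nra|].
    assert (v ^ 2 <= sin (PI * v) ^ 2) by (apply pow_incr; lra).
    replace (odd_freq N ^ 2 * PI * sin (PI * v) ^ 2) with (odd_freq N ^ 2 * (PI * sin (PI * v) ^ 2)) by ring.
    replace (2 * (odd_freq N * v) ^ 2) with (odd_freq N ^ 2 * (2 * v ^ 2)) by ring.
    apply Rmult_le_compat_l; nra. }
assert (e1 : T (/ 2) = 0).
{ unfold T. replace (PI * / 2) with (PI / 2) by field. rewrite cos_PI2. unfold Rdiv; ring. }
assert (e2 : saw_err2 N (/ 2) = 0) by (unfold saw_err2; rewrite saw_err_half, saw_osc_half; ring).
rewrite e1, e2 in A.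
assert (h0 : 0 <= 3 / 2 / (odd_freq N * / 2) ^ 2) by (apply Rdiv_le_0_compat; nra).
replace (saw_err2 N v) with ((saw_err2 N v - T v - (0 - 0)) + T v) by ring.
eapply Rle_trans; [apply Rabs_triang|]. lra.
Qed.

(** * Trapezoidal sums of a power with imaginary exponent *)

Definition logstep (y : R) := ln (y + 1) - ln y.

(** With z = 1 / (2 y + 1) the quotient (1 + z) / (1 - z) is (y + 1) / y, so these
    are the midpoint and trapezoidal bounds for the integral of 1 / x over
    [y, y + 1]. *)
Lemma log_ratio_bounds z : 0 <= z < 1 ->
  2 * z <= ln (1 + z) - ln (1 - z) <= 2 * z / (1 - z ^ 2).
Proof.
intros hz. split.
- assert (A : (ln (1 + 0) - ln (1 - 0)) - 2 * 0 <= (ln (1 + z) - ln (1 - z)) - 2 * z).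
  { apply (incr_of_derive (fun z => (ln (1 + z) - ln (1 - z)) - 2 * z)
      (fun z => 2 / (1 - z ^ 2) - 2)); [lra| |].
    - intros y hy. auto_derive; [lra|]. field. split; nra.
    - intros y hy. assert (h : 2 / 1 <= 2 / (1 - y ^ 2)).
      { apply Rmult_le_compat_l; [lra|]. apply Rinv_le_contravar; nra. } lra. }
  rewrite Rplus_0_r, Rminus_0_r, ln_1 in A. lra.
- assert (A : 2 * 0 / (1 - 0 ^ 2) - (ln (1 + 0) - ln (1 - 0)) <=
     2 * z / (1 - z ^ 2) - (ln (1 + z) - ln (1 - z))).
  { apply (incr_of_derive (fun z => 2 * z / (1 - z ^ 2) - (ln (1 + z) - ln (1 - z)))
      (fun z => 4 * z ^ 2 / (1 - z ^ 2) ^ 2)); [lra| |].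
    - intros y hy. auto_derive; [repeat split; nra|]. field. repeat split; nra.
    - intros y hy. apply Rdiv_le_0_compat; [nra|]. apply pow_lt; nra. }
  rewrite Rplus_0_r, Rminus_0_r, ln_1 in A. replace (2 * 0 / (1 - 0 ^ 2)) with 0 in A by field. lra.
Qed.

Lemma logstep_bounds y : 0 < y ->
  / (y + / 2) <= logstep y <= (y + / 2) / (y * (y + 1)).
Proof.
intros hy. set (z := / (2 * y + 1)).
assert (hz : 0 < z) by (apply Rinv_0_lt_compat; lra).
assert (ez : z * (2 * y + 1) = 1) by (unfold z; field; lra).
assert (hz1 : z < 1) by nra.
assert (h := log_ratio_bounds z ltac:(lra)).
assert (e : ln (1 + z) - ln (1 - z) = logstep y).
{ unfold logstep. rewrite <- !ln_div by nra. f_equal. unfold z. field. split; nra. }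
rewrite e in h.
assert (e1 : 2 * z = / (y + / 2)) by (unfold z; field; lra).
assert (e2 : 2 * z / (1 - z ^ 2) = (y + / 2) / (y * (y + 1))).
{ unfold z. field. repeat split; try lra. nra. }
rewrite e1 in h at 1. rewrite e2 in h. easy.
Qed.

Lemma logstep_pos y : 0 < y -> 0 < logstep y <= / y.
Proof.
intros hy. assert (h := logstep_bounds y hy).
assert (0 < / (y + / 2)) by (apply Rinv_0_lt_compat; lra).
split; [lra|]. apply Rle_trans with (1 := proj2 h).
apply Rmult_le_reg_r with (y * (y + 1)); [nra|].
field_simplify; lra.
Qed.

Lemma logstep_decr x y : 0 < x <= y -> logstep y <= logstep x.
Proof.
intros h. unfold logstep. rewrite <- !ln_div by lra. 
apply ln_le; [apply Rdiv_lt_0_compat; lra|].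
apply Rmult_le_reg_r with (x * y); [nra|]. field_simplify; nra.
Qed.

Lemma exp_logstep y : 0 < y -> exp (logstep y) = (y + 1) / y.
Proof. intros h. unfold logstep. rewrite <- ln_div by lra. apply exp_ln, Rdiv_lt_0_compat; lra. Qed.

Lemma exp_half_ineq l : 0 <= l -> l * exp (l / 2) <= exp l - 1.
Proof.
intros hl.
assert (A : exp 0 - 1 - 0 * exp (0 / 2) <= exp l - 1 - l * exp (l / 2)).
{ apply (incr_of_derive (fun l => exp l - 1 - l * exp (l / 2))
    (fun l => exp (l / 2) * (exp (l / 2) - 1 - l / 2))); [easy| |].
  - intros z _. auto_derive; [easy|].
    assert (e : exp z = exp (z / 2) * exp (z / 2)) by (rewrite <- exp_plus; f_equal; field).
    rewrite e. unfold Rdiv. ring.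
  - intros z hz. assert (h := exp_ineq1_le (z / 2)). assert (h' := exp_pos (z / 2)). nra. }
rewrite exp_0, Rmult_0_l in A. lra.
Qed.

Lemma sin_le_id x : 0 <= x -> sin x <= x.
Proof.
intros h. assert (H := sin_diff_le 0 x h). rewrite sin_0 in H.
apply Rabs_le_between in H. lra.
Qed.

(** On [m, m + 1], the trapezoidal value minus the integral of x^(-it) equals
    [cot_defect t l] / (1 - it) times the increment of x^(-it), where
    l = ln (1 + 1 / m); note that 1 / (exp l - 1) = m. *)
Definition cot_defect (t l : R) := t / 2 * cos (t * l / 2) / sin (t * l / 2) - (/ 2 + / (exp l - 1)).

Lemma sin_small_pos x : 0 < x <= / 2 -> 0 < sin x.
Proof. intros h. assert (hp := PI2_3_2). apply sin_gt_0; lra. Qed.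

(** The derivative compares (t / 2)^2 / sin^2 (t l / 2), which is at least
    1 / l^2, with exp l / (exp l - 1)^2 = 1 / (4 sinh^2 (l / 2)), which is at most
    1 / l^2. *)
Lemma cot_defect_decr t l l' : 0 < t -> 0 < l' <= l -> t * l <= 1 -> cot_defect t l <= cot_defect t l'.
Proof.
intros ht hl htl.
assert (A : - cot_defect t l' <= - cot_defect t l); [|lra].
apply (incr_of_derive (fun l => - cot_defect t l)
  (fun l => (t / 2) ^ 2 / (sin (t * l / 2)) ^ 2 - exp l / (exp l - 1) ^ 2)); [easy| |].
- intros z hz. assert (hs := sin_small_pos (t * z / 2) ltac:(nra)).
  assert (he := exp_ineq1_le z).
  unfold cot_defect. auto_derive; [repeat split; nra|].
  assert (e := cos_sq_add_sin_sq (t * z / 2)). unfold Rdiv in *.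
  set (s := sin _) in *. set (c := cos _) in *.
  transitivity ((t * / 2) ^ 2 * (c ^ 2 + s ^ 2) * / s ^ 2 - exp z * / (exp z - 1) ^ 2).
  + field. split; lra.
  + rewrite e, Rmult_1_r. reflexivity.
- intros z hz. assert (hs := sin_small_pos (t * z / 2) ltac:(nra)).
  assert (he := exp_ineq1_le z). assert (hsx := sin_le_id (t * z / 2) ltac:(nra)).
  assert (h1 : / z ^ 2 <= (t / 2) ^ 2 / (sin (t * z / 2)) ^ 2).
  { replace (/ z ^ 2) with ((t / 2) ^ 2 / (t * z / 2) ^ 2) by (field; lra).
    apply Rmult_le_compat_l; [nra|]. apply Rinv_le_contravar; [nra|]. apply pow_incr; lra. }
  assert (h2 : exp z / (exp z - 1) ^ 2 <= / z ^ 2).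
  { assert (h3 := exp_half_ineq z ltac:(lra)).
    assert (e : exp z = exp (z / 2) * exp (z / 2)) by (rewrite <- exp_plus; f_equal; field).
    assert (h4 := exp_pos (z / 2)).
    assert (h5 : (z * exp (z / 2)) ^ 2 <= (exp z - 1) ^ 2) by (apply pow_incr; nra).
    apply Rmult_le_reg_r with (z ^ 2 * (exp z - 1) ^ 2); [apply Rmult_lt_0_compat; apply pow_lt; lra|].
    replace (exp z / (exp z - 1) ^ 2 * (z ^ 2 * (exp z - 1) ^ 2)) with (z ^ 2 * exp z) by (field; lra).
    replace (/ z ^ 2 * (z ^ 2 * (exp z - 1) ^ 2)) with ((exp z - 1) ^ 2) by (field; lra).
    rewrite e at 1. lra. }
  lra.
Qed.

Lemma cot_bounds x : 0 < x <= / 2 -> 1 - x ^ 2 <= x * cos x / sin x <= 1.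
Proof.
intros hx. assert (hs := sin_small_pos x hx). assert (hp := PI2_3_2).
split.
- apply Rmult_le_reg_r with (sin x); [easy|].
  unfold Rdiv; rewrite Rmult_assoc, Rinv_l, Rmult_1_r by lra.
  assert (A : 0 * cos 0 - (1 - 0 ^ 2) * sin 0 <= x * cos x - (1 - x ^ 2) * sin x).
  { apply (incr_of_derive (fun x => x * cos x - (1 - x ^ 2) * sin x)
      (fun x => x ^ 2 * cos x + x * sin x)); [lra| |].
    - intros z _. auto_derive; [easy|ring].
    - intros z hz. assert (0 <= sin z) by (apply sin_ge_0; lra).
      assert (0 <= cos z) by (apply cos_ge_0; lra). nra. }
  rewrite sin_0 in A. lra.
- apply Rmult_le_reg_r with (sin x); [easy|].
  unfold Rdiv; rewrite Rmult_assoc, Rinv_l, Rmult_1_r by lra.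
  assert (A : sin 0 - 0 * cos 0 <= sin x - x * cos x).
  { apply (incr_of_derive (fun x => sin x - x * cos x) (fun x => x * sin x)); [lra| |].
    - intros z _. auto_derive; [easy|ring].
    - intros z hz. assert (0 <= sin z) by (apply sin_ge_0; lra). nra. }
  rewrite sin_0 in A. lra.
Qed.

Lemma cot_defect_bounds t y : 0 < t <= y ->
  - ((1 + t ^ 2) / (4 * y)) <= cot_defect t (logstep y) <= 0.
Proof.
intros h. assert (hl := logstep_pos y ltac:(lra)). assert (hb := logstep_bounds y ltac:(lra)).
unfold cot_defect. rewrite exp_logstep by lra.
replace (/ ((y + 1) / y - 1)) with y by (field; lra).
set (l := logstep y) in *.
assert (htl : t * l <= 1).
{ apply Rle_trans with (y * / y); [apply Rmult_le_compat; lra|]. rewrite Rinv_r; lra. }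
assert (hc := cot_bounds (t * l / 2) ltac:(nra)).
assert (hs := sin_small_pos (t * l / 2) ltac:(nra)).
set (X := t * l / 2 * cos (t * l / 2) / sin (t * l / 2)) in *.
replace (t / 2 * cos (t * l / 2) / sin (t * l / 2)) with (/ l * X) by (unfold X; field; lra).
assert (hil : 0 < / l) by (apply Rinv_0_lt_compat; lra).
assert (u : / l <= y + / 2).
{ rewrite <- (Rinv_inv (y + / 2)). apply Rinv_le_contravar; [apply Rinv_0_lt_compat|]; lra. }
assert (v : y + / 2 - / (4 * y + 2) <= / l).
{ apply Rle_trans with (/ ((y + / 2) / (y * (y + 1)))).
  - right. field. lra.
  - apply Rinv_le_contravar; lra. }
split; [|nra].
assert (w : / l * (1 - (t * l / 2) ^ 2) <= / l * X) by (apply Rmult_le_compat_l; lra).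
replace (/ l * (1 - (t * l / 2) ^ 2)) with (/ l - t ^ 2 * l / 4) in w by (field; lra).
assert (t ^ 2 * l <= t ^ 2 * / y) by (apply Rmult_le_compat_l; nra).
assert (/ (4 * y + 2) <= / (4 * y)) by (apply Rinv_le_contravar; lra).
replace ((1 + t ^ 2) / (4 * y)) with (/ (4 * y) + t ^ 2 * / y / 4) by (field; lra).
lra.
Qed.

(** Minus the imaginary part of
    sum_(m <= M) m^(-it) - M^(-it) / 2 - M^(1 - it) / (1 - it). *)
Definition zeta_im_trap (t : R) (M : nat) :=
  psum (fun m => sin (t * ln (INR (S m)))) M - / 2 * sin (t * ln (INR M))
  + INR M * (t * cos (t * ln (INR M)) - sin (t * ln (INR M))) / (1 + t ^ 2).

Definition trap_phase t M := sin (t * ln (INR M)) - t * cos (t * ln (INR M)).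

Lemma zeta_im_trap_step t M : 0 < t <= INR M ->
  zeta_im_trap t (S M) - zeta_im_trap t M =
  cot_defect t (logstep (INR M)) * (trap_phase t (S M) - trap_phase t M) / (1 + t ^ 2).
Proof.
intros h. unfold zeta_im_trap, trap_phase. rewrite psum_S, !S_INR.
set (y := INR M) in *.
assert (hl := logstep_pos y ltac:(lra)).
unfold cot_defect. rewrite exp_logstep by lra.
replace (/ ((y + 1) / y - 1)) with y by (field; lra).
set (l := logstep y) in *.
assert (htl : t * l <= 1).
{ apply Rle_trans with (y * / y); [apply Rmult_le_compat; lra|]. rewrite Rinv_r; lra. }
assert (hs := sin_small_pos (t * l / 2) ltac:(nra)).
set (m := t * ln y + t * l / 2).
replace (t * ln y) with (m - t * l / 2) by (unfold m; ring).
replace (t * ln (y + 1)) with (m + t * l / 2) by (unfold m, l, logstep; field).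
rewrite sin_plus, sin_minus, cos_plus, cos_minus.
assert (ht : 0 < 1 + t ^ 2) by nra.
field. split; lra.
Qed.

(** The increments are those of a bounded sequence times the weights
    [cot_defect], which are monotone in m; summation by parts leaves only the
    first weight, of size (1 + t^2) / M. *)
Lemma zeta_im_trap_cauchy t M n : 0 < t <= INR M ->
  Rabs (zeta_im_trap t (M + n) - zeta_im_trap t M) <= (1 + t) / (2 * INR M).
Proof.
intros h.
assert (ht : 0 < 1 + t ^ 2) by nra.
assert (e : zeta_im_trap t (M + n) - zeta_im_trap t M =
  - (psum (fun i => - cot_defect t (logstep (INR (M + i))) *
     (trap_phase t (M + S i) - trap_phase t (M + i))) n) / (1 + t ^ 2)).
{ clear -h ht. induction n as [|n IH]; [rewrite Nat.add_0_r; simpl; field; lra|].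
  rewrite psum_S, Nat.add_succ_r.
  assert (hn : INR M <= INR (M + n)) by (apply le_INR; lia).
  assert (e := zeta_im_trap_step t (M + n) ltac:(lra)).
  replace (zeta_im_trap t (S (M + n)) - zeta_im_trap t M) with
   ((zeta_im_trap t (S (M + n)) - zeta_im_trap t (M + n)) + (zeta_im_trap t (M + n) - zeta_im_trap t M)) by ring.
  rewrite e, IH. field. lra. }
rewrite e. unfold Rdiv. rewrite Rabs_mult, Rabs_Ropp.
assert (hz : forall i, Rabs (trap_phase t i) <= 1 + t).
{ intros i. unfold trap_phase, Rminus. eapply Rle_trans; [apply Rabs_triang|].
  rewrite Rabs_Ropp, Rabs_mult, (Rabs_pos_eq t) by lra.
  assert (a := Rabs_sin_le (t * ln (INR i))). assert (b := Rabs_cos_le (t * ln (INR i))). nra. }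
assert (hb : forall i, - ((1 + t ^ 2) / (4 * INR (M + i))) <= cot_defect t (logstep (INR (M + i))) <= 0).
{ intros i. apply cot_defect_bounds. assert (INR M <= INR (M + i)) by (apply le_INR; lia). lra. }
assert (B : Rabs (psum (fun i => - cot_defect t (logstep (INR (M + i))) *
     (trap_phase t (M + S i) - trap_phase t (M + i))) n)
  <= 0 * psum (fun i => - cot_defect t (logstep (INR (M + i)))) n
     + 2 * (1 + t) * (- cot_defect t (logstep (INR (M + 0))))).
{ apply (psum_abel (fun i => - cot_defect t (logstep (INR (M + i))))
    (fun i => trap_phase t (M + S i) - trap_phase t (M + i))).
  - lra.
  - lra.
  - assert (a := hb 0%nat); lra.
  - intros i _; assert (a := hb i); lra.
  - intros i _. apply Ropp_le_contravar.
    assert (hi : INR M <= INR (M + i)) by (apply le_INR; lia).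
    assert (hi' : INR (M + i) <= INR (M + S i)) by (apply le_INR; lia).
    assert (a := logstep_pos (INR (M + i)) ltac:(lra)).
    assert (a' := logstep_pos (INR (M + S i)) ltac:(lra)).
    apply cot_defect_decr; [lra| |].
    + split; [lra|]. apply logstep_decr; lra.
    + apply Rle_trans with (INR (M + i) * / INR (M + i)).
      * apply Rmult_le_compat; lra.
      * rewrite Rinv_r; lra.
  - intros i _. rewrite (psum_telescope (fun i => trap_phase t (M + i))).
    rewrite Nat.add_0_r. unfold Rminus. rewrite Rmult_0_l, Rplus_0_l.
    eapply Rle_trans; [apply Rabs_triang|]. rewrite Rabs_Ropp.
    assert (a := hz (M + i)%nat). assert (b := hz M). lra. }
rewrite Nat.add_0_r in B. assert (b0 := hb 0%nat). rewrite Nat.add_0_r in b0.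
rewrite Rabs_inv, (Rabs_pos_eq (1 + t ^ 2)) by lra.
apply Rmult_le_reg_r with (1 + t ^ 2); [lra|].
rewrite Rmult_assoc, Rinv_l, Rmult_1_r by lra.
apply Rle_trans with (2 * (1 + t) * ((1 + t ^ 2) / (4 * INR M))).
- assert (2 * (1 + t) * - cot_defect t (logstep (INR M)) <= 2 * (1 + t) * ((1 + t ^ 2) / (4 * INR M))).
  { apply Rmult_le_compat_l; lra. } lra.
- right. field. lra.
Qed.

(** * The integral of the partial sums *)

Ltac eq_in_R := match goal with |- ?a = ?b => change (@eq R a b) end; cbv beta.

(** The n-th point of the sum is the argument i [zeta_height L n] of zeta. *)
Definition zeta_height (L : R) (n : nat) := 2 * PI / L * INR n.

(** The value F(v) for which exp (L v) F(v) is the integral of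
    L exp (L w) saw(w) over w <= v.  With x = exp (L w) this is the integral of
    saw (ln x / L) over 0 < x <= exp (L v). *)
Definition smooth_saw (L : R) (N : nat) (v : R) :=
  psum (fun n => (sin (2 * PI * INR (S n) * v) - zeta_height L (S n) * cos (2 * PI * INR (S n) * v))
                 / ((1 + zeta_height L (S n) ^ 2) * (PI * INR (S n)))) N.

Lemma exp_smooth_saw_derive L N v : 0 < L ->
  is_derive (fun v => exp (L * v) * smooth_saw L N v) v (L * exp (L * v) * saw N v).
Proof.
intros hL. induction N as [|N IH].
- apply is_derive_ext with (fun _ => 0).
  { intros z. unfold smooth_saw; simpl. eq_in_R; ring. }
  unfold saw; simpl. rewrite Rmult_0_r. apply (is_derive_const 0).
- apply is_derive_ext with (fun v => exp (L * v) * smooth_saw L N v +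
    exp (L * v) * ((sin (2 * PI * INR (S N) * v) - zeta_height L (S N) * cos (2 * PI * INR (S N) * v))
                 / ((1 + zeta_height L (S N) ^ 2) * (PI * INR (S N))))).
  { intros z. unfold smooth_saw; rewrite psum_S. eq_in_R; ring. }
  evar_last.
  + refine (is_derive_plus _ _ v _ _ IH _).
    set (y := INR (S N)). set (f := zeta_height L (S N)).
    auto_derive; [easy|reflexivity].
  + unfold saw; rewrite psum_S. unfold plus; simpl.
    rewrite Rmult_plus_distr_l. f_equal.
    set (y := match N with O => 1 | S _ => INR N + 1 end).
    assert (hy : 0 < y) by (change (0 < INR (S N)); apply lt_0_INR; lia).
    assert (hp := PI_RGT_0). unfold zeta_height. change (INR (S N)) with y.
    assert (h := pow2_ge_0 (2 * PI / L * y)).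
    assert (h1 : 0 < L * L + 4 * (PI * PI) * (y * y)).
    { assert (0 <= (PI * y) * (PI * y)) by (apply Rle_0_sqr). nra. }
    field. repeat split; nra.
Qed.

Lemma smooth_saw_half_opp L N : smooth_saw L N (- / 2) = smooth_saw L N (/ 2).
Proof.
unfold smooth_saw. apply psum_ext; intros i _.
replace (2 * PI * INR (S i) * / 2) with (INR (S i) * PI) by field.
replace (2 * PI * INR (S i) * - / 2) with (- (INR (S i) * PI)) by field.
rewrite cos_neg, sin_neg.
assert (h : sin (INR (S i) * PI) = 0).
{ apply sin_eq_0_1. exists (Z.of_nat (S i)). now rewrite <- INR_IZR_INZ. }
rewrite h. f_equal. ring.
Qed.

Lemma saw_opp N v : saw N (- v) = - saw N v.
Proof.
unfold saw. replace (- psum (fun n => sin (2 * PI * INR (S n) * v) / (PI * INR (S n))) N) with (-1 * psum (fun n => sin (2 * PI * INR (S n) * v) / (PI * INR (S n))) N) by ring.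
rewrite <- psum_scal. apply psum_ext; intros i _.
rewrite Ropp_mult_distr_r_reverse, sin_neg. unfold Rdiv. ring.
Qed.

(** Near 0 the bound 1 / (N v) for [saw_err] is not integrable.  Taking the
    difference of the values at v and at - v replaces the density exp (L v) by
    exp (L v) - exp (- L v), which vanishes at 0, and the points 1/2 and - 1/2 are
    equivalent modulo the period. *)
Lemma smooth_saw_half L N : 0 < L ->
  Rabs ((exp (L / 2) - exp (- (L / 2))) * (smooth_saw L N (/ 2) - / L) + 1)
  <= L ^ 2 * exp (L / 2) / odd_freq N.
Proof.
intros hL. assert (hw := odd_freq_ge1 N).
set (D := 2 * L ^ 2 * exp (L / 2) / odd_freq N).
set (Phi v := (exp (L * v) * smooth_saw L N v - exp (L * v) * (/ 2 - v + / L))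
   - (exp (L * - v) * smooth_saw L N (- v) - exp (L * - v) * (- / 2 + v + / L)) + 1).
assert (hPhi : Rabs (Phi 0 - Phi (/ 2)) <= - D * 0 - (- D * / 2)).
{ apply (dist_le_of_derive Phi
   (fun v => - L * (exp (L * v) - exp (- (L * v))) * saw_err N v) (fun v => - D * v) (fun _ => - D) 0 (/ 2)).
  - lra.
  - intros v hv. unfold Phi.
    apply is_derive_ext with (fun v => (exp (L * v) * smooth_saw L N v
      - (fun w => exp (L * w) * smooth_saw L N w) (- v))
      + (- exp (L * v) * (/ 2 - v + / L) + exp (L * - v) * (- / 2 + v + / L) + 1)).
    { intros z; eq_in_R; ring. }
    evar_last.
    + refine (is_derive_plus _ _ v _ _ _ _).
      * refine (is_derive_minus _ _ v _ _ (exp_smooth_saw_derive L N v hL) _).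
        refine (is_derive_comp (fun w => exp (L * w) * smooth_saw L N w) Ropp v _ _
           (exp_smooth_saw_derive L N (- v) hL) _).
        instantiate (1 := -1). auto_derive; [easy|ring].
      * auto_derive; [easy|reflexivity].
    + unfold plus, minus, plus, opp, scal; simpl. unfold mult; simpl.
      rewrite saw_opp. unfold saw_err.
      replace (L * - v) with (- (L * v)) by ring. field. lra.
  - intros v _. auto_derive; [easy|ring].
  - intros v hv. rewrite Ropp_involutive.
    destruct (Req_dec v 0) as [->|hv0].
    + rewrite Rmult_0_r, Ropp_0, Rminus_diag, Rmult_0_r, Rmult_0_l, Rabs_R0.
      unfold D. assert (he := exp_pos (L / 2)). apply Rdiv_le_0_compat; [|lra].
      assert (0 <= L ^ 2) by nra. nra.
    + assert (hr := saw_err_bound N v ltac:(lra)).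
      assert (hLv : 0 <= L * v) by nra.
      assert (e1 := exp_ineq1_le (L * v)). assert (e2 := exp_ineq1_le (- (L * v))).
      assert (ep := exp_pos (L * v)).
      assert (ee : exp (L * v) * exp (- (L * v)) = 1)
        by (rewrite <- exp_plus; replace (L * v + - (L * v)) with 0 by ring; apply exp_0).
      assert (e3 : exp (L * v) <= exp (L / 2)).
      { destruct (Req_dec v (/ 2)) as [->|]; [right; f_equal; field|].
        left; apply exp_increasing. nra. }
      assert (e4 : 1 <= exp (L / 2)) by lra.
      assert (hd : 0 <= exp (L * v) - exp (- (L * v)) <= 2 * (L * v) * exp (L / 2)).
      { split; [nra|].
        assert (exp (L * v) - 1 <= L * v * exp (L * v)) by nra. nra. }
      assert (0 < / (odd_freq N * v)) by (apply Rinv_0_lt_compat; nra).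
      rewrite !Rabs_mult, Rabs_Ropp, (Rabs_pos_eq L), (Rabs_pos_eq (_ - _)) by lra.
      unfold D. replace (2 * L ^ 2 * exp (L / 2) / odd_freq N) with
         (L * (2 * (L * v) * exp (L / 2)) * / (odd_freq N * v)) by (field; lra).
      apply Rmult_le_compat; [|apply Rabs_pos| |lra].
      * apply Rmult_le_pos; lra.
      * apply Rmult_le_compat_l; lra. }
assert (e0 : Phi 0 = 0).
{ unfold Phi. rewrite Ropp_0, Rmult_0_r, exp_0. field. lra. }
assert (e1 : Phi (/ 2) = (exp (L / 2) - exp (- (L / 2))) * (smooth_saw L N (/ 2) - / L) + 1).
{ unfold Phi. rewrite smooth_saw_half_opp.
  replace (L * / 2) with (L / 2) by field. replace (L * - / 2) with (- (L / 2)) by field. ring. }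
rewrite e0, e1 in hPhi.
replace (L ^ 2 * exp (L / 2) / odd_freq N) with (- D * 0 - - D * / 2) by (unfold D; field; lra).
rewrite <- Rabs_Ropp. rewrite <- (Rminus_0_l (_ + 1)). exact hPhi.
Qed.

(** The limit of [smooth_saw L N v] for v in [0, 1]; the constant of
    integration is fixed by equality of the values at 0 and 1. *)
Definition smooth_saw_lim (L v : R) := / 2 - v + / L - exp (L * (1 - v)) / (exp L - 1).

(** From 1/2, where [smooth_saw_half] applies, one goes down to v by
    integrating [saw_err], which is O(1 / N) away from 0. *)
Lemma smooth_saw_approx L c : 0 < L -> 0 < c ->
  exists C, 0 < C /\ forall N v, c <= v <= / 2 ->
  Rabs (smooth_saw L N v - smooth_saw_lim L v) <= C / odd_freq N.
Proof.
intros hL hc.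
set (h := exp (L / 2)).
assert (hh : 1 < h) by (unfold h; rewrite <- exp_0; apply exp_increasing; lra).
set (C1 := L * h / c / 2). set (C2 := h ^ 2 / (h ^ 2 - 1) * (L ^ 2 * h)).
assert (hh2 : 0 < h ^ 2 - 1) by nra.
assert (hC1 : 0 < C1). { unfold C1. repeat apply Rdiv_lt_0_compat; nra. }
assert (hC2 : 0 < C2). { unfold C2. apply Rmult_lt_0_compat; [apply Rdiv_lt_0_compat; nra|]. 
  apply Rmult_lt_0_compat; [apply pow_lt|]; lra. }
exists (C1 + C2). split; [lra|]. intros N v hv. assert (hw := odd_freq_ge1 N).
assert (ehL : exp L = h ^ 2).
{ unfold h. simpl. rewrite Rmult_1_r, <- exp_plus. f_equal; field. }
set (E v := exp (L * v) * smooth_saw L N v - exp (L * v) * (/ 2 - v + / L) + h ^ 2 / (h ^ 2 - 1)).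
set (D := L * h / c / odd_freq N).
assert (hD : 0 < D) by (unfold D; repeat apply Rdiv_lt_0_compat; nra).
assert (hE : Rabs (E v - E (/ 2)) <= - D * v - (- D * / 2)).
{ apply (dist_le_of_derive E (fun v => - L * exp (L * v) * saw_err N v)
    (fun v => - D * v) (fun _ => - D) v (/ 2)); [lra| | |].
  - intros z hz. unfold E.
    apply is_derive_ext with (fun v => exp (L * v) * smooth_saw L N v +
       (- exp (L * v) * (/ 2 - v + / L) + h ^ 2 / (h ^ 2 - 1))).
    { intros; eq_in_R; ring. }
    evar_last.
    + refine (is_derive_plus _ _ z _ _ (exp_smooth_saw_derive L N z hL) _).
      auto_derive; [easy|reflexivity].
    + unfold plus; simpl. unfold saw_err. field. lra.
  - intros z _. auto_derive; [easy|ring].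
  - intros z hz. rewrite Ropp_involutive.
    assert (hr := saw_err_bound N z ltac:(lra)).
    assert (e3 : exp (L * z) <= h).
    { unfold h. destruct (Req_dec z (/ 2)) as [->|]; [right; f_equal; field|].
        left; apply exp_increasing. nra. }
    assert (ep := exp_pos (L * z)).
    rewrite !Rabs_mult, Rabs_Ropp, (Rabs_pos_eq L), (Rabs_pos_eq (exp _)) by lra.
    unfold D. replace (L * h / c / odd_freq N) with (L * h * / (odd_freq N * c)) by (field; lra).
    assert (/ (odd_freq N * z) <= / (odd_freq N * c)) by (apply Rinv_le_contravar; nra).
    apply Rmult_le_compat; [nra|apply Rabs_pos|nra|lra]. }
assert (hE2 : Rabs (E (/ 2)) <= C2 / odd_freq N).
{ assert (H := smooth_saw_half L N hL). fold h in H.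
  assert (eh : exp (- (L / 2)) = / h) by (unfold h; apply exp_Ropp).
  rewrite eh in H.
  replace (E (/ 2)) with (h ^ 2 / (h ^ 2 - 1) * ((h - / h) * (smooth_saw L N (/ 2) - / L) + 1)).
  - assert (0 < h ^ 2 / (h ^ 2 - 1)) by (apply Rdiv_lt_0_compat; nra).
    rewrite Rabs_mult, Rabs_pos_eq by lra. unfold C2.
    replace (h ^ 2 / (h ^ 2 - 1) * (L ^ 2 * h) / odd_freq N) with (h ^ 2 / (h ^ 2 - 1) * (L ^ 2 * h / odd_freq N))
      by (field; lra).
    apply Rmult_le_compat_l; lra.
  - unfold E. replace (L * / 2) with (L / 2) by field. fold h. field. lra. }
assert (eE : smooth_saw L N v - smooth_saw_lim L v = exp (- (L * v)) * E v).
{ unfold E, smooth_saw_lim. rewrite ehL.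
  replace (L * (1 - v)) with (L + - (L * v)) by ring. rewrite exp_plus, ehL.
  rewrite exp_Ropp. assert (ep := exp_pos (L * v)). field. lra. }
rewrite eE, Rabs_mult, (Rabs_pos_eq (exp _)) by (left; apply exp_pos).
assert (hx : exp (- (L * v)) <= 1).
{ rewrite <- exp_0. left; apply exp_increasing. nra. }
assert (hx0 := exp_pos (- (L * v))).
assert (hEv : Rabs (E v) <= (C1 + C2) / odd_freq N).
{ replace (E v) with ((E v - E (/ 2)) + E (/ 2)) by ring.
  eapply Rle_trans; [apply Rabs_triang|].
  replace ((C1 + C2) / odd_freq N) with (D / 2 + C2 / odd_freq N) by (unfold D, C1; field; lra). nra. }
assert (h0 := Rabs_pos (E v)). nra.
Qed.

(** * Cosine sums with logarithmic phase *)

Lemma ln_le_sub1 x : 0 < x -> ln x <= x - 1.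
Proof. intros h. assert (H := exp_ineq1_le (ln x)). rewrite exp_ln in H by easy. lra. Qed.

Lemma ln_ge_1_sub_inv x : 0 < x -> 1 - / x <= ln x.
Proof.
intros h. assert (H := ln_le_sub1 (/ x) (Rinv_0_lt_compat x h)). rewrite ln_Rinv in H by easy. lra.
Qed.

Lemma logstep_gap y : 0 < y -> / (y + 1) ^ 2 <= logstep y - logstep (y + 1).
Proof.
intros h. unfold logstep. replace (y + 1 + 1) with (y + 2) by ring.
replace (ln (y + 1) - ln y - (ln (y + 2) - ln (y + 1))) with (ln ((y + 1) / y / ((y + 2) / (y + 1)))).
- eapply Rle_trans; [|apply ln_ge_1_sub_inv].
  + right. field. lra.
  + repeat apply Rdiv_lt_0_compat; lra.
- rewrite !ln_div; try lra; apply Rdiv_lt_0_compat; lra.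
Qed.

Lemma logstep_range y d : 0 < y -> 0 <= d -> logstep y - logstep (y + d) <= d / y ^ 2.
Proof.
intros h hd. unfold logstep.
replace (ln (y + 1) - ln y - (ln (y + d + 1) - ln (y + d))) with
  (ln ((y + 1) / y / ((y + d + 1) / (y + d)))).
- eapply Rle_trans; [apply ln_le_sub1; repeat apply Rdiv_lt_0_compat; lra|].
  replace ((y + 1) / y / ((y + d + 1) / (y + d)) - 1) with (d / (y * (y + d + 1))) by (field; lra).
  unfold Rdiv; apply Rmult_le_compat_l; [easy|]. apply Rinv_le_contravar; nra.
- rewrite !ln_div; try lra; apply Rdiv_lt_0_compat; lra.
Qed.

(** On the range between K / k and k K the half-increments of w ln have gaps at
    least w / (2 k^2 K^2) = 1 / r^2 and total variation O(w n / K^2). *)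
Lemma cos_log_sum_bound k K w th a n :
  1 <= k -> 0 < K -> 0 < w -> K / k <= INR a -> INR (a + n) - 1 <= k * K ->
  Rabs (psum (fun i => cos (w * ln (INR (a + i)) + th)) n) <=
  20 * k ^ 3 * sqrt w / K * INR n + 20 * k ^ 3 * (K / sqrt w).
Proof.
intros hk hK hw ha hb.
assert (hs : 0 < sqrt w) by now apply sqrt_lt_R0.
assert (ew : sqrt w * sqrt w = w) by (apply sqrt_sqrt; lra).
set (s := sqrt w) in *.
assert (hk3 : 1 <= k ^ 3) by (apply pow_R1_Rle; lra).
assert (hn0 := pos_INR n).
assert (h1 : 0 < K / s) by now apply Rdiv_lt_0_compat.
assert (h2 : 0 < s / K) by now apply Rdiv_lt_0_compat.
assert (ha0 : 0 < INR a) by (assert (0 < K / k) by (apply Rdiv_lt_0_compat; lra); lra).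
(* For s > K the phase varies so fast that the number of terms is within the
   bound. *)
destruct (Rle_dec s K) as [hle|hgt].
2:{
  apply Rle_trans with (INR n).
  - eapply Rle_trans; [apply (psum_abs_le _ (fun _ => 1)); intros; apply Rabs_cos_le|].
    rewrite psum_const; lra.
  - assert (1 <= s / K).
    { apply Rmult_le_reg_r with K; [easy|]. field_simplify; lra. }
    assert (1 <= k ^ 3 * (s / K)) by nra.
    assert (0 <= k ^ 3 * (K / s)) by nra.
    replace (20 * k ^ 3 * s / K * INR n) with (20 * (k ^ 3 * (s / K)) * INR n) by (field; lra).
    nra. }
destruct n as [|n].
{ simpl psum. rewrite Rabs_R0. simpl INR. nra. }
set (f i := - (w * ln (INR (a + i)) + th)).
assert (hR2 : 0 < sqrt 2) by (apply sqrt_lt_R0; lra).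
assert (eR2 : sqrt 2 * sqrt 2 = 2) by (apply sqrt_sqrt; lra).
set (r := sqrt 2 * k * (K / s)).
assert (er : r ^ 2 = 2 * k ^ 2 * K ^ 2 / w).
{ unfold r. rewrite <- ew. replace ((sqrt 2 * k * (K / s)) ^ 2) with ((sqrt 2 * sqrt 2) * k ^ 2 * K ^ 2 / (s * s)) by (field; lra).
  rewrite eR2. field. lra. }
assert (hKs : 1 <= K / s).
{ apply Rmult_le_reg_r with s; [easy|]. field_simplify; lra. }
assert (hR : 1 <= sqrt 2 <= 3 / 2) by nra.
assert (hr1 : 1 <= r). { unfold r. assert (1 <= sqrt 2 * k) by nra. nra. }
assert (hr2 : 2 <= r ^ 2).
{ unfold r. replace ((sqrt 2 * k * (K / s)) ^ 2) with ((sqrt 2 * sqrt 2) * (k * (K / s)) ^ 2) by ring.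
  rewrite eR2. assert (1 <= k * (K / s)) by nra. nra. }
assert (hx : forall i, (f (S i) - f i) / 2 = - (w / 2 * logstep (INR (a + i)))).
{ intros i. unfold f, logstep. rewrite Nat.add_succ_r, S_INR. field. }
assert (hpos : forall i, INR a <= INR (a + i)) by (intros; apply le_INR; lia).
assert (V := second_derivative_test r f n hr1 hr2).
assert (V' : Rabs (psum (fun i => cos (f i) + cos (f (S i))) (S n)) <=
   3 * r + 5 * r * (((f (S n) - f n) / 2) - ((f 1%nat - f 0%nat) / 2) + PI)).
{ apply V. intros i hi. rewrite !hx, er.
  assert (hp := hpos i).
  rewrite Nat.add_succ_r, S_INR.
  assert (g := logstep_gap (INR (a + i)) ltac:(lra)).
  assert (hi' : INR (a + i) + 1 <= k * K).
  { rewrite <- S_INR. apply Rle_trans with (INR (a + S n) - 1); [|easy].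
    assert (INR (S (a + i)) + 1 <= INR (a + S n)) by (rewrite <- S_INR; apply le_INR; lia). lra. }
  assert (/ (k * K) ^ 2 <= / (INR (a + i) + 1) ^ 2).
  { apply Rinv_le_contravar; [apply pow_lt; lra|]. apply pow_incr; lra. }
  replace (/ (2 * k ^ 2 * K ^ 2 / w)) with (w / 2 * / (k * K) ^ 2) by (field; lra).
  assert (w / 2 * / (k * K) ^ 2 <= w / 2 * (logstep (INR (a + i)) - logstep (INR (a + i) + 1))) by (apply Rmult_le_compat_l; lra). lra. }
rewrite !hx, Nat.add_0_r in V'.
assert (g := logstep_range (INR a) (INR n) ha0 (pos_INR n)). rewrite <- plus_INR in g.
assert (hX : INR n / INR a ^ 2 <= INR n * (k ^ 2 / K ^ 2)).
{ unfold Rdiv. apply Rmult_le_compat_l; [apply pos_INR|].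
  replace (k ^ 2 * / K ^ 2) with (/ (K / k) ^ 2) by (field; lra).
  apply Rinv_le_contravar; [apply pow_lt, Rdiv_lt_0_compat; lra|].
  apply pow_incr. split; [left; apply Rdiv_lt_0_compat; lra|easy]. }
assert (V2 : Rabs (psum (fun i => cos (f i) + cos (f (S i))) (S n)) <=
   3 * r + 5 * r * (w / 2 * (INR n * (k ^ 2 / K ^ 2)) + 4)).
{ eapply Rle_trans; [exact V'|]. assert (hPI := PI_4).
  apply Rplus_le_compat_l, Rmult_le_compat_l; [lra|].
  apply Rplus_le_compat; [|lra]. nra. }
assert (esum : psum (fun i => cos (w * ln (INR (a + i)) + th)) (S n) =
   / 2 * psum (fun i => cos (f i) + cos (f (S i))) (S n) + / 2 * (cos (f 0%nat) - cos (f (S n)))).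
{ assert (e : forall m, psum (fun i => cos (w * ln (INR (a + i)) + th)) m =
   / 2 * psum (fun i => cos (f i) + cos (f (S i))) m + / 2 * (cos (f 0%nat) - cos (f m))).
  { induction m as [|m IH]; [simpl; lra|]. rewrite !psum_S, IH.
    assert (ec : cos (w * ln (INR (a + m)) + th) = cos (f m)) by (unfold f; now rewrite cos_neg).
    rewrite ec. lra. }
  apply e. }
rewrite esum.
assert (hends : Rabs (/ 2 * (cos (f 0%nat) - cos (f (S n)))) <= 1).
{ assert (a1 := COS_bound (f 0%nat)). assert (a2 := COS_bound (f (S n))). apply Rabs_le; lra. }
eapply Rle_trans; [apply Rabs_triang|].
rewrite Rabs_mult, (Rabs_pos_eq (/ 2)) by lra.
assert (hrb : r <= 3 / 2 * k * (K / s)) by (unfold r; apply Rmult_le_compat_r; [lra|]; apply Rmult_le_compat_r; lra).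
assert (hrs : r * (w / 2 * (INR n * (k ^ 2 / K ^ 2))) <= 3 / 4 * (k ^ 3 * (s / K)) * INR n).
{ apply Rle_trans with (3 / 2 * k * (K / s) * (w / 2 * (INR n * (k ^ 2 / K ^ 2)))).
  - apply Rmult_le_compat_r; [|easy].
    apply Rmult_le_pos; [lra|]. apply Rmult_le_pos; [apply pos_INR|].
    apply Rdiv_le_0_compat; [nra|apply pow_lt; lra].
  - right. rewrite <- ew. field. lra. }
assert (hkk : k <= k ^ 3) by nra.
assert (hn1 : INR n <= INR (S n)) by (apply le_INR; lia).
assert (q1 : k * (K / s) <= k ^ 3 * (K / s)) by (apply Rmult_le_compat_r; lra).
assert (q2 : 1 <= k ^ 3 * (K / s)) by nra.
assert (q3 : k ^ 3 * (s / K) * INR n <= k ^ 3 * (s / K) * INR (S n)) by (apply Rmult_le_compat_l; nra).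
assert (q4 : 0 <= k ^ 3 * (s / K) * INR n) by (apply Rmult_le_pos; [nra|apply pos_INR]).
replace (20 * k ^ 3 * s / K * INR (S n)) with (20 * (k ^ 3 * (s / K) * INR (S n))) by (field; lra).
lra.
Qed.

(** Along an increasing sequence in (0, 1/2] the amplitude
    1 / ((2N+1) pi sin (pi v)) decreases, so that only the partial sums of the
    cosines matter. *)
Lemma saw_osc_abel N (v : nat -> R) q J A B n : 0 < q -> 0 < J -> 0 <= A -> 0 <= B ->
  (forall j, (j < n)%nat -> 0 < v j <= / 2) ->
  (forall j, (S j < n)%nat -> v j <= v (S j)) ->
  (forall j, (j < n)%nat -> q * (J + INR j) <= v j) -> 1 <= J ->
  (forall i, (i <= n)%nat -> Rabs (psum (fun j => cos (odd_freq N * PI * v j)) i) <= A * INR i + B) ->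
  Rabs (psum (fun j => saw_osc N (v j)) n) <= (A * (2 * sqrt (INR n)) + B / J) / (odd_freq N * q).
Proof.
intros hq hJ hA hB hv hvi hvq hJ1 hs.
assert (hw := odd_freq_ge1 N). assert (hp := PI2_3_2).
destruct n as [|n].
{ simpl psum. rewrite Rabs_R0. simpl INR. rewrite sqrt_0. apply Rdiv_le_0_compat; [|nra].
  assert (0 <= B / J) by (apply Rdiv_le_0_compat; lra). lra. }
set (W j := / (odd_freq N * PI * sin (PI * v j))).
assert (hW : forall j, (j < S n)%nat -> 0 <= W j <= / (odd_freq N * q) * / (J + INR j)).
{ intros j hj. assert (a1 := hv j hj). assert (a3 := hvq j hj).
  assert (a4 := sin_PI_ge (v j) ltac:(lra)). assert (a5 := pos_INR j).
  assert (a6 : odd_freq N * (v j) <= odd_freq N * PI * sin (PI * v j)).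
  { replace (odd_freq N * PI * sin (PI * v j)) with (odd_freq N * (PI * sin (PI * v j))) by ring.
    apply Rmult_le_compat_l; nra. }
  assert (a7 : 0 < odd_freq N * v j) by nra.
  unfold W. split; [left; apply Rinv_0_lt_compat; lra|].
  rewrite <- Rinv_mult. apply Rinv_le_contravar.
  - assert (0 < odd_freq N * q) by nra. nra.
  - apply Rle_trans with (odd_freq N * v j); [|easy]. rewrite Rmult_assoc. apply Rmult_le_compat_l; lra. }
assert (e : psum (fun j => saw_osc N (v j)) (S n) = psum (fun j => W j * cos (odd_freq N * PI * v j)) (S n)).
{ apply psum_ext. intros j _. unfold saw_osc, W, Rdiv. apply Rmult_comm. }
rewrite e.
eapply Rle_trans; [apply (psum_abel W (fun j => cos (odd_freq N * PI * v j)) A B (S n) hA hB)|].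
- apply hW; lia.
- intros j hj; now apply hW.
- intros j hj. unfold W.
  assert (a1 := hv j ltac:(lia)). assert (a3 := hvi j hj). assert (a4 := hv (S j) hj).
  assert (b1 := sin_PI_pos (v j) ltac:(lra)).
  apply Rinv_le_contravar; [apply Rmult_pos3; lra|]. apply Rmult_le_compat_l; [nra|].
  apply sin_incr_1; nra.
- exact hs.
- assert (hq0 : 0 < / (odd_freq N * q)) by (apply Rinv_0_lt_compat; nra).
  assert (s1 : psum W (S n) <= / (odd_freq N * q) * (2 * sqrt (INR (S n)))).
  { apply Rle_trans with (psum (fun j => / (odd_freq N * q) * / INR (S j)) (S n)).
    - apply psum_le. intros j hj. eapply Rle_trans; [apply hW; easy|].
      apply Rmult_le_compat_l; [lra|]. apply Rinv_le_contravar; [apply lt_0_INR; lia|].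
      rewrite S_INR; lra.
    - rewrite psum_scal. apply Rmult_le_compat_l; [lra|]. apply psum_inv_le_sqrt. }
  assert (s2 := proj2 (hW 0%nat ltac:(lia))). simpl (INR 0) in s2. rewrite Rplus_0_r in s2.
  replace ((A * (2 * sqrt (INR (S n))) + B / J) / (odd_freq N * q)) with
    (A * (/ (odd_freq N * q) * (2 * sqrt (INR (S n)))) + B * (/ (odd_freq N * q) * / J)) by (field; lra).
  apply Rplus_le_compat; apply Rmult_le_compat_l; easy.
Qed.

(** * The error of the partial sums around a power of k *)

(** [log_right k K i] and [- log_left k K i] are the base k logarithms of
    (K + i) / K and (K - i) / K. *)
Definition log_right (k : R) (K i : nat) := ln (INR (K + i) / INR K) / ln k.
Definition log_left (k : R) (K i : nat) := ln (INR K / INR (K - i)) / ln k.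

(** [right_half] and [left_half] say that these logarithms remain at distance at
    most 1/2 from 0. *)
Definition right_half (k : R) (K H : nat) := INR (K + H) ^ 2 <= k * INR K ^ 2.
Definition left_half (k : R) (K H : nat) := (H < K)%nat /\ INR K ^ 2 <= k * INR (K - H) ^ 2.

Lemma ln_pos k : 1 < k -> 0 < ln k.
Proof. intros h. rewrite <- ln_1. apply ln_increasing; lra. Qed.

Lemma sq_le_cancel a b : 0 <= b -> a ^ 2 <= b ^ 2 -> a <= b.
Proof. intros hb h. apply Rnot_lt_le; intros hlt. assert (b ^ 2 < a ^ 2) by nra. lra. Qed.

Lemma half_log_le k x : 1 < k -> 0 < x -> x ^ 2 <= k -> ln x / ln k <= / 2.
Proof.
intros hk hx h. assert (hL := ln_pos k hk).
apply Rmult_le_reg_r with (ln k); [easy|]. unfold Rdiv. rewrite Rmult_assoc, Rinv_l, Rmult_1_r by lra.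
assert (e : ln (x ^ 2) = 2 * ln x) by (rewrite ln_pow by easy; simpl; ring).
assert (ln (x ^ 2) <= ln k) by (apply ln_le; [apply pow_lt|]; easy). lra.
Qed.

Lemma mult_sq_le k x : 1 < k -> k * x ^ 2 <= (k * x) ^ 2.
Proof.
intros hk. replace ((k * x) ^ 2) with (k * (k * x ^ 2)) by ring.
assert (h := pow2_ge_0 x). rewrite <- (Rmult_1_l (k * x ^ 2)) at 1. apply Rmult_le_compat_r; nra.
Qed.

Lemma log_right_bounds k K H i : 1 < k -> (1 <= K)%nat -> right_half k K H -> (i <= H)%nat ->
  INR i * / (k * INR K * ln k) <= log_right k K i <= / 2.
Proof.
intros hk hK hH hi. assert (hL := ln_pos k hk).
assert (hK0 : 1 <= INR K) by now apply (le_INR 1).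
assert (hi0 := pos_INR i). assert (hiH : INR (K + i) <= INR (K + H)) by (apply le_INR; lia).
unfold right_half in hH. rewrite plus_INR in hiH.
assert (hH1 : (INR K + INR i) ^ 2 <= INR (K + H) ^ 2) by (apply pow_incr; lra).
assert (hH2 := mult_sq_le k (INR K) hk).
assert (hx : INR K + INR i <= k * INR K) by (apply sq_le_cancel; nra).
assert (hx0 : 0 < (INR K + INR i) / INR K) by (apply Rdiv_lt_0_compat; lra).
unfold log_right. rewrite plus_INR. split.
- replace (INR i * / (k * INR K * ln k)) with (INR i / (k * INR K) * / ln k) by (field; lra).
  apply Rmult_le_compat_r; [left; now apply Rinv_0_lt_compat|].
  eapply Rle_trans; [|now apply ln_ge_1_sub_inv].
  replace (1 - / ((INR K + INR i) / INR K)) with (INR i / (INR K + INR i)) by (field; lra).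
  apply Rmult_le_compat_l; [easy|]. apply Rinv_le_contravar; lra.
- apply half_log_le; [easy|easy|].
  replace (((INR K + INR i) / INR K) ^ 2) with ((INR K + INR i) ^ 2 / INR K ^ 2) by (field; lra).
  apply Rmult_le_reg_r with (INR K ^ 2); [apply pow_lt; lra|].
  unfold Rdiv. rewrite Rmult_assoc, Rinv_l, Rmult_1_r by nra.
  lra.
Qed.

Lemma log_left_bounds k K H i : 1 < k -> left_half k K H -> (i <= H)%nat ->
  INR K / k <= INR (K - i) /\
  INR i * / (k * INR K * ln k) <= log_left k K i <= / 2.
Proof.
intros hk [hHK hH] hi. assert (hL := ln_pos k hk).
assert (hK0 : 1 <= INR K) by (apply (le_INR 1); lia).
assert (hi0 := pos_INR i). assert (hiH : INR (K - H) <= INR (K - i)) by (apply le_INR; lia).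
assert (hm : 1 <= INR (K - H)) by (apply (le_INR 1); lia).
assert (hsq : INR K ^ 2 <= k * INR (K - i) ^ 2).
{ eapply Rle_trans; [exact hH|]. apply Rmult_le_compat_l; [lra|]. apply pow_incr; lra. }
assert (hx0 : 0 < INR K / INR (K - i)) by (apply Rdiv_lt_0_compat; lra).
assert (hKm : INR K <= k * INR (K - i)).
{ apply sq_le_cancel; [nra|]. assert (h := mult_sq_le k (INR (K - i)) hk). lra. }
split; [|split].
- apply Rmult_le_reg_r with k; [lra|]. unfold Rdiv; rewrite Rmult_assoc, Rinv_l; lra.
- unfold log_left. replace (INR i * / (k * INR K * ln k)) with (INR i / (k * INR K) * / ln k) by (field; lra).
  apply Rmult_le_compat_r; [left; now apply Rinv_0_lt_compat|].
  eapply Rle_trans; [|now apply ln_ge_1_sub_inv].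
  replace (1 - / (INR K / INR (K - i))) with (INR i / INR K).
  + apply Rmult_le_compat_l; [easy|]. apply Rinv_le_contravar; [lra|].
    rewrite <- (Rmult_1_l (INR K)) at 1. apply Rmult_le_compat_r; lra.
  + assert (hKi : INR (K - i) = INR K - INR i) by (apply minus_INR; lia).
    rewrite hKi in *. field. split; lra.
- unfold log_left. apply half_log_le; [easy|easy|].
  replace ((INR K / INR (K - i)) ^ 2) with (INR K ^ 2 / INR (K - i) ^ 2) by (field; lra).
  apply Rmult_le_reg_r with (INR (K - i) ^ 2); [apply pow_lt; lra|].
  unfold Rdiv. rewrite Rmult_assoc, Rinv_l, Rmult_1_r; [easy|]. apply pow_nonzero; lra.
Qed.

(** The points K + i and K - i have logarithms of opposite signs whose absolute
    values differ by O(i^2 / K^2); multiplied by the size K / i + K^2 / (N i^2) of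
    the derivative of [saw_osc] this is O(i / K + 1 / N). *)
Lemma saw_osc_pair_bound k K HR HL i N : 1 < k -> right_half k K HR -> left_half k K HL ->
  (1 <= i <= HR)%nat -> (i <= HL)%nat ->
  Rabs (saw_osc N (log_right k K i) - saw_osc N (log_left k K i)) <= k ^ 2 * INR i / INR K + k ^ 3 * ln k / odd_freq N.
Proof.
intros hk hR hL hi hi'. assert (hLk := ln_pos k hk).
assert (hK1 : (1 <= K)%nat) by (destruct hL; lia).
assert (hK0 : 1 <= INR K) by now apply (le_INR 1).
assert (hi1 : 1 <= INR i) by (apply (le_INR 1); lia).
destruct (log_right_bounds k K HR i hk hK1 hR ltac:(lia)) as [r1 r2].
destruct (log_left_bounds k K HL i hk hL hi') as [l0 [l1 l2]].
assert (hw := odd_freq_ge1 N).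
set (q := INR i * / (k * INR K * ln k)) in *.
assert (hq : 0 < q). { unfold q. apply Rmult_lt_0_compat; [lra|]. apply Rinv_0_lt_compat, Rmult_pos3; lra. }
assert (hKi : INR (K - i) = INR K - INR i) by (apply minus_INR; destruct hL; lia).
assert (hKi0 : 0 < INR K - INR i) by (rewrite <- hKi; apply lt_0_INR; destruct hL; lia).
assert (hd : log_left k K i - log_right k K i = ln (INR K ^ 2 / ((INR K - INR i) * (INR K + INR i))) / ln k).
{ unfold log_left, log_right. rewrite hKi, plus_INR.
  replace (INR K ^ 2 / ((INR K - INR i) * (INR K + INR i))) with
    (INR K / (INR K - INR i) / ((INR K + INR i) / INR K)) by (field; lra).
  rewrite (ln_div (INR K / _)) by (apply Rdiv_lt_0_compat; lra). field. lra. }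
assert (hd1 : 0 <= log_left k K i - log_right k K i <= k * INR i ^ 2 / (INR K ^ 2 * ln k)).
{ rewrite hd. assert (hden : 0 < (INR K - INR i) * (INR K + INR i)) by nra.
  assert (hx : 1 <= INR K ^ 2 / ((INR K - INR i) * (INR K + INR i))).
  { apply Rmult_le_reg_r with ((INR K - INR i) * (INR K + INR i)); [easy|].
    unfold Rdiv; rewrite Rmult_assoc, Rinv_l; nra. }
  split.
  - apply Rdiv_le_0_compat; [|easy]. rewrite <- ln_1. apply ln_le; lra.
  - replace (k * INR i ^ 2 / (INR K ^ 2 * ln k)) with (INR i ^ 2 / (INR K / k * INR K) * / ln k) by (field; lra).
    apply Rmult_le_compat_r; [left; now apply Rinv_0_lt_compat|].
    eapply Rle_trans; [apply ln_le_sub1; lra|].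
    replace (INR K ^ 2 / ((INR K - INR i) * (INR K + INR i)) - 1) with
      (INR i ^ 2 / ((INR K - INR i) * (INR K + INR i))) by (field; lra).
    apply Rmult_le_compat_l; [nra|]. apply Rinv_le_contravar.
    + apply Rmult_lt_0_compat; [apply Rdiv_lt_0_compat|]; lra.
    + rewrite hKi in l0. apply Rmult_le_compat; try lra. left; apply Rdiv_lt_0_compat; lra. }
set (D := / q + / (odd_freq N * q ^ 2)).
assert (hD : 0 < D).
{ unfold D. assert (0 < / q) by now apply Rinv_0_lt_compat.
  assert (0 < / (odd_freq N * q ^ 2)) by (apply Rinv_0_lt_compat; nra). lra. }
assert (M : Rabs (saw_osc N (log_right k K i) - saw_osc N (log_left k K i)) <= - D * log_right k K i - - D * log_left k K i).
{ apply (dist_le_of_derive (saw_osc N) (fun v => - (sin (odd_freq N * PI * v) / sin (PI * v))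
    - cos (odd_freq N * PI * v) * cos (PI * v) / (odd_freq N * (sin (PI * v))^2)) (fun z => - D * z) (fun _ => - D)).
  - lra.
  - intros z hz. apply saw_osc_derive; lra.
  - intros z _. auto_derive; [easy|ring].
  - intros z hz. rewrite Ropp_involutive.
    eapply Rle_trans; [apply saw_osc_derive_bound; lra|]. unfold D.
    assert (q ^ 2 <= z ^ 2) by (apply pow_incr; lra).
    apply Rplus_le_compat; apply Rinv_le_contravar; nra. }
eapply Rle_trans; [exact M|].
apply Rle_trans with (D * (k * INR i ^ 2 / (INR K ^ 2 * ln k))); [nra|].
right. unfold D, q. field. repeat split; lra.
Qed.

Lemma saw_err2_sum_bound N (v : nat -> R) q n : 0 < q ->
  (forall j, (j < n)%nat -> INR (S j) * q <= v j <= / 2) ->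
  Rabs (psum (fun j => saw_err2 N (v j)) n) <= 4 / (odd_freq N * q) ^ 2.
Proof.
intros hq hv. assert (hw := odd_freq_ge1 N).
apply Rle_trans with (psum (fun j => 2 / (odd_freq N * q) ^ 2 * / (INR (S j)) ^ 2) n).
- apply psum_abs_le. intros j hj. assert (h := hv j hj).
  assert (hj1 : 1 <= INR (S j)) by (apply (le_INR 1); lia).
  assert (hjq : 0 < INR (S j) * q) by (apply Rmult_lt_0_compat; lra).
  eapply Rle_trans; [apply saw_err2_bound; lra|].
  replace (2 / (odd_freq N * q) ^ 2 * / INR (S j) ^ 2) with (2 / (odd_freq N * (INR (S j) * q)) ^ 2) by (field; lra).
  apply Rmult_le_compat_l; [lra|]. apply Rinv_le_contravar.
  + apply pow_lt, Rmult_lt_0_compat; lra.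
  + apply pow_incr. split; [apply Rmult_le_pos; lra|]. apply Rmult_le_compat_l; lra.
- rewrite psum_scal. assert (h := psum_inv_sq_le n).
  replace (4 / (odd_freq N * q) ^ 2) with (2 / (odd_freq N * q) ^ 2 * 2) by (field; lra).
  apply Rmult_le_compat_l; [|easy]. apply Rdiv_le_0_compat; [lra|]. apply pow_lt, Rmult_lt_0_compat; lra.
Qed.

Lemma saw_osc_right_tail k K H I0 N : 1 < k -> (1 <= K)%nat -> right_half k K H -> (I0 <= H)%nat ->
  let w := odd_freq N * PI / ln k in
  Rabs (psum (fun j => saw_osc N (log_right k K (S I0 + j))) (H - I0)) <=
  (20 * k ^ 3 * sqrt w / INR K * (2 * (k * sqrt (INR K))) + 20 * k ^ 3 * (INR K / sqrt w) / INR (S I0))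
   * (k * INR K * ln k) / odd_freq N.
Proof.
intros hk hK hH hI w. assert (hLk := ln_pos k hk).
assert (hK0 : 1 <= INR K) by now apply (le_INR 1).
assert (hw := odd_freq_ge1 N). assert (hp := PI2_3_2).
assert (hw0 : 0 < w) by (unfold w; apply Rdiv_lt_0_compat; [nra|easy]).
assert (hs : 0 < sqrt w) by now apply sqrt_lt_R0.
set (q := / (k * INR K * ln k)).
assert (hq : 0 < q) by (apply Rinv_0_lt_compat, Rmult_pos3; lra).
assert (hk3 : 0 < k ^ 3) by (apply pow_lt; lra).
set (A := 20 * k ^ 3 * sqrt w / INR K). set (B := 20 * k ^ 3 * (INR K / sqrt w)).
assert (hA : 0 <= A) by (unfold A; apply Rdiv_le_0_compat; nra).
assert (hB : 0 <= B).
{ unfold B. assert (0 < INR K / sqrt w) by (apply Rdiv_lt_0_compat; lra). nra. }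
assert (hHk : INR (K + H) <= k * INR K).
{ apply sq_le_cancel; [nra|]. unfold right_half in hH. assert (h := mult_sq_le k (INR K) hk). lra. }
assert (hI1 : 1 <= INR (S I0)) by (apply (le_INR 1); lia).
eapply Rle_trans; [apply (saw_osc_abel N (fun j => log_right k K (S I0 + j)) q (INR (S I0)) A B)|]; try easy; try lra.
- intros j hj. destruct (log_right_bounds k K H (S I0 + j) hk hK hH ltac:(lia)) as [h1 h2].
  fold q in h1. assert (1 <= INR (S I0 + j)) by (apply (le_INR 1); lia). split; [nra|easy].
- intros j hj. unfold log_right. apply Rmult_le_compat_r; [left; now apply Rinv_0_lt_compat|].
  assert (0 < INR (K + (S I0 + j))) by (apply lt_0_INR; lia).
  apply ln_le; [apply Rdiv_lt_0_compat; lra|]. apply Rmult_le_compat_r; [left; apply Rinv_0_lt_compat; lra|].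
  apply le_INR; lia.
- intros j hj. destruct (log_right_bounds k K H (S I0 + j) hk hK hH ltac:(lia)) as [h1 h2].
  fold q in h1. rewrite plus_INR in h1. lra.
- intros i hi.
  rewrite (psum_ext _ (fun j => cos (w * ln (INR ((K + S I0) + j)) + - (w * ln (INR K))))).
  + apply (cos_log_sum_bound k (INR K) w); try lra.
    * apply Rle_trans with (INR K); [|apply le_INR; lia].
      apply Rmult_le_reg_r with k; [lra|]. unfold Rdiv; rewrite Rmult_assoc, Rinv_l by lra. nra.
    * apply Rle_trans with (INR (K + H)); [|easy].
      assert (INR (K + S I0 + i) <= INR (S (K + H))) by (apply le_INR; lia). rewrite S_INR in *. lra.
  + intros j hj. f_equal. unfold log_right, w. rewrite Nat.add_assoc.
    rewrite ln_div; [field; lra|apply lt_0_INR; lia|lra].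
- replace ((A * (2 * sqrt (INR (H - I0))) + B / INR (S I0)) / (odd_freq N * q)) with
   ((A * (2 * sqrt (INR (H - I0))) + B / INR (S I0)) * (k * INR K * ln k) / odd_freq N).
  2:{ unfold q. field. repeat split; lra. }
  unfold Rdiv. apply Rmult_le_compat_r; [left; apply Rinv_0_lt_compat; lra|].
  apply Rmult_le_compat_r; [left; apply Rmult_pos3; lra|]. apply Rplus_le_compat_r.
  apply Rmult_le_compat_l; [easy|]. apply Rmult_le_compat_l; [lra|].
  apply Rle_trans with (sqrt (k ^ 2 * INR K)).
  + apply sqrt_le_1_alt. apply Rle_trans with (INR (K + H)); [apply le_INR; lia|].
    apply Rle_trans with (1 := hHk). apply Rmult_le_compat_r; nra.
  + rewrite sqrt_mult, sqrt_pow2 by nra. lra.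
Qed.

Lemma saw_osc_left_tail k K H I0 N : 1 < k -> left_half k K H -> (I0 <= H)%nat ->
  let w := odd_freq N * PI / ln k in
  Rabs (psum (fun j => saw_osc N (log_left k K (S I0 + j))) (H - I0)) <=
  (20 * k ^ 3 * sqrt w / INR K * (2 * (k * sqrt (INR K))) + 20 * k ^ 3 * (INR K / sqrt w) / INR (S I0))
   * (k * INR K * ln k) / odd_freq N.
Proof.
intros hk hH hI w. assert (hLk := ln_pos k hk).
assert (hHK := proj1 hH).
assert (hK0 : 1 <= INR K) by (apply (le_INR 1); lia).
assert (hw := odd_freq_ge1 N). assert (hp := PI2_3_2).
assert (hw0 : 0 < w) by (unfold w; apply Rdiv_lt_0_compat; [nra|easy]).
assert (hs : 0 < sqrt w) by now apply sqrt_lt_R0.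
set (q := / (k * INR K * ln k)).
assert (hq : 0 < q) by (apply Rinv_0_lt_compat, Rmult_pos3; lra).
assert (hk3 : 0 < k ^ 3) by (apply pow_lt; lra).
set (A := 20 * k ^ 3 * sqrt w / INR K). set (B := 20 * k ^ 3 * (INR K / sqrt w)).
assert (hA : 0 <= A) by (unfold A; apply Rdiv_le_0_compat; nra).
assert (hB : 0 <= B).
{ unfold B. assert (0 < INR K / sqrt w) by (apply Rdiv_lt_0_compat; lra). nra. }
assert (hI1 : 1 <= INR (S I0)) by (apply (le_INR 1); lia).
eapply Rle_trans; [apply (saw_osc_abel N (fun j => log_left k K (S I0 + j)) q (INR (S I0)) A B)|]; try easy; try lra.
- intros j hj. destruct (log_left_bounds k K H (S I0 + j) hk hH ltac:(lia)) as [_ [h1 h2]].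
  fold q in h1. assert (1 <= INR (S I0 + j)) by (apply (le_INR 1); lia). split; [nra|easy].
- intros j hj. unfold log_left. apply Rmult_le_compat_r; [left; now apply Rinv_0_lt_compat|].
  assert (0 < INR (K - (S I0 + S j))) by (apply lt_0_INR; lia).
  assert (INR (K - (S I0 + S j)) <= INR (K - (S I0 + j))) by (apply le_INR; lia).
  apply ln_le; [apply Rdiv_lt_0_compat; lra|]. apply Rmult_le_compat_l; [lra|].
  apply Rinv_le_contravar; lra.
- intros j hj. destruct (log_left_bounds k K H (S I0 + j) hk hH ltac:(lia)) as [_ [h1 h2]].
  fold q in h1. rewrite plus_INR in h1. lra.
- intros i hi.
  rewrite <- (psum_rev (fun j => cos (odd_freq N * PI * log_left k K (S I0 + j)))).
  rewrite (psum_ext _ (fun j => cos (w * ln (INR ((K - I0 - i) + j)) + - (w * ln (INR K))))).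
  + apply (cos_log_sum_bound k (INR K) w); try lra.
    * apply Rle_trans with (INR (K - H)); [|apply le_INR; lia].
      now apply (log_left_bounds k K H H hk hH).
    * apply Rle_trans with (INR K); [|nra].
      assert (INR (K - I0 - i + i) <= INR K) by (apply le_INR; lia). lra.
  + intros j hj. unfold log_left, w.
    replace (K - (S I0 + (i - 1 - j)))%nat with (K - I0 - i + j)%nat by lia.
    rewrite <- cos_neg. f_equal.
    rewrite ln_div; [field; lra|lra|apply lt_0_INR; lia].
- replace ((A * (2 * sqrt (INR (H - I0))) + B / INR (S I0)) / (odd_freq N * q)) with
   ((A * (2 * sqrt (INR (H - I0))) + B / INR (S I0)) * (k * INR K * ln k) / odd_freq N).
  2:{ unfold q. field. repeat split; lra. }
  unfold Rdiv. apply Rmult_le_compat_r; [left; apply Rinv_0_lt_compat; lra|].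
  apply Rmult_le_compat_r; [left; apply Rmult_pos3; lra|]. apply Rplus_le_compat_r.
  apply Rmult_le_compat_l; [easy|]. apply Rmult_le_compat_l; [lra|].
  apply Rle_trans with (sqrt (k ^ 2 * INR K)).
  + apply sqrt_le_1_alt. apply Rle_trans with (INR K); [apply le_INR; lia|].
    rewrite <- (Rmult_1_l (INR K)) at 1. apply Rmult_le_compat_r; nra.
  + rewrite sqrt_mult, sqrt_pow2 by nra. lra.
Qed.

(** Turns the bound of [saw_osc_right_tail] and [saw_osc_left_tail] into powers of
    z = sqrt (K / N), once the cut J is at least of order K / sqrt N. *)
Lemma tail_constant k L w wn K N J z : 1 < k -> 0 < L -> 1 <= K -> 1 <= N ->
  N <= wn -> N / L <= w <= 12 * N / L -> K / (8 * sqrt N) <= J -> 0 < J ->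
  z = sqrt K / sqrt N ->
  (20 * k ^ 3 * sqrt w / K * (2 * (k * sqrt K)) + 20 * k ^ 3 * (K / sqrt w) / J)
   * (k * K * L) / wn <=
  40 * k ^ 5 * sqrt (12 / L) * L * z + 160 * k ^ 4 * sqrt L * L * z ^ 2.
Proof.
intros hk hL hK hN hwn hw hJ hJ0 ez.
set (sK := sqrt K) in *. set (sN := sqrt N) in *.
assert (hsK : 0 < sK) by (apply sqrt_lt_R0; lra). assert (hsN : 0 < sN) by (apply sqrt_lt_R0; lra).
assert (eK : sK * sK = K) by (apply sqrt_sqrt; lra). assert (eN : sN * sN = N) by (apply sqrt_sqrt; lra).
assert (hNL : 0 < N / L) by (apply Rdiv_lt_0_compat; lra).
assert (hsw : 0 < sqrt w) by (apply sqrt_lt_R0; lra).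
assert (h12 : 0 < 12 / L) by (apply Rdiv_lt_0_compat; lra).
assert (a1 : sqrt w <= sqrt (12 / L) * sN).
{ unfold sN. rewrite <- sqrt_mult by lra. apply sqrt_le_1_alt.
  replace (12 / L * N) with (12 * N / L) by (field; lra). lra. }
assert (hsL : 0 < sqrt L) by (apply sqrt_lt_R0; lra).
assert (a2 : sN / sqrt L <= sqrt w).
{ unfold sN. rewrite <- sqrt_div by lra. apply sqrt_le_1_alt. lra. }
assert (a2' : 0 < sN / sqrt L) by (apply Rdiv_lt_0_compat; lra).
assert (a3 : K / sqrt w <= K * (sqrt L / sN)).
{ apply Rmult_le_compat_l; [lra|]. replace (sqrt L / sN) with (/ (sN / sqrt L)) by (field; lra).
  apply Rinv_le_contravar; lra. }
assert (hKJ : 0 < K / (8 * sN)) by (apply Rdiv_lt_0_compat; lra).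
assert (a4 : / J <= 8 * sN / K).
{ replace (8 * sN / K) with (/ (K / (8 * sN))) by (field; lra). apply Rinv_le_contravar; lra. }
assert (a5 : K / sqrt w / J <= 8 * sqrt L).
{ apply Rle_trans with (K * (sqrt L / sN) * (8 * sN / K)).
  - apply Rmult_le_compat; try lra; left; [apply Rdiv_lt_0_compat|apply Rinv_0_lt_compat]; lra.
  - right. field. lra. }
assert (hk3 : 0 < k ^ 3) by (apply pow_lt; lra).
assert (a6 : 20 * k ^ 3 * sqrt w / K * (2 * (k * sK)) <= 20 * k ^ 3 * (sqrt (12 / L) * sN) / K * (2 * (k * sK))).
{ apply Rmult_le_compat_r; [nra|]. apply Rmult_le_compat_r; [left; apply Rinv_0_lt_compat; lra|].
  apply Rmult_le_compat_l; lra. }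
assert (a7 : 20 * k ^ 3 * (K / sqrt w) / J <= 20 * k ^ 3 * (8 * sqrt L)).
{ replace (20 * k ^ 3 * (K / sqrt w) / J) with (20 * k ^ 3 * (K / sqrt w / J)) by (field; lra).
  apply Rmult_le_compat_l; lra. }
assert (hkKL : 0 < k * K * L) by (apply Rmult_pos3; lra).
apply Rle_trans with ((20 * k ^ 3 * (sqrt (12 / L) * sN) / K * (2 * (k * sK)) + 20 * k ^ 3 * (8 * sqrt L)) * (k * K * L) / N).
- unfold Rdiv at 1. unfold Rdiv at 4. apply Rmult_le_compat.
  + apply Rmult_le_pos; [|lra]. apply Rplus_le_le_0_compat.
    * apply Rmult_le_pos; [|nra]. apply Rdiv_le_0_compat; [|lra]. nra.
    * apply Rdiv_le_0_compat; [|lra]. assert (0 < K / sqrt w) by (apply Rdiv_lt_0_compat; lra). nra.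
  + left; apply Rinv_0_lt_compat; lra.
  + apply Rmult_le_compat_r; [lra|]. apply Rplus_le_compat; assumption.
  + apply Rinv_le_contravar; lra.
- right. rewrite ez, <- eN, <- eK. field. lra.
Qed.

(** The cut between cancellation in pairs and cancellation along the phase is at
    I0 = K / (8 sqrt N).  The pairs below it contribute I0^2 / K; the terms above
    it contribute sqrt (K / N) and (K / sqrt N) K / (N I0), the two terms of the
    second derivative test. *)
Lemma window_bound k Y : 1 < k -> 1 <= Y ->
  exists C, 0 < C /\ forall K HR HL N : nat, (1 <= K)%nat -> (1 <= N)%nat ->
  right_half k K HR -> left_half k K HL -> (K / 8 <= HR)%nat -> (K / 8 <= HL)%nat ->
  INR K <= Y * INR N ->
  Rabs (psum (fun i => saw_err N (log_right k K (S i))) HR - psum (fun i => saw_err N (log_left k K (S i))) HL)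
  <= C * (sqrt (INR K) / sqrt (INR N)).
Proof.
intros hk hY. set (L := ln k). assert (hL : 0 < L) by now apply ln_pos.
set (c1 := 40 * k ^ 5 * sqrt (12 / L) * L). set (c2 := 160 * k ^ 4 * sqrt L * L).
assert (hpk : forall n, 0 < k ^ n) by (intros; apply pow_lt; lra).
assert (hc1 : 0 <= c1).
{ unfold c1. assert (h := hpk 5%nat). assert (h' := sqrt_pos (12 / L)).
  repeat apply Rmult_le_pos; lra. }
assert (hc2 : 0 <= c2).
{ unfold c2. assert (h := hpk 4%nat). assert (h' := sqrt_pos L).
  repeat apply Rmult_le_pos; lra. }
set (C := 8 * k ^ 2 * L ^ 2 * Y ^ 3 + (k ^ 2 + k ^ 3 * L + 2 * c2) * Y + 2 * c1).
assert (hC : 0 < C).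
{ unfold C. assert (h2 := hpk 2%nat). assert (h3 := hpk 3%nat).
  assert (0 < Y ^ 3) by (apply pow_lt; lra). assert (0 < L ^ 2) by (apply pow_lt; lra).
  assert (0 < 8 * k ^ 2 * L ^ 2 * Y ^ 3) by (repeat apply Rmult_lt_0_compat; lra).
  assert (0 <= (k ^ 2 + k ^ 3 * L + 2 * c2) * Y) by (apply Rmult_le_pos; nra). lra. }
exists C. split; [easy|]. intros K HR HL N hK hN hR hLh hKR hKL hKY.
assert (hK0 : 1 <= INR K) by now apply (le_INR 1).
assert (hN0 : 1 <= INR N) by now apply (le_INR 1).
set (z := sqrt (INR K) / sqrt (INR N)).
assert (hsN : 1 <= sqrt (INR N)) by (rewrite <- sqrt_1; apply sqrt_le_1_alt; lra).
assert (hsK : 0 < sqrt (INR K)) by (apply sqrt_lt_R0; lra).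
assert (hz : 0 < z) by (apply Rdiv_lt_0_compat; lra).
assert (eK : sqrt (INR K) * sqrt (INR K) = INR K) by (apply sqrt_sqrt; lra).
assert (eN : sqrt (INR N) * sqrt (INR N) = INR N) by (apply sqrt_sqrt; lra).
assert (ez : z ^ 2 = INR K / INR N).
{ unfold z. transitivity (sqrt (INR K) * sqrt (INR K) / (sqrt (INR N) * sqrt (INR N))); [field; lra|]. now rewrite eK, eN. }
assert (hzY : z ^ 2 <= Y).
{ rewrite ez. apply Rmult_le_reg_r with (INR N); [lra|]. unfold Rdiv; rewrite Rmult_assoc, Rinv_l; lra. }
assert (hzY1 : z <= Y) by nra.
(* The factor 8 keeps the cut inside both halves of the window. *)
destruct (nfloor_ex (INR K / (8 * sqrt (INR N)))) as [I0 [hI1 hI2]].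
{ apply Rdiv_le_0_compat; lra. }
assert (hI8 : 8 * INR I0 <= INR K).
{ apply Rle_trans with (8 * (INR K / (8 * sqrt (INR N)))); [lra|].
  replace (8 * (INR K / (8 * sqrt (INR N)))) with (INR K / sqrt (INR N)) by (field; lra).
  rewrite <- (Rmult_1_r (INR K)) at 2. apply Rmult_le_compat_l; [lra|].
  rewrite <- Rinv_1. apply Rinv_le_contravar; lra. }
assert (hIn : (I0 <= K / 8)%nat).
{ apply Nat.div_le_lower_bound; [easy|]. apply INR_le. rewrite mult_INR. simpl (INR 8). lra. }
assert (hw := odd_freq_ge1 N). assert (hwN : INR N <= odd_freq N <= 3 * INR N) by (unfold odd_freq; lra).
assert (hp := PI2_3_2). assert (hp4 := PI_4).
set (w := odd_freq N * PI / ln k).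
assert (hT : forall T, T <= (20 * k ^ 3 * sqrt w / INR K * (2 * (k * sqrt (INR K))) + 20 * k ^ 3 * (INR K / sqrt w) / INR (S I0))
   * (k * INR K * ln k) / odd_freq N -> T <= c1 * z + c2 * z ^ 2).
{ intros T hT. eapply Rle_trans; [exact hT|].
  apply (tail_constant k L w (odd_freq N) (INR K) (INR N) (INR (S I0)) z); try easy; try lra.
  - unfold w. fold L. split; unfold Rdiv; apply Rmult_le_compat_r; try (left; now apply Rinv_0_lt_compat).
    + nra.
    + apply Rle_trans with (3 * INR N * 4); [apply Rmult_le_compat; lra|lra].
  - rewrite S_INR. lra.
  - apply lt_0_INR; lia. }
assert (tR := hT _ (saw_osc_right_tail k K HR I0 N hk hK hR ltac:(lia))).
assert (tL := hT _ (saw_osc_left_tail k K HL I0 N hk hLh ltac:(lia))).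
clear hT.
set (q := / (k * INR K * L)).
assert (hq : 0 < q) by (apply Rinv_0_lt_compat, Rmult_pos3; lra).
assert (pc : 4 / (odd_freq N * q) ^ 2 <= 4 * k ^ 2 * L ^ 2 * (z ^ 2) ^ 2).
{ rewrite ez. replace (4 / (odd_freq N * q) ^ 2) with (4 * k ^ 2 * L ^ 2 * (INR K / odd_freq N) ^ 2) by (unfold q; field; lra).
  apply Rmult_le_compat_l.
  - assert (h2 := hpk 2%nat). assert (0 < L ^ 2) by (apply pow_lt; lra). nra.
  - apply pow_incr. split; [apply Rdiv_le_0_compat; lra|].
    apply Rmult_le_compat_l; [lra|]. apply Rinv_le_contravar; lra. }
assert (pR : Rabs (psum (fun i => saw_err2 N (log_right k K (S i))) HR) <= 4 * k ^ 2 * L ^ 2 * (z ^ 2) ^ 2).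
{ eapply Rle_trans; [apply (saw_err2_sum_bound N _ q)|exact pc]; [easy|].
  intros j hj. apply (log_right_bounds k K HR); try easy; lia. }
assert (pL : Rabs (psum (fun i => saw_err2 N (log_left k K (S i))) HL) <= 4 * k ^ 2 * L ^ 2 * (z ^ 2) ^ 2).
{ eapply Rle_trans; [apply (saw_err2_sum_bound N _ q)|exact pc]; [easy|].
  intros j hj. apply (log_left_bounds k K HL); try easy; lia. }
assert (pp : Rabs (psum (fun i => saw_osc N (log_right k K (S i)) - saw_osc N (log_left k K (S i))) I0)
   <= k ^ 2 * z ^ 2 + k ^ 3 * L * z ^ 2).
{ apply Rle_trans with (psum (fun _ => k ^ 2 * INR I0 / INR K + k ^ 3 * L / odd_freq N) I0).
  - apply psum_abs_le. intros i hi.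
    eapply Rle_trans; [apply (saw_osc_pair_bound k K HR HL); try easy; lia|].
    apply Rplus_le_compat_r. apply Rmult_le_compat_r; [left; apply Rinv_0_lt_compat; lra|].
    apply Rmult_le_compat_l; [left; apply hpk|]. apply le_INR; lia.
  - rewrite psum_const. assert (hI0 := pos_INR I0).
    assert (b1 : INR I0 ^ 2 / INR K <= z ^ 2).
    { rewrite ez. apply Rle_trans with ((INR K / (8 * sqrt (INR N))) ^ 2 / INR K).
      - apply Rmult_le_compat_r; [left; apply Rinv_0_lt_compat; lra|]. apply pow_incr; lra.
      - replace ((INR K / (8 * sqrt (INR N))) ^ 2 / INR K) with (/ 64 * (INR K / (sqrt (INR N) * sqrt (INR N)))) by (field; lra).
        rewrite eN. assert (0 < INR K / INR N) by (apply Rdiv_lt_0_compat; lra). lra. }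
    assert (b2 : INR I0 / odd_freq N <= z ^ 2).
    { rewrite ez. apply Rmult_le_compat; try lra; [left; apply Rinv_0_lt_compat; lra|].
      apply Rinv_le_contravar; lra. }
    replace (INR I0 * (k ^ 2 * INR I0 / INR K + k ^ 3 * L / odd_freq N)) with
      (k ^ 2 * (INR I0 ^ 2 / INR K) + k ^ 3 * L * (INR I0 / odd_freq N)) by (field; lra).
    assert (h2 := hpk 2%nat). assert (h3 := hpk 3%nat).
    apply Rplus_le_compat; apply Rmult_le_compat_l; try lra. nra. }
assert (eR : psum (fun i => saw_err N (log_right k K (S i))) HR =
   psum (fun i => saw_err2 N (log_right k K (S i))) HR + (psum (fun i => saw_osc N (log_right k K (S i))) I0 +
     psum (fun j => saw_osc N (log_right k K (S I0 + j))) (HR - I0))).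
{ replace HR with (I0 + (HR - I0))%nat at 1 2 by lia. 
  rewrite <- (psum_split (fun i => saw_osc N (log_right k K (S i)))).
  rewrite <- psum_plus. apply psum_ext. intros; unfold saw_err2; ring. }
assert (eL : psum (fun i => saw_err N (log_left k K (S i))) HL =
   psum (fun i => saw_err2 N (log_left k K (S i))) HL + (psum (fun i => saw_osc N (log_left k K (S i))) I0 +
     psum (fun j => saw_osc N (log_left k K (S I0 + j))) (HL - I0))).
{ replace HL with (I0 + (HL - I0))%nat at 1 2 by lia. 
  rewrite <- (psum_split (fun i => saw_osc N (log_left k K (S i)))).
  rewrite <- psum_plus. apply psum_ext. intros; unfold saw_err2; ring. }
rewrite eR, eL. rewrite psum_minus in pp.
set (PR := psum (fun i => saw_err2 N (log_right k K (S i))) HR) in *.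
set (PL := psum (fun i => saw_err2 N (log_left k K (S i))) HL) in *.
set (OR := psum (fun i => saw_osc N (log_right k K (S i))) I0) in *.
set (OL := psum (fun i => saw_osc N (log_left k K (S i))) I0) in *.
set (TR := psum (fun j => saw_osc N (log_right k K (S I0 + j))) (HR - I0)) in *.
set (TL := psum (fun j => saw_osc N (log_left k K (S I0 + j))) (HL - I0)) in *.
clearbody PR PL OR OL TR TL.
assert (hfin : 2 * (4 * k ^ 2 * L ^ 2 * (z ^ 2) ^ 2) + (k ^ 2 * z ^ 2 + k ^ 3 * L * z ^ 2) + 2 * (c1 * z + c2 * z ^ 2) <= C * z).
{ assert (q1 : z ^ 2 <= Y * z) by nra.
  assert (q2 : (z ^ 2) ^ 2 <= Y ^ 3 * z).
  { apply Rle_trans with (Y * z ^ 2 * Y); [|nra]. assert (0 <= z ^ 2) by nra. nra. }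
  assert (h2 := hpk 2%nat). assert (h3 := hpk 3%nat).
  assert (hL2 : 0 < L ^ 2) by (apply pow_lt; lra).
  assert (r1 : 8 * k ^ 2 * L ^ 2 * (z ^ 2) ^ 2 <= 8 * k ^ 2 * L ^ 2 * (Y ^ 3 * z)).
  { apply Rmult_le_compat_l; [nra|easy]. }
  assert (r2 : (k ^ 2 + k ^ 3 * L + 2 * c2) * z ^ 2 <= (k ^ 2 + k ^ 3 * L + 2 * c2) * (Y * z)).
  { apply Rmult_le_compat_l; [nra|easy]. }
  unfold C. lra. }
eapply Rle_trans; [|exact hfin].
apply Rabs_le_between in pR, pL, pp, tR, tL. apply Rabs_le. lra.
Qed.

(** * Summation over the powers of k *)

Definition lnsum (a n : nat) := psum (fun i => ln (INR (a + S i))) n.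

(** One step changes the difference by 1 - (y + 1/2) ln (1 + 1 / y), which is
    between - (1 / y - 1 / (y + 1)) / 4 and 0. *)
Lemma stirling_increment a n : (1 <= a)%nat ->
  Rabs (lnsum a n - (((INR (a + n) + / 2) * ln (INR (a + n)) - INR (a + n))
                     - ((INR a + / 2) * ln (INR a) - INR a))) <= / 4 * / INR a.
Proof.
intros ha.
assert (h : Rabs (lnsum a n - (((INR (a + n) + / 2) * ln (INR (a + n)) - INR (a + n))
                     - ((INR a + / 2) * ln (INR a) - INR a))) <= / 4 * (/ INR a - / INR (a + n))).
{ induction n as [|n IH].
  - unfold lnsum; simpl psum. rewrite Nat.add_0_r.
    match goal with |- Rabs ?e <= _ => replace e with 0 by ring end. rewrite Rabs_R0; lra.
  - unfold lnsum in *. rewrite psum_S. rewrite !Nat.add_succ_r, !S_INR.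
    set (y := INR (a + n)) in *.
    assert (hy : 0 < y) by (apply lt_0_INR; lia).
    assert (hb := logstep_bounds y hy).
    assert (hc : - (/ 4 * (/ y - / (y + 1))) <= 1 - (y + / 2) * logstep y <= 0).
    { split.
      - assert ((y + / 2) * logstep y <= (y + / 2) * ((y + / 2) / (y * (y + 1)))) by (apply Rmult_le_compat_l; lra).
        replace ((y + / 2) * ((y + / 2) / (y * (y + 1)))) with (1 + / 4 * (/ y - / (y + 1))) in H by (field; lra).
        lra.
      - assert ((y + / 2) * / (y + / 2) <= (y + / 2) * logstep y) by (apply Rmult_le_compat_l; lra).
        rewrite Rinv_r in H; lra. }
    unfold logstep in hc. apply Rabs_le_between in IH. apply Rabs_le. lra. }
assert (0 < / INR (a + n)) by (apply Rinv_0_lt_compat, lt_0_INR; lia). lra.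
Qed.

Lemma saw_period N v j : saw N (v + INR j) = saw N v.
Proof.
unfold saw. apply psum_ext. intros i _. f_equal.
replace (2 * PI * INR (S i) * (v + INR j)) with (2 * PI * INR (S i) * v + 2 * INR (S i * j) * PI)
 by (rewrite mult_INR; ring).
apply sin_period.
Qed.

Lemma saw_0 N : saw N 0 = 0.
Proof.
unfold saw. rewrite (psum_ext _ (fun _ => 0)), psum_const; [ring|].
intros i _. rewrite Rmult_0_r, sin_0. unfold Rdiv; ring.
Qed.

(** The integers m between K and k K are attributed to K or to k K according to
    whether log_k (m / K) <= 1/2, that is m <= [mid k K]. *)
Definition mid (k K : nat) := Nat.sqrt (k * (K * K)).

Lemma mid_spec k K : (mid k K * mid k K <= k * (K * K) < S (mid k K) * S (mid k K))%nat.
Proof. apply Nat.sqrt_spec; lia. Qed.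

Lemma mid_ge k K : (2 <= k)%nat -> (K + K / 8 <= mid k K)%nat.
Proof.
intros hk. assert (h := mid_spec k K).
assert (h8 : (8 * (K / 8) <= K)%nat) by (apply Nat.Div0.mul_div_le).
set (q := (K / 8)%nat) in *. clearbody q.
apply Nat.nlt_ge. intros hlt. assert (S (mid k K) <= K + q)%nat by lia.
assert (S (mid k K) * S (mid k K) <= (K + q) * (K + q))%nat by (now apply Nat.mul_le_mono).
assert (2 * (K * K) <= k * (K * K))%nat by (apply Nat.mul_le_mono_r; lia).
nia.
Qed.

Lemma mid_lt k K : (2 <= k)%nat -> (1 <= K)%nat -> (mid k K + (k * K) / 8 < k * K)%nat.
Proof.
intros hk hK. assert (h := mid_spec k K).
assert (h8 : (8 * (k * K / 8) <= k * K)%nat) by (apply Nat.Div0.mul_div_le).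
set (q := (k * K / 8)%nat) in *. clearbody q.
set (m := mid k K) in *. clearbody m.
apply Nat.nle_gt. intros hle.
assert (hm : (7 * (k * K) <= 8 * m)%nat) by lia.
assert ((7 * (k * K)) * (7 * (k * K)) <= (8 * m) * (8 * m))%nat by (now apply Nat.mul_le_mono).
assert (k * (K * K) * 2 <= (k * K) * (k * K))%nat by nia.
assert (1 <= k * (K * K))%nat by nia.
nia.
Qed.

Lemma mid_right_half k K : right_half (INR k) K (mid k K - K) \/ (mid k K < K)%nat.
Proof.
destruct (Nat.lt_ge_cases (mid k K) K) as [h|h]; [now right|left].
unfold right_half. replace (K + (mid k K - K))%nat with (mid k K) by lia.
assert (h1 := proj1 (mid_spec k K)). apply le_INR in h1. rewrite !mult_INR in h1. lra.
Qed.

Lemma mid_left_half k K : (2 <= k)%nat -> (1 <= K)%nat ->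
  left_half (INR k) (k * K) (k * K - 1 - mid k K).
Proof.
intros hk hK. assert (h := mid_lt k K hk hK). split; [lia|].
replace (k * K - (k * K - 1 - mid k K))%nat with (S (mid k K)) by lia.
assert (h1 := proj2 (mid_spec k K)). apply Nat.lt_le_incl, le_INR in h1. rewrite !mult_INR in *.
assert (hk0 := pos_INR k).
replace ((INR k * INR K) ^ 2) with (INR k * (INR k * (INR K * INR K))) by ring.
apply Rmult_le_compat_l; [easy|]. lra.
Qed.

Definition vmid (k K : nat) := ln (INR (mid k K) / INR K) / ln (INR k).

Definition saw_sum (k N M : nat) := psum (fun i => saw N (ln (INR (S i)) / ln (INR k))) M.

(** Equal to M times [smooth_saw_lim] at log_k (M / K), where M = [mid k K] and K is
    a power of k: the integral of the sawtooth of log_k over (0, M]. *)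
Definition saw_integral (k K : nat) :=
  INR (mid k K) * (/ 2 - vmid k K + / ln (INR k)) - INR k * INR K / (INR k - 1).

(** Trapezoidal sum minus integral up to [mid k K], hence the subtraction of half
    of the sawtooth at the endpoint. *)
Definition saw_defect (k N K : nat) :=
  saw_sum k N (mid k K) - saw_integral k K - / 2 * (/ 2 - vmid k K).

Lemma ln_pow_ratio k j m : (2 <= k)%nat -> 0 < m ->
  ln m / ln (INR k) = ln (m / INR (k ^ j)) / ln (INR k) + INR j.
Proof.
intros hk hm. assert (hk0 : 1 < INR k) by (apply (lt_INR 1); lia).
assert (hL := ln_pos _ hk0). rewrite pow_INR.
rewrite ln_div, ln_pow by (try apply pow_lt; lra). field. lra.
Qed.

Lemma saw_right k N j i : (2 <= k)%nat ->
  saw N (ln (INR (k ^ j + i)) / ln (INR k)) = / 2 - log_right (INR k) (k ^ j) i - saw_err N (log_right (INR k) (k ^ j) i).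
Proof.
intros hk. assert (hp : (0 < k ^ j)%nat) by (apply Nat.neq_0_lt_0, Nat.pow_nonzero; lia).
rewrite (ln_pow_ratio k j) by (try apply lt_0_INR; lia).
rewrite saw_period. unfold saw_err, log_right. ring.
Qed.

Lemma saw_left k N j i : (2 <= k)%nat -> (i < k ^ j)%nat ->
  saw N (ln (INR (k ^ j - i)) / ln (INR k)) = - (/ 2 - log_left (INR k) (k ^ j) i - saw_err N (log_left (INR k) (k ^ j) i)).
Proof.
intros hk hi. assert (hm : 0 < INR (k ^ j - i)) by (apply lt_0_INR; lia).
assert (hK : 0 < INR (k ^ j)) by (apply lt_0_INR; lia).
rewrite (ln_pow_ratio k j) by easy.
rewrite saw_period.
replace (ln (INR (k ^ j - i) / INR (k ^ j)) / ln (INR k)) with (- log_left (INR k) (k ^ j) i).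
- rewrite saw_opp. unfold saw_err. ring.
- unfold log_left. rewrite !ln_div by easy. unfold Rdiv; ring.
Qed.

(** By periodicity and oddness of [saw], the terms around K = k^(j+1) are values
    at [log_right] and opposites of values at [log_left]. *)
Lemma saw_sum_step k N j : (2 <= k)%nat ->
  let K := (k * k ^ j)%nat in let m := mid k K in let m' := mid k (k ^ j) in
  let HR := (m - K)%nat in let HL := (K - 1 - m')%nat in
  saw_sum k N m - saw_sum k N m' =
   (psum (fun i => / 2 - log_right (INR k) K (S i)) HR - psum (fun i => / 2 - log_left (INR k) K (S i)) HL)
   - (psum (fun i => saw_err N (log_right (INR k) K (S i))) HR - psum (fun i => saw_err N (log_left (INR k) K (S i))) HL).
Proof.
intros hk K m m' HR HL.
assert (hp : (1 <= k ^ j)%nat) by (apply Nat.neq_0_lt_0, Nat.pow_nonzero; lia).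
assert (hm := mid_ge k K hk). fold m in hm. assert (hm' := mid_lt k (k ^ j) hk hp). fold K m' in hm'.
assert (eKj : K = (k ^ S j)%nat) by reflexivity.
unfold saw_sum. replace m with (m' + (HL + (1 + HR)))%nat by (unfold HL, HR; lia).
rewrite psum_split, psum_split, psum_split.
assert (e1 : psum (fun i => saw N (ln (INR (S (m' + i))) / ln (INR k))) HL =
  -1 * (psum (fun i => / 2 - log_left (INR k) K (S i)) HL - psum (fun i => saw_err N (log_left (INR k) K (S i))) HL)).
{ rewrite <- psum_minus, <- psum_scal. rewrite <- psum_rev. apply psum_ext. intros i hi.
  replace (S (m' + (HL - 1 - i))) with (K - S i)%nat by (unfold HL in *; lia).
  rewrite eKj, saw_left; [ring|easy|]. rewrite <- eKj. unfold HL in hi; lia. }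
assert (e2 : psum (fun i => saw N (ln (INR (S (m' + (HL + i)))) / ln (INR k))) 1 = 0).
{ change (0 + saw N (ln (INR (S (m' + (HL + 0)))) / ln (INR k)) = 0). replace (S (m' + (HL + 0))) with (k ^ S j + 0)%nat by (rewrite <- eKj; unfold HL; lia).
  rewrite saw_right by easy. unfold log_right. rewrite Nat.add_0_r, Rdiv_diag, ln_1 by (rewrite <- eKj; apply not_0_INR; lia).
  unfold Rdiv. rewrite Rmult_0_l. unfold saw_err. rewrite saw_0. ring. }
assert (e3 : psum (fun i => saw N (ln (INR (S (m' + (HL + (1 + i))))) / ln (INR k))) HR =
  psum (fun i => / 2 - log_right (INR k) K (S i)) HR - psum (fun i => saw_err N (log_right (INR k) K (S i))) HR).
{ rewrite <- psum_minus. apply psum_ext. intros i hi.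
  replace (S (m' + (HL + (1 + i)))) with (K + S i)%nat by (unfold HL in *; lia).
  rewrite eKj. now apply saw_right. }
rewrite e1, e2, e3. ring.
Qed.

(** The sums are explicit in terms of sums of logarithms, and Stirling's formula
    applies between the two consecutive values of [mid].  The one-sided
    values 1/2 and - 1/2 of the sawtooth at K compensate each other. *)
Lemma saw_defect_step k j : (2 <= k)%nat ->
  let K := (k * k ^ j)%nat in let m := mid k K in let m' := mid k (k ^ j) in
  let HR := (m - K)%nat in let HL := (K - 1 - m')%nat in
  Rabs ((psum (fun i => / 2 - log_right (INR k) K (S i)) HR - psum (fun i => / 2 - log_left (INR k) K (S i)) HL)
    - (saw_integral k K - saw_integral k (k ^ j))
    - / 2 * ((/ 2 - vmid k K) - (/ 2 - vmid k (k ^ j))))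
  <= / ln (INR k) * / INR (k ^ j).
Proof.
intros hk K m m' HR HL.
assert (hp : (1 <= k ^ j)%nat) by (apply Nat.neq_0_lt_0, Nat.pow_nonzero; lia).
assert (hm := mid_ge k K hk). fold m in hm. assert (hm' := mid_lt k (k ^ j) hk hp). fold K m' in hm'.
assert (hm2 := mid_ge k (k ^ j) hk). fold m' in hm2.
assert (hk0 : 1 < INR k) by (apply (lt_INR 1); lia).
assert (hL := ln_pos _ hk0). set (L := ln (INR k)) in *.
assert (hK1 : 0 < INR (k ^ j)) by (apply lt_0_INR; lia).
assert (hKe : INR K = INR k * INR (k ^ j)) by (unfold K; apply mult_INR).
assert (hK0 : 0 < INR K) by (rewrite hKe; nra).
assert (hlnK : ln (INR (k ^ j)) = ln (INR K) - L).
{ rewrite hKe, ln_mult by lra. unfold L; ring. }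
assert (hm0 : 0 < INR m) by (apply lt_0_INR; lia). assert (hm0' : 0 < INR m') by (apply lt_0_INR; lia).
assert (s1 : psum (fun i => / 2 - log_right (INR k) K (S i)) HR =
   INR HR * (/ 2 + ln (INR K) / L) - / L * lnsum K HR).
{ unfold lnsum. rewrite <- psum_const, <- psum_scal, <- psum_minus. apply psum_ext. intros i hi.
  unfold log_right. fold L. rewrite ln_div by (try apply lt_0_INR; lia || lra). field. lra. }
assert (s2 : psum (fun i => / 2 - log_left (INR k) K (S i)) HL =
   INR HL * (/ 2 - ln (INR K) / L) + / L * lnsum m' HL).
{ unfold lnsum. rewrite <- (psum_rev (fun i => ln (INR (m' + S i)))).
  rewrite <- psum_const, <- psum_scal, <- psum_plus. apply psum_ext. intros i hi.
  unfold log_left. fold L. replace (m' + S (HL - 1 - i))%nat with (K - S i)%nat by (unfold HL in *; lia).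
  rewrite ln_div by (try apply lt_0_INR; unfold HL in *; lia || lra). field. lra. }
assert (s3 : lnsum m' (HL + (1 + HR)) = lnsum m' HL + (ln (INR K) + lnsum K HR)).
{ unfold lnsum. rewrite psum_split, psum_split. f_equal. f_equal.
  - change (0 + ln (INR (m' + S (HL + 0))) = ln (INR K)). rewrite Rplus_0_l. f_equal. f_equal. unfold HL; lia.
  - apply psum_ext. intros i hi. f_equal. f_equal. unfold HL; lia. }
assert (st := stirling_increment m' (HL + (1 + HR)) ltac:(lia)).
replace (m' + (HL + (1 + HR)))%nat with m in st by (unfold HL, HR; lia).
rewrite s3 in st.
assert (eHR : INR HR = INR m - INR K) by (unfold HR; apply minus_INR; lia).
assert (eHL : INR HL = INR K - 1 - INR m').
{ unfold HL. rewrite !minus_INR by lia. easy. }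
rewrite s1, s2, eHR, eHL. unfold saw_integral, vmid. fold m m' L.
rewrite !ln_div by easy. rewrite hlnK.
set (E := lnsum m' HL + (ln (INR K) + lnsum K HR) -
   ((INR m + / 2) * ln (INR m) - INR m - ((INR m' + / 2) * ln (INR m') - INR m'))) in *.
match goal with |- Rabs ?e <= _ => replace e with (- (/ L * E)) end.
2:{ unfold E. rewrite hKe. field. lra. }
rewrite Rabs_Ropp, Rabs_mult, (Rabs_pos_eq (/ L)) by (left; now apply Rinv_0_lt_compat).
apply Rmult_le_compat_l; [left; now apply Rinv_0_lt_compat|].
eapply Rle_trans; [exact st|].
assert (/ INR m' <= / INR (k ^ j)) by (apply Rinv_le_contravar; [easy|apply le_INR; lia]).
assert (0 < / INR m') by now apply Rinv_0_lt_compat. lra.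
Qed.

Lemma psum_geom_le r n : 0 <= r <= / 2 -> psum (fun j => r ^ j) n <= 2.
Proof.
intros hr.
assert (h : psum (fun j => r ^ j) n <= 2 * (1 - r ^ n)).
{ induction n as [|n IH]; [simpl; lra|]. rewrite psum_S. assert (0 <= r ^ n) by (apply pow_le; lra).
  simpl (r ^ S n). nra. }
assert (0 <= r ^ n) by (apply pow_le; lra). lra.
Qed.

(** Adding the steps gives a geometric series with ratio 1 / k from Stirling's
    formula and one with ratio sqrt k, dominated by its last term, from
    [window_bound]. *)
Lemma saw_defect_bound k Y : (2 <= k)%nat -> 1 <= Y ->
  exists C, 0 < C /\ forall N J, (1 <= N)%nat -> INR (k ^ J) <= Y * INR N ->
  Rabs (saw_defect k N (k ^ J)) <= C.
Proof.
intros hk hY.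
assert (hk0 : 2 <= INR k) by (apply (le_INR 2); easy).
assert (hL := ln_pos (INR k) ltac:(lra)). set (L := ln (INR k)) in *.
destruct (window_bound (INR k) Y ltac:(lra) hY) as [C [hC hwin]].
set (m0 := mid k (k ^ 0)).
set (C0 := INR m0 * (1 + L / ln 2) + Rabs (saw_integral k (k ^ 0)) + Rabs (/ 2 * (/ 2 - vmid k (k ^ 0)))).
assert (hln2 : 0 < ln 2) by (apply ln_pos; lra).
assert (hC0 : 0 <= C0).
{ unfold C0. assert (h1 := Rabs_pos (saw_integral k (k ^ 0))).
  assert (h2 := Rabs_pos (/ 2 * (/ 2 - vmid k (k ^ 0)))).
  assert (0 < L / ln 2) by now apply Rdiv_lt_0_compat.
  assert (0 <= INR m0 * (1 + L / ln 2)) by (apply Rmult_le_pos; [apply pos_INR|lra]). lra. }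
assert (hsY : 0 < sqrt Y) by (apply sqrt_lt_R0; lra).
exists (C0 + 2 / L + C * 4 * sqrt Y).
assert (h2L : 0 < 2 / L) by (apply Rdiv_lt_0_compat; lra).
split; [nra|]. intros N J hN hJ.
assert (hN0 : 1 <= INR N) by now apply (le_INR 1).
set (q := sqrt (INR k)).
assert (hsN : 0 < sqrt (INR N)) by (apply sqrt_lt_R0; lra).
assert (hq2 : q * q = INR k) by (apply sqrt_sqrt; lra).
assert (hq0 : 0 <= q) by apply sqrt_pos.
assert (hq : 4 / 3 <= q) by nra.
assert (base : Rabs (saw_defect k N (k ^ 0)) <= C0).
{ unfold saw_defect. fold m0. unfold Rminus at 1 2.
  eapply Rle_trans; [apply Rabs_triang|]. rewrite Rabs_Ropp. unfold C0.
  apply Rplus_le_compat_r. eapply Rle_trans; [apply Rabs_triang|]. rewrite Rabs_Ropp.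
  apply Rplus_le_compat_r. unfold saw_sum. rewrite <- psum_const. apply psum_abs_le.
  intros i hi. fold L.
  assert (hd : 0 < L / ln 2) by now apply Rdiv_lt_0_compat.
  destruct i as [|i].
  - change (INR 1) with 1. rewrite ln_1. unfold Rdiv at 1. rewrite Rmult_0_l, saw_0, Rabs_R0. lra.
  - assert (hx : 2 <= INR (S (S i))) by (apply (le_INR 2); lia).
    set (v := ln (INR (S (S i))) / L).
    assert (hv2 : v <= / 2).
    { unfold v, L. apply half_log_le; [lra|lra|].
      assert (h := proj1 (mid_spec k (k ^ 0))). fold m0 in h. simpl (k ^ 0)%nat in h. rewrite !Nat.mul_1_r in h.
      apply le_INR in h. rewrite mult_INR in h.
      assert (INR (S (S i)) <= INR m0) by (apply le_INR; lia). nra. }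
    assert (hv1 : ln 2 / L <= v).
    { unfold v. apply Rmult_le_compat_r; [left; now apply Rinv_0_lt_compat|]. apply ln_le; lra. }
    assert (hv0 : 0 < ln 2 / L) by now apply Rdiv_lt_0_compat.
    assert (hr := saw_err_bound N v ltac:(lra)). assert (hw := odd_freq_ge1 N).
    assert (hb : / (odd_freq N * v) <= L / ln 2).
    { replace (L / ln 2) with (/ (ln 2 / L)) by (field; lra). apply Rinv_le_contravar; nra. }
    replace (saw N v) with ((/ 2 - v) - saw_err N v) by (unfold saw_err; ring).
    apply Rabs_le_between in hr. apply Rabs_le. lra. }
assert (ind : Rabs (saw_defect k N (k ^ J)) <= C0 + / L * psum (fun j => (/ INR k) ^ j) J
   + C / sqrt (INR N) * psum (fun j => q ^ j) (S J)).
{ induction J as [|J IH].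
  - simpl psum. assert (0 < C / sqrt (INR N)) by now apply Rdiv_lt_0_compat. simpl in base |- *. lra.
  - assert (hKJ : INR (k ^ J) <= INR (k ^ S J)).
    { apply le_INR. simpl. nia. }
    assert (hp : (1 <= k ^ J)%nat) by (apply Nat.neq_0_lt_0, Nat.pow_nonzero; lia).
    specialize (IH ltac:(lra)).
    assert (st := saw_sum_step k N J hk). assert (sd := saw_defect_step k J hk).
    cbv zeta in st, sd. change (k * k ^ J)%nat with (k ^ S J)%nat in st, sd.
    assert (hm := mid_ge k (k ^ S J) hk). assert (hml := mid_lt k (k ^ J) hk hp).
    change (k * k ^ J)%nat with (k ^ S J)%nat in hml.
    assert (W := hwin (k ^ S J)%nat (mid k (k ^ S J) - k ^ S J)%nat (k ^ S J - 1 - mid k (k ^ J))%nat N).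
    assert (hr : right_half (INR k) (k ^ S J) (mid k (k ^ S J) - k ^ S J)).
    { destruct (mid_right_half k (k ^ S J)) as [h|h]; [easy|lia]. }
    assert (W' := W ltac:(lia) hN hr (mid_left_half k (k ^ J) hk hp) ltac:(lia) ltac:(lia) hJ).
    clear W.
    assert (eq : sqrt (INR (k ^ S J)) = q ^ S J).
    { rewrite pow_INR. unfold q. clear. induction (S J) as [|n IH]; [simpl; apply sqrt_1|].
      simpl. rewrite sqrt_mult, IH; [easy|apply pos_INR|apply pow_le, pos_INR]. }
    rewrite eq in W'.
    rewrite (psum_S _ J), (psum_S _ (S J)).
    replace ((/ INR k) ^ J) with (/ INR (k ^ J)) by (rewrite pow_INR, pow_inv; easy).
    set (RR := psum (fun i => saw_err N (log_right (INR k) (k ^ S J) (S i))) (mid k (k ^ S J) - k ^ S J) -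
      psum (fun i => saw_err N (log_left (INR k) (k ^ S J) (S i))) (k ^ S J - 1 - mid k (k ^ J))) in *.
    set (BB := psum (fun i => / 2 - log_right (INR k) (k ^ S J) (S i)) (mid k (k ^ S J) - k ^ S J) -
      psum (fun i => / 2 - log_left (INR k) (k ^ S J) (S i)) (k ^ S J - 1 - mid k (k ^ J))) in *.
    replace (saw_defect k N (k ^ S J)) with (saw_defect k N (k ^ J) +
      (BB - (saw_integral k (k ^ S J) - saw_integral k (k ^ J))
       - / 2 * ((/ 2 - vmid k (k ^ S J)) - (/ 2 - vmid k (k ^ J)))) - RR).
    2:{ unfold saw_defect. lra. }
    fold L in sd.
    replace (C * (q ^ S J / sqrt (INR N))) with (C / sqrt (INR N) * q ^ S J) in W' by (field; lra).
    apply Rabs_le_between in IH, sd, W'. apply Rabs_le. lra. }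
eapply Rle_trans; [exact ind|].
assert (g1 : psum (fun j => (/ INR k) ^ j) J <= 2).
{ apply psum_geom_le. split; [left; apply Rinv_0_lt_compat; lra|]. apply Rinv_le_contravar; lra. }
assert (g2 := psum_pow_le q J hq).
assert (eqJ : q ^ J = sqrt (INR (k ^ J))).
{ rewrite pow_INR. unfold q. clear. induction J as [|n IH]; [simpl; now rewrite sqrt_1|].
  simpl. rewrite sqrt_mult, IH; [easy|apply pos_INR|apply pow_le, pos_INR]. }
assert (g3 : q ^ J <= sqrt Y * sqrt (INR N)).
{ rewrite eqJ, <- sqrt_mult by lra. now apply sqrt_le_1_alt. }
assert (hiL : 0 < / L) by now apply Rinv_0_lt_compat.
assert (g4 : / L * psum (fun j => (/ INR k) ^ j) J <= 2 / L).
{ unfold Rdiv. rewrite (Rmult_comm 2). apply Rmult_le_compat_l; lra. }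
assert (g5 : C / sqrt (INR N) * psum (fun j => q ^ j) (S J) <= C / sqrt (INR N) * (4 * (sqrt Y * sqrt (INR N)))).
{ apply Rmult_le_compat_l; [left; now apply Rdiv_lt_0_compat|lra]. }
replace (C / sqrt (INR N) * (4 * (sqrt Y * sqrt (INR N)))) with (C * 4 * sqrt Y) in g5 by (field; lra).
lra.
Qed.

(** * Uniqueness of analytic continuation along a line *)

Definition analytic_R_at (f : R -> R) (x0 : R) : Prop :=
  exists (a : nat -> R) (r : R), 0 < r /\
    forall x, Rabs x < r -> is_pseries a x (f (x0 + x)).

Lemma analytic_R_ext f g x0 : (forall x, f x = g x) -> analytic_R_at f x0 -> analytic_R_at g x0.
Proof. intros e [a [r [hr h]]]. exists a, r; split; [easy|]. intros x hx. rewrite <- e. now apply h. Qed.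

Lemma analytic_R_plus f g x0 : analytic_R_at f x0 -> analytic_R_at g x0 -> analytic_R_at (fun x => f x + g x) x0.
Proof.
intros [a [r [hr h]]] [b [r' [hr' h']]].
exists (PS_plus a b), (Rmin r r'). split; [now apply Rmin_pos|].
intros x hx. apply (is_pseries_plus (K := R_AbsRing) (V := R_NormedModule)).
- apply h. eapply Rlt_le_trans; [exact hx|apply Rmin_l].
- apply h'. eapply Rlt_le_trans; [exact hx|apply Rmin_r].
Qed.

Lemma analytic_R_scal c f x0 : analytic_R_at f x0 -> analytic_R_at (fun x => c * f x) x0.
Proof.
intros [a [r [hr h]]]. exists (PS_scal c a), r. split; [easy|].
intros x hx. apply (is_pseries_scal (K := R_AbsRing) (V := R_NormedModule)).
- apply Rmult_comm.
- now apply h.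
Qed.

Lemma analytic_R_const c x0 : analytic_R_at (fun _ => c) x0.
Proof.
exists (fun n => match n with O => c | S _ => 0 end), 1. split; [lra|]. intros x _.
unfold is_pseries.
apply is_series_ext with (fun n => match n with O => c | S _ => 0 end).
{ intros [|n]; [change (c = 1 * c)|change (0 = pow_n (K := R_AbsRing) x (S n) * 0)]; ring. }
apply (is_series_decr_1 (V := R_NormedModule)).
apply is_series_ext with (fun _ : nat => 0); [easy|].
evar_last; [apply filterlim_ext with (fun _ : nat => 0); [|apply filterlim_const]|].
- intros n. rewrite sum_n_const. ring.
- unfold plus, opp; simpl; ring.
Qed.

Lemma analytic_R_mul_id f x0 : analytic_R_at f x0 -> analytic_R_at (fun x => x * f x) x0.
Proof.
intros hf.
assert (h1 := analytic_R_scal x0 _ _ hf).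
apply analytic_R_ext with (fun x => x0 * f x + (x - x0) * f x); [intros; ring|].
apply analytic_R_plus; [easy|]. clear h1.
destruct hf as [a [r [hr h]]]. exists (PS_incr_1 a), r. split; [easy|].
intros x hx. replace (x0 + x - x0) with x by ring.
apply (is_pseries_incr_1 (K := R_AbsRing) (V := R_NormedModule)). now apply h.
Qed.

Lemma CV_radius_ge_of_is_pseries a x l : is_pseries a x l -> Rbar_le (Rabs x) (CV_radius a).
Proof.
intros h. apply Rbar_not_lt_le. intros hlt.
apply (CV_disk_outside a x hlt).
apply ex_series_lim_0. exists l.
apply is_series_ext with (2 := h). intros n.
rewrite pow_n_pow. apply Rmult_comm.
Qed.

(** The hypothesis is one-sided because the identity theorem extends an equality
    known on the right to the left. *)
Lemma pseries_zero_right_coef0 a r : 0 < r ->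
  (forall x, 0 < x < r -> is_pseries a x 0) -> a 0%nat = 0.
Proof.
intros hr h.
assert (hcv : Rbar_lt (Rabs 0) (CV_radius a)).
{ assert (h1 := CV_radius_ge_of_is_pseries a (r / 2) 0 (h (r / 2) ltac:(lra))).
  apply Rbar_lt_le_trans with (2 := h1). simpl. rewrite Rabs_R0, Rabs_pos_eq; lra. }
assert (hc := PSeries_continuity a 0 hcv).
destruct (Req_dec (a 0%nat) 0) as [e|ne]; [easy|exfalso].
destruct (hc (Rabs (a 0%nat)) (Rabs_pos_lt _ ne)) as [d [hd H]].
(* A point of the right neighbourhood where the series is within |a 0| of a 0. *)
set (x := Rmin (d / 2) (r / 2)).
assert (hx : 0 < x) by (apply Rmin_pos; lra).
assert (hx1 : x <= d / 2) by apply Rmin_l. assert (hx2 : x <= r / 2) by apply Rmin_r.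
assert (H1 := H x). simpl in H1. unfold Rdist in H1.
rewrite (is_pseries_unique a x 0) in H1 by (apply h; lra).
rewrite PSeries_0, Rminus_0_l in H1.
rewrite Rabs_Ropp in H1. apply (Rlt_irrefl (Rabs (a 0%nat))). apply H1. split.
- unfold D_x, no_cond. split; [easy|lra].
- rewrite Rminus_0_r, Rabs_pos_eq; lra.
Qed.

Lemma pseries_zero_right a r : 0 < r ->
  (forall x, 0 < x < r -> is_pseries a x 0) -> forall n, a n = 0.
Proof.
intros hr h n. revert a h; induction n as [|n IH]; intros a h.
- exact (pseries_zero_right_coef0 a r hr h).
- apply (IH (PS_decr_1 a)). intros x hx.
  assert (e0 := pseries_zero_right_coef0 a r hr h).
  assert (H := is_pseries_decr_1 (K := R_AbsRing) (V := R_NormedModule) a x (/ x) 0).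
  rewrite e0 in H.
  replace 0 with (scal (/ x) (plus 0 (opp 0)) : R).
  + apply H; [|apply h; lra]. unfold mult, one; simpl. field. lra.
  + unfold scal, plus, opp; simpl; unfold mult; simpl; ring.
Qed.

(** At the infimum of the points from which u vanishes onwards, all the
    coefficients vanish, so that u vanishes on the left of this infimum as well. *)
Lemma analytic_R_identity u :
  (forall x, 0 <= x <= 2 -> analytic_R_at u x) -> (forall x, 1 < x -> u x = 0) -> u 0 = 0.
Proof.
intros han hz.
set (S y := 0 <= y <= 2 /\ forall x, 2 - y <= x -> u x = 0).
assert (S0 : S 0) by (split; [lra|intros x hx; apply hz; lra]).
destruct (completeness S) as [m [hm1 hm2]].
- exists 2. intros y [hy _]; lra.
- now exists 0.
- assert (hm : 0 <= m <= 2).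
  { split; [now apply hm1|]. apply hm2. intros y [hy _]; lra. }
  assert (hright : forall x, 2 - m < x -> u x = 0).
  { intros x hx. destruct (Req_dec (u x) 0) as [e|ne]; [easy|exfalso].
    assert (m <= 2 - x); [|lra]. apply hm2. intros y [hy1 hy2].
    apply Rnot_lt_le; intros hlt. apply ne, hy2. lra. }
  destruct (han (2 - m) ltac:(lra)) as [a [r [hr ha]]].
  assert (hcoef := pseries_zero_right a r hr).
  assert (hall : forall n, a n = 0).
  { apply hcoef. intros x hx. assert (H := ha x). rewrite hright in H by lra.
    apply H. rewrite Rabs_pos_eq; lra. }
  assert (hloc : forall x, Rabs x < r -> u (2 - m + x) = 0).
  { intros x hx. rewrite <- (is_pseries_unique a x _ (ha x hx)).
    rewrite (PSeries_ext a (fun _ => 0) x hall). apply PSeries_const_0. }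
  destruct (Rlt_dec m 2) as [hlt|hge].
  + exfalso. set (e := Rmin (r / 2) (2 - m)).
    assert (he : 0 < e) by (apply Rmin_pos; lra).
    assert (he1 : e <= r / 2) by apply Rmin_l. assert (he2 : e <= 2 - m) by apply Rmin_r.
    assert (H : S (m + e)).
    { split; [lra|]. intros x hx. destruct (Rlt_dec (2 - m) x) as [|hn]; [now apply hright|].
      replace x with (2 - m + (x - (2 - m))) by ring. apply hloc.
      apply Rabs_def1; lra. }
    assert (H' := hm1 _ H). lra.
  + assert (E := hloc 0). rewrite Rabs_R0 in E. replace (2 - m + 0) with 0 in E by lra. now apply E.
Qed.

Lemma is_series_C_proj (p : C -> R) (a : nat -> C) (l : C) :
  (forall z w, p (z + w)%C = p z + p w) ->
  (forall z w eps, ball (M := C_UniformSpace) z eps w -> Rabs (p w - p z) < eps) ->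
  is_series (K := C_AbsRing) (V := C_NormedModule) a l ->
  is_series (fun n => p (a n)) (p l).
Proof.
intros hp hb h.
apply filterlim_locally. intros eps.
assert (H := proj1 (filterlim_locally (F := eventually) _ l) h eps).
apply filter_imp with (2 := H). intros n hn.
assert (e : sum_n (fun n => p (a n)) n = p (sum_n a n)).
{ clear hn. induction n as [|n IH]; [now rewrite !sum_O|]. rewrite !sum_Sn, IH. symmetry; apply hp. }
change (Rabs (sum_n (fun n => p (a n)) n - p l) < eps). rewrite e.
now apply hb.
Qed.

Lemma is_series_C_re (a : nat -> C) (l : C) :
  is_series (K := C_AbsRing) (V := C_NormedModule) a l -> is_series (fun n => Re (a n)) (Re l).
Proof. apply is_series_C_proj; [easy|]. intros z w eps h. exact (proj1 h). Qed.

Lemma is_series_C_im (a : nat -> C) (l : C) :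
  is_series (K := C_AbsRing) (V := C_NormedModule) a l -> is_series (fun n => Im (a n)) (Im l).
Proof. apply is_series_C_proj; [easy|]. intros z w eps h. exact (proj2 h). Qed.

Lemma pow_n_RtoC x n : pow_n (K := C_AbsRing) (RtoC x) n = RtoC (x ^ n).
Proof.
induction n as [|n IH]; [easy|]. simpl. rewrite IH. change (RtoC x * RtoC (x ^ n) = RtoC (x * x ^ n))%C.
now rewrite RtoC_mult.
Qed.

Lemma analytic_R_of_analytic_at f s0 t : analytic_at f (s0, t) ->
  analytic_R_at (fun s => Re (f (s, t))) s0 /\ analytic_R_at (fun s => Im (f (s, t))) s0.
Proof.
intros [a [r [hr h]]].
assert (H : forall x, Rabs x < r ->
  is_series (K := C_AbsRing) (V := C_NormedModule) (fun n => RtoC (x ^ n) * a n)%C (f (s0 + x, t)%R)).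
{ intros x hx.
  assert (e : ((((s0 + x)%R, t) : C) - (s0, t))%C = RtoC x).
  { unfold Cminus, Cplus, Copp, RtoC; simpl. f_equal; ring. }
  assert (H := h (s0 + x, t)%R). rewrite e, Cmod_R in H.
  apply is_series_ext with (2 := H hx). intros n. rewrite pow_n_RtoC. reflexivity. }
split.
- exists (fun n => Re (a n)), r. split; [easy|]. intros x hx.
  apply is_series_ext with (2 := is_series_C_re _ _ (H x hx)). intros n.
  transitivity (x ^ n * Re (a n)); [unfold Re, Im, Cmult, RtoC; cbn [fst snd]; match goal with |- ?a = ?b => change (@eq R a b) end; ring|]. rewrite <- pow_n_pow. reflexivity.
- exists (fun n => Im (a n)), r. split; [easy|]. intros x hx.
  apply is_series_ext with (2 := is_series_C_im _ _ (H x hx)). intros n.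
  transitivity (x ^ n * Im (a n)); [unfold Re, Im, Cmult, RtoC; cbn [fst snd]; match goal with |- ?a = ?b => change (@eq R a b) end; ring|]. rewrite <- pow_n_pow. reflexivity.
Qed.

(** * Analytic continuation by Euler-Maclaurin summation *)

Fixpoint exp_rem (n : nat) (y : R) : R :=
  match n with O => exp y | S n => exp_rem n y - y ^ n / INR (fact n) end.

Lemma exp_rem_0 n : exp_rem (S n) 0 = 0.
Proof.
induction n as [|n IH]; [simpl; rewrite exp_0; lra|].
change (exp_rem (S n) 0 - 0 ^ S n / INR (fact (S n)) = 0). rewrite IH, pow_ne_zero by easy.
unfold Rdiv; ring.
Qed.

Lemma exp_rem_derive n y : is_derive (exp_rem (S n)) y (exp_rem n y).
Proof.
induction n as [|n IH].
- simpl. auto_derive; [easy|ring].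
- apply is_derive_ext with (fun y => exp_rem (S n) y - y ^ S n / INR (fact (S n))); [easy|].
  evar_last.
  + refine (is_derive_minus _ _ y _ (y ^ n / INR (fact n)) IH _).
    auto_derive; [easy|]. change (1 * (INR (S n) * y ^ n) * / INR (fact (S n)) = y ^ n / INR (fact n)).
    rewrite fact_simpl, mult_INR. field.
    split; [apply INR_fact_neq_0|apply not_0_INR; lia].
  + reflexivity.
Qed.

Lemma exp_rem_continuous n y : continuous (exp_rem n) y.
Proof.
apply (ex_derive_continuous (V := R_NormedModule)). destruct n as [|n].
- simpl. auto_derive; easy.
- exists (exp_rem n y). apply exp_rem_derive.
Qed.

(** Weaker than the usual bound in y^n / n!, but geometric in n with a constant
    that only costs a power of the integer whose logarithm y is proportional to.
    The factor exp (2 y) + exp (- 2 y) is stable under integration of both signs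
    of y. *)
Lemma exp_rem_bound n y : Rabs (exp_rem n y) <= (/ 2) ^ n * (exp (2 * y) + exp (- (2 * y))).
Proof.
revert y; induction n as [|n IH]; intros y.
- simpl. rewrite Rabs_pos_eq by (left; apply exp_pos). rewrite Rmult_1_l.
  assert (h := exp_pos (2 * y)). assert (h' := exp_pos (- (2 * y))).
  assert (h1 := exp_pos (- y)). assert (h2 := exp_pos y).
  replace (exp (2 * y)) with (exp y * exp y) by (rewrite <- exp_plus; f_equal; ring).
  replace (exp (- (2 * y))) with (exp (- y) * exp (- y)) by (rewrite <- exp_plus; f_equal; ring).
  assert (e : exp y * exp (- y) = 1) by (rewrite <- exp_plus; replace (y + - y) with 0 by ring; apply exp_0).
  nra.
- assert (key : forall z, 0 <= z -> 
    Rabs (exp_rem (S n) z) <= (/ 2) ^ S n * (exp (2 * z) - exp (- (2 * z))) /\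
    Rabs (exp_rem (S n) (- z)) <= (/ 2) ^ S n * (exp (2 * z) - exp (- (2 * z)))).
  { intros z hz.
    set (g z := - ((/ 2) ^ S n * (exp (2 * z) - exp (- (2 * z))))).
    set (dg z := - ((/ 2) ^ n * (exp (2 * z) + exp (- (2 * z))))).
    assert (hg : forall x, is_derive g x (dg x)).
    { intros x. unfold g, dg. auto_derive; [easy|]. simpl. field. }
    assert (g0 : g 0 = 0) by (unfold g; rewrite Rmult_0_r, Ropp_0; ring).
    split.
    - assert (H := dist_le_of_derive (exp_rem (S n)) (exp_rem n) g dg 0 z hz
        (fun x _ => exp_rem_derive n x) (fun x _ => hg x)).
      rewrite exp_rem_0, g0, Rminus_0_l, Rabs_Ropp in H.
      replace ((/ 2) ^ S n * (exp (2 * z) - exp (- (2 * z)))) with (0 - g z) by (unfold g; ring).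
      apply H. intros x _. unfold dg. rewrite Ropp_involutive. apply IH.
    - assert (H := dist_le_of_derive (fun x => exp_rem (S n) (- x)) (fun x => - exp_rem n (- x)) g dg 0 z hz).
      cbv beta in H. rewrite Ropp_0, exp_rem_0, g0, Rminus_0_l, Rabs_Ropp in H.
      replace ((/ 2) ^ S n * (exp (2 * z) - exp (- (2 * z)))) with (0 - g z) by (unfold g; ring).
      apply H.
      + intros x _. evar_last.
        * refine (is_derive_comp (exp_rem (S n)) Ropp x _ (-1) (exp_rem_derive n (- x)) _).
          auto_derive; [easy|ring].
        * unfold scal; simpl; unfold mult; simpl. ring.
      + intros x _; apply hg.
      + intros x _. unfold dg. rewrite Ropp_involutive, Rabs_Ropp.
        eapply Rle_trans; [apply IH|]. replace (- (2 * - x)) with (2 * x) by ring.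
        replace (2 * - x) with (- (2 * x)) by ring. lra. }
  assert (hp : 0 < (/ 2) ^ S n) by (apply pow_lt; lra).
  assert (h := exp_pos (2 * y)). assert (h' := exp_pos (- (2 * y))).
  destruct (Rle_dec 0 y) as [hy|hy].
  + eapply Rle_trans; [apply (key y hy)|]. nra.
  + assert (k := proj2 (key (- y) ltac:(lra))). rewrite Ropp_involutive in k.
    eapply Rle_trans; [exact k|]. replace (- (2 * - y)) with (2 * y) by ring.
    replace (2 * - y) with (- (2 * y)) by ring. nra.
Qed.

(** Each integral is expanded in powers of x - x0 under the integral sign.  The
    remainders are bounded by 2^(-n) times a summable sequence, which permits the
    exchange of the two summations. *)
Lemma analytic_R_laplace_series (q l : nat -> R -> R) (B Lam : nat -> R) x0 rho :
  0 < rho ->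
  (forall m u, 0 <= u <= 1 -> continuous (q m) u) ->
  (forall m u, 0 <= u <= 1 -> continuous (l m) u) ->
  (forall m u, 0 <= u <= 1 -> Rabs (q m u * exp (- x0 * l m u)) <= B m) ->
  (forall m u, 0 <= u <= 1 -> 0 <= l m u <= Lam m) ->
  ex_series (fun m => B m * exp (2 * rho * Lam m)) ->
  analytic_R_at (fun x => Series (fun m => RInt (fun u => q m u * exp (- x * l m u)) 0 1)) x0
  /\ forall x, Rabs (x - x0) < rho -> ex_series (fun m => RInt (fun u => q m u * exp (- x * l m u)) 0 1).
Proof.
intros hrho hq hl hB hLam hsum.
set (q0 m u := q m u * exp (- x0 * l m u)).
assert (hq0 : forall m u, 0 <= u <= 1 -> continuous (q0 m) u).
{ intros m u hu. apply (continuous_mult (K := R_AbsRing) (q m) (fun u => exp (- x0 * l m u))); [now apply hq|].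
  apply (continuous_comp (fun u => - x0 * l m u) exp).
  - apply (continuous_mult (K := R_AbsRing) (fun _ => - x0)); [apply continuous_const|now apply hl].
  - apply (ex_derive_continuous (V := R_NormedModule)). auto_derive; easy. }
set (IR n x m := RInt (fun u => q0 m u * exp_rem n (- x * l m u)) 0 1).
set (c j m := RInt (fun u => q0 m u * ((- l m u) ^ j / INR (fact j))) 0 1).
assert (hcl : forall m u, 0 <= u <= 1 -> continuous (fun u => - l m u) u).
{ intros m u hu. apply (continuous_opp (l m)). now apply hl. }
assert (exI : forall n x m, ex_RInt (fun u => q0 m u * exp_rem n (- x * l m u)) 0 1).
{ intros n x m. apply (ex_RInt_continuous (V := R_CompleteNormedModule)). intros u hu.
  rewrite Rmin_left, Rmax_right in hu by lra.
  apply (continuous_mult (K := R_AbsRing) (q0 m)); [now apply hq0|].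
  apply (continuous_comp (fun u => - x * l m u) (exp_rem n)); [|apply exp_rem_continuous].
  apply (continuous_mult (K := R_AbsRing) (fun _ => - x)); [apply continuous_const|now apply hl]. }
assert (exc : forall j m, ex_RInt (fun u => q0 m u * ((- l m u) ^ j / INR (fact j))) 0 1).
{ intros j m. apply (ex_RInt_continuous (V := R_CompleteNormedModule)). intros u hu.
  rewrite Rmin_left, Rmax_right in hu by lra.
  apply (continuous_mult (K := R_AbsRing) (q0 m)); [now apply hq0|].
  apply (continuous_comp (fun u => - l m u) (fun y => y ^ j / INR (fact j))); [now apply hcl|].
  apply (ex_derive_continuous (V := R_NormedModule)). auto_derive; easy. }
assert (step : forall n x m, IR (S n) x m = IR n x m - x ^ n * c n m).
{ intros n x m. unfold IR, c.
  rewrite <- (RInt_scal (V := R_CompleteNormedModule)) by apply exc.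
  rewrite <- (RInt_minus (V := R_CompleteNormedModule)).
  - apply RInt_ext. intros u _. unfold minus, plus, opp, scal; simpl; unfold mult; simpl.
    replace (- x * l m u) with (x * - l m u) by ring. rewrite Rpow_mult_distr. unfold Rdiv. ring.
  - apply exI.
  - apply (ex_RInt_scal (V := R_NormedModule)), exc. }
assert (bnd : forall n x m, Rabs x < rho ->
   Rabs (IR n x m) <= (/ 2) ^ n * 2 * (B m * exp (2 * rho * Lam m))).
{ intros n x m hx. unfold IR.
  rewrite <- (Rmult_1_l (_ * _ * (B m * _))). replace 1 with (1 - 0) at 2 by ring.
  apply abs_RInt_le_const; [lra|apply exI|]. intros u hu.
  rewrite Rabs_mult. rewrite (Rmult_comm ((/2) ^ n * 2)), Rmult_assoc.
  apply Rmult_le_compat; [apply Rabs_pos|apply Rabs_pos|now apply hB|].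
  eapply Rle_trans; [apply exp_rem_bound|].
  assert (hl' := hLam m u hu). apply Rabs_def2 in hx.
  assert (hle : forall z, Rabs z <= rho * Lam m -> exp (2 * z) <= exp (2 * rho * Lam m)).
  { intros z hz. apply Rabs_le_between in hz.
    destruct (Req_dec z (rho * Lam m)) as [->|]; [right; f_equal; ring|].
    left; apply exp_increasing. lra. }
  assert (hz : Rabs (- x * l m u) <= rho * Lam m).
  { rewrite Rabs_mult, Rabs_Ropp, (Rabs_pos_eq (l m u)) by lra.
    apply Rmult_le_compat; [apply Rabs_pos|lra| |lra].
    apply Rabs_le; lra. }
  assert (h1 := hle _ hz). assert (h2 := hle (- (- x * l m u))). rewrite Rabs_Ropp in h2.
  specialize (h2 hz). replace (2 * - (- x * l m u)) with (- (2 * (- x * l m u))) in h2 by ring.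
  assert (hp : 0 < (/ 2) ^ n) by (apply pow_lt; lra). nra. }
set (W m := B m * exp (2 * rho * Lam m)) in *.
assert (exIR : forall n x, Rabs x < rho -> ex_series (IR n x)).
{ intros n x hx. apply (ex_series_le (V := R_CompleteNormedModule)) with (fun m => (/ 2) ^ n * 2 * W m).
  - intros m. now apply bnd.
  - now apply (ex_series_scal (V := R_NormedModule)). }
assert (exC : forall j, ex_series (c j)).
{ intros j. set (x := rho / 2).
  assert (hx : Rabs x < rho) by (unfold x; rewrite Rabs_pos_eq; lra).
  apply ex_series_ext with (fun m => / x ^ j * (IR j x m - IR (S j) x m)).
  - intros m. rewrite step. assert (x <> 0) by (unfold x; lra).
    assert (hxj := pow_nonzero x j H). match goal with |- ?a = ?b => change (@eq R a b) end. field. easy.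
  - apply (ex_series_scal (V := R_NormedModule)).
    apply (ex_series_minus (V := R_NormedModule)); now apply exIR. }
assert (part : forall n x, Rabs x < rho ->
   Series (IR 0%nat x) = psum (fun j => x ^ j * Series (c j)) n + Series (IR n x)).
{ intros n x hx. induction n as [|n IH]; [simpl; ring|].
  rewrite IH, psum_S.
  rewrite (Series_ext (IR (S n) x) (fun m => IR n x m - x ^ n * c n m)) by (intros; apply step).
  rewrite Series_minus, Series_scal_l.
  - ring.
  - now apply exIR.
  - now apply (ex_series_scal (V := R_NormedModule)). }
assert (e0 : forall x m, RInt (fun u => q m u * exp (- (x0 + x) * l m u)) 0 1 = IR 0%nat x m).
{ intros x m. unfold IR, q0. apply RInt_ext. intros u _. simpl.
  rewrite Rmult_assoc, <- exp_plus. f_equal. f_equal. ring. }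
split.
- exists (fun j => Series (c j)), rho. split; [easy|]. intros x hx.
  rewrite (Series_ext _ (IR 0%nat x)) by (intros; apply e0).
  unfold is_pseries. apply filterlim_locally. intros eps.
  assert (hlim : is_lim_seq (fun n => (/ 2) ^ n * (2 * Series W)) 0).
  { replace (Finite 0) with (Rbar_mult 0 (2 * Series W)) by (simpl; f_equal; ring).
    apply (is_lim_seq_scal_r (fun n => (/ 2) ^ n)). apply is_lim_seq_geom. rewrite Rabs_pos_eq; lra. }
  apply is_lim_seq_spec in hlim. destruct (hlim eps) as [n0 hn0].
  exists n0. intros n hn.
  assert (es : sum_n (fun k => scal (pow_n (K := R_AbsRing) x k) (Series (c k))) n
    = psum (fun j => x ^ j * Series (c j)) (S n)).
  { clear. induction n as [|n IH].
    - rewrite sum_O. change (@eq R (1 * Series (c 0%nat)) (0 + 1 * Series (c 0%nat))). ring.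
    - rewrite sum_Sn, IH, (psum_S _ (S n)), pow_n_pow. reflexivity. }
  rewrite (part (S n) x hx).
  change (Rabs (sum_n (fun k => scal (pow_n (K := R_AbsRing) x k) (Series (c k))) n -
     (psum (fun j => x ^ j * Series (c j)) (S n) + Series (IR (S n) x))) < eps).
  rewrite es.
  match goal with |- Rabs ?e < _ => replace e with (- Series (IR (S n) x)) by ring end.
  rewrite Rabs_Ropp.
  eapply Rle_lt_trans; [|apply (hn0 (S n)); lia].
  rewrite Rminus_0_r. eapply Rle_trans; [|apply Rle_abs].
  eapply Rle_trans; [apply Series_Rabs|].
  { apply (ex_series_le (V := R_CompleteNormedModule)) with (fun m => (/ 2) ^ S n * 2 * W m).
    - intros m. change (Rabs (Rabs (IR (S n) x m)) <= (/ 2) ^ S n * 2 * W m). rewrite Rabs_Rabsolu. now apply bnd.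
    - now apply (ex_series_scal (V := R_NormedModule)). }
  rewrite <- Rmult_assoc, <- Series_scal_l.
  apply Series_le.
  + intros m. split; [apply Rabs_pos|now apply bnd].
  + now apply (ex_series_scal (V := R_NormedModule)).
- intros x hx. apply ex_series_ext with (IR 0%nat (x - x0)); [|now apply exIR].
  intros m. rewrite <- e0. replace (x0 + (x - x0)) with x by ring. reflexivity.
Qed.

Lemma is_lim_inv_sqrt : is_lim_seq (fun n => / sqrt (INR (S n))) 0.
Proof.
apply is_lim_seq_spec. intros eps. 
destruct (nfloor_ex (/ eps ^ 2)) as [n0 [_ hn0]].
{ left; apply Rinv_0_lt_compat, pow_lt, eps. }
exists n0. intros n hn. rewrite Rminus_0_r.
assert (he := cond_pos eps). set (e := pos eps) in *.
assert (hn1 : INR n0 + 1 <= INR (S n)) by (rewrite S_INR; apply le_INR in hn; lra).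
assert (h0 : 0 < / e ^ 2) by (apply Rinv_0_lt_compat, pow_lt; easy).
assert (hs : / e < sqrt (INR (S n))).
{ rewrite <- (sqrt_pow2 (/ e)) by (left; now apply Rinv_0_lt_compat).
  apply sqrt_lt_1_alt. rewrite pow_inv. split; lra. }
assert (hi : 0 < / e) by now apply Rinv_0_lt_compat.
rewrite Rabs_pos_eq by (left; apply Rinv_0_lt_compat; lra).
rewrite <- (Rinv_inv e). apply Rinv_lt_contravar; [nra|easy].
Qed.

Lemma ex_series_three_halves : ex_series (fun m => / (INR (S m)) ^ 2 * sqrt (INR (S (S m)))).
Proof.
apply (ex_series_le (V := R_CompleteNormedModule)) with
  (* A telescoping series of order m^(-3/2). *)
  (fun m => 6 * (/ sqrt (INR (S m)) - / sqrt (INR (S (S m))))).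
- intros m. rewrite (S_INR (S m)). set (y := INR (S m)).
  assert (hy : 1 <= y) by (apply (le_INR 1); lia).
  set (a := sqrt y). set (b := sqrt (y + 1)).
  assert (ha : 1 <= a) by (unfold a; rewrite <- sqrt_1; apply sqrt_le_1_alt; easy).
  assert (hb : a <= b) by (apply sqrt_le_1_alt; lra).
  assert (ea : a * a = y) by (apply sqrt_sqrt; lra).
  assert (eb : b * b = y + 1) by (apply sqrt_sqrt; lra).
  change (Rabs (/ y ^ 2 * b) <= 6 * (/ a - / b)).
  assert (0 < / y ^ 2) by (apply Rinv_0_lt_compat, pow_lt; lra).
  rewrite Rabs_pos_eq by nra.
  replace (/ a - / b) with (/ (a * b * (a + b))).
  2:{ replace (/ a - / b) with ((b * b - a * a) / (a * b * (a + b))) by (field; lra).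
      rewrite ea, eb. unfold Rdiv. ring. }
  rewrite <- ea.
  apply Rmult_le_reg_r with (a ^ 4 * (a * b * (a + b))); [repeat apply Rmult_lt_0_compat; try apply pow_lt; lra|].
  replace (/ (a * a) ^ 2 * b * (a ^ 4 * (a * b * (a + b)))) with ((b * b) * (a * (a + b))) by (field; lra).
  replace (6 * / (a * b * (a + b)) * (a ^ 4 * (a * b * (a + b)))) with (6 * ((a * a) * (a * a))) by (field; lra).
  assert (hba : b <= 2 * a) by nra.
  rewrite eb, ea. assert (a * (a + b) <= 3 * y) by nra. nra.
- exists (6 * 1). apply (is_series_scal (V := R_NormedModule) 6).
  match goal with |- is_series ?a ?l => change (is_lim_seq (sum_n a) (Finite l)) end.
  apply (is_lim_seq_ext (fun n => 1 - / sqrt (INR (S (S n))))).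
  + intros n. induction n as [|n IH].
    * rewrite sum_O. change (INR 1) with 1. rewrite sqrt_1, Rinv_1. reflexivity.
    * rewrite sum_Sn, <- IH. change plus with Rplus. ring.
  + replace (Finite 1) with (Finite (1 - 0)) by (f_equal; ring).
    apply is_lim_seq_minus'; [apply is_lim_seq_const|].
    apply (is_lim_seq_incr_1 (fun n => / sqrt (INR (S n)))), is_lim_inv_sqrt.
Qed.

Definition em_arg (m : nat) (u : R) := INR (S m) + u.
Definition em_kernel (trig : R -> R) (t : R) (m : nat) (u : R) :=
  u * (1 - u) / 2 / (em_arg m u) ^ 2 * trig (t * ln (em_arg m u)).
(** With trig = cos and trig = sin these are the real part and minus the
    imaginary part of the integral of u (1 - u) / 2 * (m + 1 + u)^(- z - 2) over
    0 <= u <= 1, where z = s + i t. *)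
Definition em_int trig t s m :=
  RInt (fun u => em_kernel trig t m u * exp (- s * ln (em_arg m u))) 0 1.

Lemma em_arg_ge1 m u : 0 <= u -> 1 <= em_arg m u.
Proof. intros h. unfold em_arg. assert (h1 : 1 <= INR (S m)) by (apply (le_INR 1); lia). lra. Qed.

Lemma ln_em_arg_continuous m u : 0 <= u -> continuous (fun u => ln (em_arg m u)) u.
Proof.
intros hu. assert (h := em_arg_ge1 m u hu). unfold em_arg in *.
set (y := INR (S m)) in *; clearbody y.
apply (ex_derive_continuous (V := R_NormedModule)). auto_derive. lra.
Qed.

Lemma em_kernel_continuous trig t m u : (forall x, continuous trig x) -> 0 <= u ->
  continuous (em_kernel trig t m) u.
Proof.
intros ht hu. assert (h := em_arg_ge1 m u hu). 
apply (continuous_mult (K := R_AbsRing) (fun u => u * (1 - u) / 2 / (em_arg m u) ^ 2)).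
- unfold em_arg in *. set (y := INR (S m)) in *; clearbody y. apply (ex_derive_continuous (V := R_NormedModule)). auto_derive. nra.
- apply (continuous_comp (fun u => t * ln (em_arg m u)) trig); [|apply ht].
  apply (continuous_mult (K := R_AbsRing) (fun _ => t)); [apply continuous_const|].
  now apply ln_em_arg_continuous.
Qed.

Lemma em_series_analytic_R trig t s0 : (forall x, continuous trig x) -> (forall x, Rabs (trig x) <= 1) ->
  0 <= s0 ->
  analytic_R_at (fun s => Series (em_int trig t s)) s0 /\ ex_series (em_int trig t s0).
Proof.
intros hc hb hs0.
destruct (analytic_R_laplace_series (em_kernel trig t) (fun m u => ln (em_arg m u))
  (fun m => / (INR (S m)) ^ 2) (fun m => ln (INR (S (S m)))) s0 (/ 4)) as [h1 h2].
- lra.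
- intros m u hu. apply em_kernel_continuous; [easy|lra].
- intros m u hu. apply ln_em_arg_continuous; lra.
- intros m u hu. assert (h := em_arg_ge1 m u ltac:(lra)).
  assert (hS : 1 <= INR (S m)) by (apply (le_INR 1); lia).
  assert (hln : 0 <= ln (em_arg m u)) by (rewrite <- ln_1; apply ln_le; lra).
  assert (he : exp (- s0 * ln (em_arg m u)) <= 1).
  { rewrite <- exp_0. destruct (Req_dec (- s0 * ln (em_arg m u)) 0) as [->|]; [lra|].
    left; apply exp_increasing; nra. }
  assert (he0 := exp_pos (- s0 * ln (em_arg m u))).
  assert (h3 : / em_arg m u ^ 2 <= / (INR (S m)) ^ 2).
  { apply Rinv_le_contravar; [apply pow_lt; lra|]. apply pow_incr. unfold em_arg; lra. }
  assert (h4 : 0 < / em_arg m u ^ 2) by (apply Rinv_0_lt_compat, pow_lt; lra).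
  assert (h7 : 0 <= u * (1 - u) / 2 * / em_arg m u ^ 2 <= / (INR (S m)) ^ 2).
  { split; [apply Rmult_le_pos; nra|].
    rewrite <- (Rmult_1_l (/ (INR (S m)) ^ 2)). apply Rmult_le_compat; try lra; nra. }
  assert (h5 := hb (t * ln (em_arg m u))). assert (h6 := Rabs_pos (trig (t * ln (em_arg m u)))).
  rewrite (Rabs_mult (em_kernel trig t m u)), (Rabs_pos_eq (exp _)) by lra.
  assert (hk : Rabs (em_kernel trig t m u) <= / (INR (S m)) ^ 2).
  { unfold em_kernel. rewrite (Rabs_mult _ (trig _)).
    rewrite (Rabs_pos_eq (u * (1 - u) / 2 / em_arg m u ^ 2)) by apply h7.
    rewrite <- (Rmult_1_r (/ (INR (S m)) ^ 2)). apply Rmult_le_compat; [apply h7| |apply h7|]; lra. }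
  assert (hk0 := Rabs_pos (em_kernel trig t m u)). nra.
- intros m u hu. assert (h := em_arg_ge1 m u ltac:(lra)). split.
  + rewrite <- ln_1; apply ln_le; lra.
  + apply ln_le; [lra|]. rewrite (S_INR (S m)). unfold em_arg; lra.
- apply ex_series_ext with (2 := ex_series_three_halves). intros m. 
  assert (hS : 1 <= INR (S (S m))) by (apply (le_INR 1); lia).
  change (@eq R (/ INR (S m) ^ 2 * sqrt (INR (S (S m)))) (/ INR (S m) ^ 2 * exp (2 * / 4 * ln (INR (S (S m)))))).
  f_equal. rewrite <- Rpower_sqrt by lra. unfold Rpower. f_equal. field.
- split; [exact h1|]. apply h2. rewrite Rminus_diag, Rabs_R0. lra.
Qed.

(** y^(- z) = [cpow_re s t y] - i [cpow_im s t y] with z = s + i t. *)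
Definition cpow_re s t (y : R) := exp (- s * ln y) * cos (t * ln y).
Definition cpow_im s t (y : R) := exp (- s * ln y) * sin (t * ln y).
(** [cubic_re] and [cubic_im] are the real and imaginary parts of
    (z - 1) z (z + 1) with z = s + i t.  The factor z (z + 1) comes from the second
    derivative of y^(- z), and the factor z - 1 removes the pole at 1. *)
Definition cubic_re s t := s ^ 3 - 3 * s * t ^ 2 - s.
Definition cubic_im s t := 3 * s ^ 2 * t - t ^ 3 - t.

Lemma em_integrand_continuous trig t s m u : (forall x, continuous trig x) -> 0 <= u ->
  continuous (fun u => em_kernel trig t m u * exp (- s * ln (em_arg m u))) u.
Proof.
intros hc hu. apply (continuous_mult (K := R_AbsRing) (em_kernel trig t m)).
- now apply em_kernel_continuous.
- apply (continuous_comp (fun u => - s * ln (em_arg m u)) exp).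
  + apply (continuous_mult (K := R_AbsRing) (fun _ => - s)); [apply continuous_const|].
    now apply ln_em_arg_continuous.
  + apply (ex_derive_continuous (V := R_NormedModule)). auto_derive; easy.
Qed.

Lemma em_int_is_RInt trig t s m : (forall x, continuous trig x) ->
  is_RInt (fun u => em_kernel trig t m u * exp (- s * ln (em_arg m u))) 0 1 (em_int trig t s m).
Proof.
intros hc. apply (RInt_correct (V := R_CompleteNormedModule)).
apply (ex_RInt_continuous (V := R_CompleteNormedModule)). intros u hu.
rewrite Rmin_left, Rmax_right in hu by lra.
apply em_integrand_continuous; [easy|lra].
Qed.

Lemma cos_continuous x : continuous cos x.
Proof. apply (ex_derive_continuous (V := R_NormedModule)). auto_derive; easy. Qed.
Lemma sin_continuous x : continuous sin x.
Proof. apply (ex_derive_continuous (V := R_NormedModule)). auto_derive; easy. Qed.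

Lemma em_combination (A B : R) (G : R -> R) t s m :
  (forall u, 0 <= u <= 1 -> is_derive G u
     (A * (em_kernel cos t m u * exp (- s * ln (em_arg m u)))
      + B * (em_kernel sin t m u * exp (- s * ln (em_arg m u))))) ->
  A * em_int cos t s m + B * em_int sin t s m = G 1 - G 0.
Proof.
intros hG.
assert (h1 : is_RInt (fun u => A * (em_kernel cos t m u * exp (- s * ln (em_arg m u)))
      + B * (em_kernel sin t m u * exp (- s * ln (em_arg m u)))) 0 1 (minus (G 1) (G 0))).
{ apply (is_RInt_derive (V := R_CompleteNormedModule)).
  - intros u hu. rewrite Rmin_left, Rmax_right in hu by lra. now apply hG.
  - intros u hu. rewrite Rmin_left, Rmax_right in hu by lra.
    apply (continuous_plus (V := R_NormedModule)
      (fun u => A * (em_kernel cos t m u * exp (- s * ln (em_arg m u))))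
      (fun u => B * (em_kernel sin t m u * exp (- s * ln (em_arg m u))))).
    + apply (continuous_mult (K := R_AbsRing) (fun _ => A)); [apply continuous_const|].
      apply em_integrand_continuous; [apply cos_continuous|lra].
    + apply (continuous_mult (K := R_AbsRing) (fun _ => B)); [apply continuous_const|].
      apply em_integrand_continuous; [apply sin_continuous|lra]. }
assert (h2 := is_RInt_plus (V := R_NormedModule) _ _ _ _ _ _
   (is_RInt_scal (V := R_NormedModule) _ _ _ A _ (em_int_is_RInt cos t s m cos_continuous))
   (is_RInt_scal (V := R_NormedModule) _ _ _ B _ (em_int_is_RInt sin t s m sin_continuous))).
assert (e1 := is_RInt_unique (V := R_CompleteNormedModule) _ _ _ _ h1).
assert (e2 := is_RInt_unique (V := R_CompleteNormedModule) _ _ _ _ h2).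
change (G 1 - G 0) with (minus (G 1) (G 0)). rewrite <- e1. symmetry. exact e2.
Qed.

(** Real part of the Euler-Maclaurin formula on [m + 1, m + 2], multiplied by
    z - 1: two integrations by parts turn the integral with the weight
    u (1 - u) / 2 into trapezoid minus integral of y^(- z). *)
Lemma em_cell_re s t m :
  cubic_re s t * em_int cos t s m + cubic_im s t * em_int sin t s m =
  (/ 2 * ((s - 1) * cpow_re s t (INR (S (S m))) + t * cpow_im s t (INR (S (S m))))
    + INR (S (S m)) * cpow_re s t (INR (S (S m))))
  + (/ 2 * ((s - 1) * cpow_re s t (INR (S m)) + t * cpow_im s t (INR (S m)))
    - INR (S m) * cpow_re s t (INR (S m))).
Proof.
set (G u := - (u * (1 - u) / 2 / em_arg m u) *
   ((s ^ 2 - t ^ 2 - s) * cpow_re s t (em_arg m u) + (2 * s * t - t) * cpow_im s t (em_arg m u))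
   - (1 - 2 * u) / 2 * ((s - 1) * cpow_re s t (em_arg m u) + t * cpow_im s t (em_arg m u))
   + em_arg m u * cpow_re s t (em_arg m u)).
rewrite (em_combination _ _ G).
- unfold G, em_arg. rewrite (S_INR (S m)), Rplus_0_r. field.
  assert (h := pos_INR (S m)). split; [|lra]. apply not_0_INR; lia.
- intros u hu. unfold G, em_kernel, cpow_re, cpow_im, cubic_re, cubic_im.
  assert (h := em_arg_ge1 m u ltac:(lra)). unfold em_arg in *.
  set (y := INR (S m)) in *. clearbody y.
  auto_derive; [repeat split; lra|].
  set (E := exp _). set (C := cos _). set (S := sin _). field. lra.
Qed.

Lemma em_cell_im s t m :
  cubic_im s t * em_int cos t s m + - cubic_re s t * em_int sin t s m =
  (/ 2 * (t * cpow_re s t (INR (S (S m))) - (s - 1) * cpow_im s t (INR (S (S m))))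
    - INR (S (S m)) * cpow_im s t (INR (S (S m))))
  + (/ 2 * (t * cpow_re s t (INR (S m)) - (s - 1) * cpow_im s t (INR (S m)))
    + INR (S m) * cpow_im s t (INR (S m))).
Proof.
set (G u := - (u * (1 - u) / 2 / em_arg m u) *
   ((2 * s * t - t) * cpow_re s t (em_arg m u) - (s ^ 2 - t ^ 2 - s) * cpow_im s t (em_arg m u))
   - (1 - 2 * u) / 2 * (t * cpow_re s t (em_arg m u) - (s - 1) * cpow_im s t (em_arg m u))
   - em_arg m u * cpow_im s t (em_arg m u)).
rewrite (em_combination _ _ G).
- unfold G, em_arg. rewrite (S_INR (S m)), Rplus_0_r. field.
  assert (h := pos_INR (S m)). split; [|lra]. apply not_0_INR; lia.
- intros u hu. unfold G, em_kernel, cpow_re, cpow_im, cubic_re, cubic_im.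
  assert (h := em_arg_ge1 m u ltac:(lra)). unfold em_arg in *.
  set (y := INR (S m)) in *. clearbody y.
  auto_derive; [repeat split; lra|].
  set (E := exp _). set (C := cos _). set (S := sin _). field. lra.
Qed.

Lemma cpow_re_1 s t : cpow_re s t 1 = 1.
Proof. unfold cpow_re. rewrite ln_1, !Rmult_0_r, exp_0, cos_0. ring. Qed.
Lemma cpow_im_1 s t : cpow_im s t 1 = 0.
Proof. unfold cpow_im. rewrite ln_1, !Rmult_0_r, sin_0. ring. Qed.

Definition trap_sum (g : R -> R) (M : nat) := psum (fun i => g (INR (S i))) (S M) - / 2 * g (INR (S M)).

Definition em_re s t M := (s - 1) * (trap_sum (cpow_re s t) M - / 2) + t * trap_sum (cpow_im s t) M
  + INR (S M) * cpow_re s t (INR (S M)) - 1.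
Definition em_im s t M := t * (trap_sum (cpow_re s t) M - / 2) - (s - 1) * trap_sum (cpow_im s t) M
  - INR (S M) * cpow_im s t (INR (S M)).

(** The contributions of y^(1 - z) telescope and the trapezoids assemble into the
    Dirichlet sum with its last term halved. *)
Lemma em_sum_re s t M :
  psum (fun m => cubic_re s t * em_int cos t s m + cubic_im s t * em_int sin t s m) M = em_re s t M.
Proof.
unfold em_re, trap_sum. induction M as [|M IH].
- change (psum (fun i => cpow_re s t (INR (S i))) 1) with (0 + cpow_re s t 1).
  change (psum (fun i => cpow_im s t (INR (S i))) 1) with (0 + cpow_im s t 1).
  change (INR 1) with 1. rewrite cpow_re_1, cpow_im_1. simpl. field.
- rewrite psum_S, IH, em_cell_re.
  rewrite (psum_S _ (S M)), (psum_S (fun i => cpow_im _ _ _) (S M)). field.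
Qed.

Lemma em_sum_im s t M :
  psum (fun m => cubic_im s t * em_int cos t s m + - cubic_re s t * em_int sin t s m) M = em_im s t M.
Proof.
unfold em_im, trap_sum. induction M as [|M IH].
- change (psum (fun i => cpow_re s t (INR (S i))) 1) with (0 + cpow_re s t 1).
  change (psum (fun i => cpow_im s t (INR (S i))) 1) with (0 + cpow_im s t 1).
  change (INR 1) with 1. rewrite cpow_re_1, cpow_im_1. simpl. field.
- rewrite psum_S, IH, em_cell_im.
  rewrite (psum_S _ (S M)), (psum_S (fun i => cpow_im _ _ _) (S M)). field.
Qed.

Definition em_cos s t := Series (em_int cos t s).
Definition em_sin s t := Series (em_int sin t s).

Lemma psum_sum_n (f : nat -> R) n : sum_n f n = psum f (S n).
Proof.
induction n as [|n IH].
- rewrite sum_O. change (@eq R (f 0%nat) (0 + f 0%nat)). ring.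
- rewrite sum_Sn, IH. reflexivity.
Qed.

Lemma is_lim_psum (f : nat -> R) (l : R) : is_series f l -> is_lim_seq (psum f) l.
Proof.
intros h. apply is_lim_seq_incr_1.
apply (is_lim_seq_ext (sum_n f)); [intros n; apply psum_sum_n|exact h].
Qed.

Lemma em_lim s t A B : 0 <= s ->
  is_lim_seq (psum (fun m => A * em_int cos t s m + B * em_int sin t s m))
     (A * em_cos s t + B * em_sin s t).
Proof.
intros hs. apply is_lim_psum.
assert (h1 := proj2 (em_series_analytic_R cos t s cos_continuous Rabs_cos_le hs)).
assert (h2 := proj2 (em_series_analytic_R sin t s sin_continuous Rabs_sin_le hs)).
apply (is_series_plus (V := R_NormedModule) (fun m => A * em_int cos t s m) (fun m => B * em_int sin t s m)).
- apply (is_series_scal (V := R_NormedModule) A). now apply Series_correct.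
- apply (is_series_scal (V := R_NormedModule) B). now apply Series_correct.
Qed.

Lemma em_re_lim s t : 0 <= s ->
  is_lim_seq (em_re s t) (cubic_re s t * em_cos s t + cubic_im s t * em_sin s t).
Proof.
intros hs. eapply is_lim_seq_ext; [|now apply em_lim]. intros n; apply em_sum_re.
Qed.
Lemma em_im_lim s t : 0 <= s ->
  is_lim_seq (em_im s t) (cubic_im s t * em_cos s t - cubic_re s t * em_sin s t).
Proof.
intros hs. replace (cubic_im s t * em_cos s t - cubic_re s t * em_sin s t) with
  (cubic_im s t * em_cos s t + - cubic_re s t * em_sin s t) by ring.
eapply is_lim_seq_ext; [|now apply em_lim]. intros n; apply em_sum_im.
Qed.

Lemma is_lim_pow_decay s : 1 < s -> is_lim_seq (fun M => INR (S M) * exp (- s * ln (INR (S M)))) 0.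
Proof.
intros hs.
assert (h : is_lim_seq (fun M => exp ((1 - s) * ln (INR (S M)))) 0).
{ apply (is_lim_comp_seq exp _ m_infty 0).
  - apply is_lim_exp_m.
  - exists 0%nat. intros; discriminate.
  - replace m_infty with (Rbar_mult (1 - s) p_infty).
    + apply is_lim_seq_scal_l. apply (is_lim_comp_seq ln _ p_infty p_infty).
      * apply is_lim_ln_p.
      * exists 0%nat; intros; discriminate.
      * apply (is_lim_seq_incr_1 INR), is_lim_seq_INR.
    + simpl. destruct (Rle_dec 0 (1 - s)) as [h1|h1]; [exfalso; lra|reflexivity]. }
eapply is_lim_seq_ext; [|exact h]. intros n.
assert (hn : 0 < INR (S n)) by (apply lt_0_INR; lia).
transitivity (exp (ln (INR (S n))) * exp (- s * ln (INR (S n)))).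
- rewrite <- exp_plus. f_equal. ring.
- now rewrite exp_ln.
Qed.

Lemma is_lim_dominated u v : is_lim_seq v 0 -> (forall n, Rabs (u n) <= v n) -> is_lim_seq u 0.
Proof.
intros hv h. apply is_lim_seq_abs_0.
apply (is_lim_seq_le_le (fun _ => 0) _ v); [|apply is_lim_seq_const|easy].
intros n; split; [apply Rabs_pos|apply h].
Qed.

Lemma trig_decay s (c : R -> R) : 1 < s -> (forall x, Rabs (c x) <= 1) ->
  is_lim_seq (fun M => INR (S M) * (exp (- s * ln (INR (S M))) * c (INR (S M)))) 0 /\
  is_lim_seq (fun M => exp (- s * ln (INR (S M))) * c (INR (S M))) 0.
Proof.
intros hs hc.
split; apply (is_lim_dominated _ _ (is_lim_pow_decay s hs)); intros n;
 assert (hn : 1 <= INR (S n)) by (apply (le_INR 1); lia);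
 assert (he := exp_pos (- s * ln (INR (S n))));
 assert (h := hc (INR (S n))); assert (h' := Rabs_pos (c (INR (S n)))).
- rewrite <- Rmult_assoc, Rabs_mult, Rabs_pos_eq by nra.
  assert (0 < INR (S n) * exp (- s * ln (INR (S n)))) by nra. nra.
- rewrite Rabs_mult, Rabs_pos_eq by lra. nra.
Qed.

Lemma zeta_re_series zeta (hz : is_riemann_zeta zeta) s t : 1 < s -> is_series (fun n => cpow_re s t (INR (S n))) (Re (zeta (s, t))).
Proof.
intros hs. assert (h := proj1 hz (s, t) hs). apply is_series_C_re in h.
apply is_series_ext with (2 := h). intros n. unfold Cexp, cpow_re, Re, Im, Cmult, Copp, RtoC; cbn [fst snd].
match goal with |- ?a = ?b => change (@eq R a b) end.
f_equal; [f_equal; ring|]. rewrite <- cos_neg. f_equal. ring.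
Qed.

Lemma zeta_im_series zeta (hz : is_riemann_zeta zeta) s t : 1 < s -> is_series (fun n => cpow_im s t (INR (S n))) (- Im (zeta (s, t))).
Proof.
intros hs. assert (h := proj1 hz (s, t) hs). apply is_series_C_im in h.
apply (is_series_opp (V := R_NormedModule)) in h.
apply is_series_ext with (2 := h). intros n. unfold Cexp, cpow_im, Re, Im, Cmult, Copp, RtoC; cbn [fst snd].
match goal with |- ?a = ?b => change (@eq R a b) end.
change (- (exp ((- s * ln (INR (S n)) - - t * 0)) * sin (- s * 0 + - t * ln (INR (S n)))) = exp (- s * ln (INR (S n))) * sin (t * ln (INR (S n)))).
replace (- s * 0 + - t * ln (INR (S n))) with (- (t * ln (INR (S n)))) by ring.
rewrite sin_neg. replace (- s * ln (INR (S n)) - - t * 0) with (- s * ln (INR (S n))) by ring. ring.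
Qed.

Lemma trap_sum_lim s (c : R -> R) l : 1 < s -> (forall x, Rabs (c x) <= 1) ->
  is_series (fun n => exp (- s * ln (INR (S n))) * c (INR (S n))) l ->
  is_lim_seq (trap_sum (fun y => exp (- s * ln y) * c y)) l.
Proof.
intros hs hc h. apply is_lim_psum in h.
replace (Finite l) with (Finite (l - / 2 * 0)) by (f_equal; ring).
apply is_lim_seq_minus'.
- apply (is_lim_seq_incr_1 (psum (fun i => exp (- s * ln (INR (S i))) * c (INR (S i))))). exact h.
- apply (is_lim_seq_scal_l _ (/ 2) 0). now apply trig_decay.
Qed.

(** Real and imaginary parts of
    (z - 1) zeta(z) - (1 + (z - 1) / 2 + (z - 1) z (z + 1) H(z)) with z = s + i t, where
    H = [em_cos] - i [em_sin]. *)
Definition continuation_re (zeta : C -> C) (t s : R) := ((s - 1) * Re (zeta (s, t)) + - t * Im (zeta (s, t)))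
  + - (1 + / 2 * (s - 1) + (cubic_re s t * em_cos s t + cubic_im s t * em_sin s t)).
Definition continuation_im (zeta : C -> C) (t s : R) := ((s - 1) * Im (zeta (s, t)) + t * Re (zeta (s, t)))
  + - (/ 2 * t + (cubic_im s t * em_cos s t - cubic_re s t * em_sin s t)).

Lemma continuation_zero_right zeta (hz : is_riemann_zeta zeta) t s : 1 < s -> continuation_re zeta t s = 0 /\ continuation_im zeta t s = 0.
Proof.
intros hs.
assert (hc : forall x, Rabs (cos (t * ln x)) <= 1) by (intros; apply Rabs_cos_le).
assert (hsn : forall x, Rabs (sin (t * ln x)) <= 1) by (intros; apply Rabs_sin_le).
assert (h1 := trap_sum_lim s (fun y => cos (t * ln y)) _ hs hc (zeta_re_series zeta hz s t hs)).
assert (h2 := trap_sum_lim s (fun y => sin (t * ln y)) _ hs hsn (zeta_im_series zeta hz s t hs)).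
assert (h3 := proj1 (trig_decay s (fun y => cos (t * ln y)) hs hc)).
assert (h4 := proj1 (trig_decay s (fun y => sin (t * ln y)) hs hsn)).
set (X := Re (zeta (s, t))) in *. set (Y := Im (zeta (s, t))) in *.
assert (l1 : is_lim_seq (em_re s t) ((s - 1) * (X - / 2) + t * - Y + 0 - 1)).
{ unfold em_re. apply is_lim_seq_minus'; [|apply is_lim_seq_const].
  apply is_lim_seq_plus'; [|exact h3]. apply is_lim_seq_plus'.
  - apply (is_lim_seq_scal_l _ (s - 1) (X - / 2)).
    apply is_lim_seq_minus'; [exact h1|apply is_lim_seq_const].
  - apply (is_lim_seq_scal_l _ t (- Y)). exact h2. }
assert (l2 : is_lim_seq (em_im s t) (t * (X - / 2) - (s - 1) * - Y - 0)).
{ unfold em_im. apply is_lim_seq_minus'; [|exact h4]. apply is_lim_seq_minus'.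
  - apply (is_lim_seq_scal_l _ t (X - / 2)).
    apply is_lim_seq_minus'; [exact h1|apply is_lim_seq_const].
  - apply (is_lim_seq_scal_l _ (s - 1) (- Y)). exact h2. }
apply is_lim_seq_unique in l1, l2.
assert (m1 := is_lim_seq_unique _ _ (em_re_lim s t ltac:(lra))).
assert (m2 := is_lim_seq_unique _ _ (em_im_lim s t ltac:(lra))).
rewrite m1 in l1. rewrite m2 in l2. injection l1 as e1. injection l2 as e2.
unfold continuation_re, continuation_im. fold X Y. rewrite e1, e2. split; field.
Qed.

Lemma analytic_R_mul_sq f x0 : analytic_R_at f x0 -> analytic_R_at (fun x => x ^ 2 * f x) x0.
Proof.
intros h. apply analytic_R_ext with (fun x => x * (x * f x)); [intros; ring|].
now apply analytic_R_mul_id, analytic_R_mul_id.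
Qed.

Lemma analytic_R_mul_cubic t f x0 : analytic_R_at f x0 ->
  analytic_R_at (fun s => cubic_re s t * f s) x0 /\ analytic_R_at (fun s => cubic_im s t * f s) x0.
Proof.
intros h. split.
- apply analytic_R_ext with (fun s => s * (s ^ 2 * f s) + (- (3 * t ^ 2) - 1) * (s * f s)).
  { intros s; unfold cubic_re; ring. }
  apply analytic_R_plus; [now apply analytic_R_mul_id, analytic_R_mul_sq|now apply analytic_R_scal, analytic_R_mul_id].
- apply analytic_R_ext with (fun s => 3 * t * (s ^ 2 * f s) + (- t ^ 3 - t) * f s).
  { intros s; unfold cubic_im; ring. }
  apply analytic_R_plus; [now apply analytic_R_scal, analytic_R_mul_sq|now apply analytic_R_scal].
Qed.

Lemma continuation_analytic_R zeta (hz : is_riemann_zeta zeta) t s : t <> 0 -> 0 <= s -> analytic_R_at (continuation_re zeta t) s /\ analytic_R_at (continuation_im zeta t) s.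
Proof.
intros ht hs.
assert (ha : analytic_at zeta (s, t)).
{ apply (proj2 hz). intros e. injection e as e1 e2. easy. }
destruct (analytic_R_of_analytic_at zeta s t ha) as [hX hY].
assert (h1 := proj1 (em_series_analytic_R cos t s cos_continuous Rabs_cos_le hs)).
assert (h2 := proj1 (em_series_analytic_R sin t s sin_continuous Rabs_sin_le hs)).
change (analytic_R_at (fun s => em_cos s t) s) in h1. change (analytic_R_at (fun s => em_sin s t) s) in h2.
destruct (analytic_R_mul_cubic t _ s h1) as [c1 c2]. destruct (analytic_R_mul_cubic t _ s h2) as [c3 c4].
assert (lin : forall f, analytic_R_at f s -> analytic_R_at (fun s => (s - 1) * f s) s).
{ intros f hf. apply analytic_R_ext with (fun s => s * f s + -1 * f s); [intros; ring|].
  apply analytic_R_plus; [now apply analytic_R_mul_id|now apply analytic_R_scal]. }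
assert (hid : analytic_R_at (fun s => s) s).
{ apply analytic_R_ext with (fun s => s * 1); [intros; ring|]. apply analytic_R_mul_id, analytic_R_const. }
split.
- apply analytic_R_plus; [apply analytic_R_plus; [now apply lin|now apply analytic_R_scal]|].
  apply analytic_R_ext with (fun s => - / 2 + (- / 2 * s + (-1 * (cubic_re s t * em_cos s t) + -1 * (cubic_im s t * em_sin s t)))).
  { intros; field. }
  apply analytic_R_plus; [apply analytic_R_const|]. apply analytic_R_plus; [now apply analytic_R_scal|].
  apply analytic_R_plus; now apply analytic_R_scal.
- apply analytic_R_plus; [apply analytic_R_plus; [now apply lin|now apply analytic_R_scal]|].
  apply analytic_R_ext with (fun s => - / 2 * t + (-1 * (cubic_im s t * em_cos s t) + 1 * (cubic_re s t * em_sin s t))).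
  { intros; field. }
  apply analytic_R_plus; [apply analytic_R_const|]. apply analytic_R_plus; now apply analytic_R_scal.
Qed.

Definition zeta_re_trap t M :=
  psum (fun i => cos (t * ln (INR (S i)))) M - / 2 * cos (t * ln (INR M))
  - INR M * (cos (t * ln (INR M)) + t * sin (t * ln (INR M))) / (1 + t ^ 2).

(** The identity theorem makes [continuation_re] and [continuation_im] vanish at
    s = 0, and the formula of [em_sum_re] and [em_sum_im] at s = 0, divided by
    z - 1 = - 1 + i t, is the trapezoidal expression. *)
Lemma zeta_limit zeta (hz : is_riemann_zeta zeta) t : t <> 0 ->
  is_lim_seq (fun M => zeta_re_trap t (S M)) (Re (zeta (0, t))) /\
  is_lim_seq (fun M => zeta_im_trap t (S M)) (- Im (zeta (0, t))).
Proof.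
intros ht.
assert (e1 : continuation_re zeta t 0 = 0).
{ apply analytic_R_identity; intros x hx; [apply (continuation_analytic_R zeta hz); [easy|lra]|now apply (continuation_zero_right zeta hz)]. }
assert (e2 : continuation_im zeta t 0 = 0).
{ apply analytic_R_identity; intros x hx; [apply (continuation_analytic_R zeta hz); [easy|lra]|now apply (continuation_zero_right zeta hz)]. }
assert (l1 := em_re_lim 0 t ltac:(lra)). assert (l2 := em_im_lim 0 t ltac:(lra)).
unfold continuation_re in e1. unfold continuation_im in e2.
set (X := Re (zeta (0, t))) in *. set (Y := Im (zeta (0, t))) in *.
assert (ht2 : 0 < 1 + t ^ 2) by nra.
set (A := cubic_re 0 t * em_cos 0 t + cubic_im 0 t * em_sin 0 t) in *.
set (B := cubic_im 0 t * em_cos 0 t - cubic_re 0 t * em_sin 0 t) in *.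
assert (eA : A = - X - t * Y - / 2) by lra.
assert (eB : B = - Y + t * X - / 2 * t) by lra.
assert (edir : forall y, cpow_re 0 t y = cos (t * ln y) /\ cpow_im 0 t y = sin (t * ln y)).
{ intros y; unfold cpow_re, cpow_im. rewrite Ropp_0, Rmult_0_l, exp_0. split; ring. }
assert (eps1 : forall M, trap_sum (cpow_re 0 t) M = psum (fun i => cos (t * ln (INR (S i)))) (S M)
   - / 2 * cos (t * ln (INR (S M)))).
{ intros M. unfold trap_sum. rewrite (proj1 (edir _)). f_equal. apply psum_ext. intros; apply edir. }
assert (eps2 : forall M, trap_sum (cpow_im 0 t) M = psum (fun i => sin (t * ln (INR (S i)))) (S M)
   - / 2 * sin (t * ln (INR (S M)))).
{ intros M. unfold trap_sum. rewrite (proj2 (edir _)). f_equal. apply psum_ext. intros; apply edir. }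
split.
- apply (is_lim_seq_ext (fun M => (-1 * (em_re 0 t M + / 2) + t * (em_im 0 t M + / 2 * t)) * / (1 + t ^ 2))).
  { intros M. unfold em_re, em_im, zeta_re_trap. rewrite eps1, eps2, (proj1 (edir _)), (proj2 (edir _)).
    field. lra. }
  replace (Finite X) with (Rbar_mult (-1 * (A + / 2) + t * (B + / 2 * t)) (/ (1 + t ^ 2))).
  2:{ simpl. f_equal. rewrite eA, eB. field. lra. }
  apply is_lim_seq_scal_r. apply is_lim_seq_plus'.
  + apply (is_lim_seq_scal_l _ (-1) (A + / 2)). apply is_lim_seq_plus'; [exact l1|apply is_lim_seq_const].
  + apply (is_lim_seq_scal_l _ t (B + / 2 * t)). apply is_lim_seq_plus'; [exact l2|apply is_lim_seq_const].
- apply (is_lim_seq_ext (fun M => (t * (em_re 0 t M + / 2) + 1 * (em_im 0 t M + / 2 * t)) * / (1 + t ^ 2))).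
  { intros M. unfold em_re, em_im, zeta_im_trap. rewrite eps1, eps2, (proj1 (edir _)), (proj2 (edir _)).
    field. lra. }
  replace (Finite (- Y)) with (Rbar_mult (t * (A + / 2) + 1 * (B + / 2 * t)) (/ (1 + t ^ 2))).
  2:{ simpl. f_equal. rewrite eA, eB. field. lra. }
  apply is_lim_seq_scal_r. apply is_lim_seq_plus'.
  + apply (is_lim_seq_scal_l _ t (A + / 2)). apply is_lim_seq_plus'; [exact l1|apply is_lim_seq_const].
  + apply (is_lim_seq_scal_l _ 1 (B + / 2 * t)). apply is_lim_seq_plus'; [exact l2|apply is_lim_seq_const].
Qed.

(** The trapezoidal expressions at t and - t are conjugate. *)
Lemma zeta_conj zeta (hz : is_riemann_zeta zeta) t : t <> 0 ->
  Re (zeta (0, - t)) = Re (zeta (0, t)) /\ Im (zeta (0, - t)) = - Im (zeta (0, t)).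
Proof.
intros ht.
destruct (zeta_limit zeta hz t ht) as [a1 a2]. destruct (zeta_limit zeta hz (- t) ltac:(lra)) as [b1 b2].
assert (e1 : forall M, zeta_re_trap (- t) M = zeta_re_trap t M).
{ intros M. unfold zeta_re_trap. replace ((- t) ^ 2) with (t ^ 2) by ring.
  replace (- t * ln (INR M)) with (- (t * ln (INR M))) by ring. rewrite cos_neg, sin_neg.
  rewrite (psum_ext _ (fun i => cos (t * ln (INR (S i))))).
  - f_equal. f_equal. ring.
  - intros i _. rewrite <- cos_neg. f_equal; ring. }
assert (e2 : forall M, zeta_im_trap (- t) M = - zeta_im_trap t M).
{ intros M. unfold zeta_im_trap. replace ((- t) ^ 2) with (t ^ 2) by ring.
  replace (- t * ln (INR M)) with (- (t * ln (INR M))) by ring. rewrite cos_neg, sin_neg.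
  rewrite (psum_ext _ (fun i => -1 * sin (t * ln (INR (S i))))), psum_scal.
  - unfold Rdiv. ring.
  - intros i _. replace (- t * ln (INR (S i))) with (- (t * ln (INR (S i)))) by ring. rewrite sin_neg; ring. }
split.
- apply is_lim_seq_ext with (v := fun M => zeta_re_trap t (S M)) in b1; [|intros; apply e1].
  apply is_lim_seq_unique in a1, b1. rewrite a1 in b1. now injection b1.
- apply is_lim_seq_ext with (v := fun M => - zeta_im_trap t (S M)) in b2; [|intros; apply e2].
  apply (is_lim_seq_opp _ (- Im (zeta (0, t)))) in a2.
  apply is_lim_seq_unique in a2, b2. rewrite a2 in b2. injection b2 as e. lra.
Qed.

Lemma zeta_im_approx zeta (hz : is_riemann_zeta zeta) t M : 0 < t <= INR M ->
  Rabs (- Im (zeta (0, t)) - zeta_im_trap t M) <= (1 + t) / (2 * INR M).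
Proof.
intros h. destruct (zeta_limit zeta hz t ltac:(lra)) as [_ hl].
apply (is_lim_seq_incr_1 (zeta_im_trap t)) in hl. apply (is_lim_seq_incr_n _ M) in hl.
assert (hlim : is_lim_seq (fun n => Rabs (zeta_im_trap t (n + M) - zeta_im_trap t M)) (Rabs (- Im (zeta (0, t)) - zeta_im_trap t M))).
{ apply (is_lim_seq_abs _ (- Im (zeta (0, t)) - zeta_im_trap t M)).
  apply is_lim_seq_minus'; [exact hl|apply is_lim_seq_const]. }
apply (is_lim_seq_le _ (fun _ => (1 + t) / (2 * INR M)) _ ((1 + t) / (2 * INR M)) ) in hlim.
- exact hlim.
- intros n. rewrite Nat.add_comm. now apply zeta_im_trap_cauchy.
- apply is_lim_seq_const.
Qed.

(** * The weighted sum of zeta values *)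

Lemma psum_swap (f : nat -> nat -> R) n m :
  psum (fun i => psum (f i) m) n = psum (fun j => psum (fun i => f i j) n) m.
Proof.
induction n as [|n IH].
- simpl. rewrite psum_const. ring.
- simpl. rewrite IH, <- psum_plus. easy.
Qed.

Lemma smooth_saw_period L N v j : smooth_saw L N (v + INR j) = smooth_saw L N v.
Proof.
unfold smooth_saw. apply psum_ext. intros i _.
replace (2 * PI * INR (S i) * (v + INR j)) with (2 * PI * INR (S i) * v + 2 * INR (S i * j) * PI)
 by (rewrite mult_INR; ring).
now rewrite sin_period, cos_period.
Qed.

(** Exchange of the sums over n and m; the term in M of [zeta_im_trap] produces
    [smooth_saw]. *)
Lemma zeta_im_trap_average k N M : (2 <= k)%nat -> let L := ln (INR k) in
  psum (fun n => / (PI * INR (S n)) * zeta_im_trap (zeta_height L (S n)) M) N =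
  saw_sum k N M - / 2 * saw N (ln (INR M) / L) - INR M * smooth_saw L N (ln (INR M) / L).
Proof.
intros hk L. assert (hp := PI_RGT_0).
assert (hL : 0 < L) by (apply ln_pos, (lt_INR 1); lia).
unfold saw_sum. fold L. unfold saw at 1.
rewrite (psum_swap (fun i n => sin (2 * PI * INR (S n) * (ln (INR (S i)) / L)) / (PI * INR (S n)))).
unfold saw, smooth_saw. rewrite <- !psum_scal, <- !psum_minus.
apply psum_ext. intros n _. unfold zeta_im_trap.
assert (hn : 0 < INR (S n)) by (apply lt_0_INR; lia).
assert (e : forall y, 2 * PI * INR (S n) * (y / L) = zeta_height L (S n) * y).
{ intros y. unfold zeta_height. field. lra. }
assert (ex : psum (fun j => sin (2 * PI * INR (S n) * (ln (INR (S j)) / L)) / (PI * INR (S n))) M =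
  / (PI * INR (S n)) * psum (fun i => sin (zeta_height L (S n) * ln (INR (S i)))) M).
{ rewrite <- psum_scal. apply psum_ext. intros i _. rewrite e. unfold Rdiv; ring. }
rewrite ex, !e. field. split; [|split]; try lra.
assert (h := pow2_ge_0 (zeta_height L (S n))). lra.
Qed.

Lemma exists_power_between k X : (2 <= k)%nat -> 1 <= X ->
  exists J, X <= INR (k ^ J) <= INR k * X.
Proof.
intros hk hX. assert (hk0 : 2 <= INR k) by (apply (le_INR 2); easy).
destruct (Pow_x_infinity (INR k) ltac:(rewrite Rabs_pos_eq; lra) X) as [n0 hn0].
assert (hex : X <= INR (k ^ n0)).
{ rewrite pow_INR. assert (h := hn0 n0 (le_n _)). rewrite Rabs_pos_eq in h by (apply pow_le; lra). lra. }
clear hn0. induction n0 as [|n IH].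
- exists 0%nat. split; [easy|]. simpl in *. nra.
- destruct (Rle_dec X (INR (k ^ n))) as [h|h]; [now apply IH|].
  exists (S n). split; [easy|]. simpl (k ^ S n)%nat. rewrite mult_INR. nra.
Qed.

(** M = [mid k K] for a power K of k of order N, so that log_k (M / K) is away from 0,
    where [smooth_saw_approx] applies. *)
Lemma saw_average_bound k : (2 <= k)%nat ->
  exists C, 0 < C /\ forall N, (1 <= N)%nat -> exists M,
  zeta_height (ln (INR k)) N <= INR M /\ 
  Rabs (psum (fun n => / (PI * INR (S n)) * zeta_im_trap (zeta_height (ln (INR k)) (S n)) M) N) <= C.
Proof.
intros hk. assert (hk0 : 2 <= INR k) by (apply (le_INR 2); easy).
set (L := ln (INR k)). assert (hL : 0 < L) by (apply ln_pos; lra).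
assert (hp := PI_RGT_0).
set (al := 2 * PI / L). assert (hal : 0 < al) by (apply Rdiv_lt_0_compat; lra).
set (Y := INR k * (al + 8)). assert (hY : 1 <= Y) by (unfold Y; nra).
destruct (saw_defect_bound k Y hk hY) as [C1 [hC1 h1]].
set (c := ln (17 / 16) / L).
assert (hc : 0 < c) by (apply Rdiv_lt_0_compat; [apply ln_pos; lra|easy]).
destruct (smooth_saw_approx L c hL hc) as [C2 [hC2 h2]].
exists (C1 + 1 + / c + INR k * Y * C2).
assert (hic : 0 < / c) by now apply Rinv_0_lt_compat.
assert (hk2 : 0 < INR k * Y * C2) by (apply Rmult_pos3; lra).
split; [lra|]. intros N hN. assert (hN0 : 1 <= INR N) by now apply (le_INR 1).
(* The summand 8 makes K / 8 at least 1, hence M >= (17 / 16) K. *)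
destruct (exists_power_between k (al * INR N + 8) hk ltac:(nra)) as [J [hJ1 hJ2]].
assert (hJY : INR (k ^ J) <= Y * INR N) by (unfold Y; nra).
set (K := (k ^ J)%nat) in *. exists (mid k K).
assert (hK8 : (8 <= K)%nat) by (apply INR_le; simpl (INR 8); nra).
assert (hm1 := mid_ge k K hk). assert (hm2 := mid_lt k K hk ltac:(lia)).
assert (hmK : INR K <= INR (mid k K)) by (apply le_INR; lia).
split. { unfold zeta_height. fold al. lra. }
assert (EA := zeta_im_trap_average k N (mid k K) hk). cbv zeta in EA. fold L in EA. rewrite EA. clear EA.
assert (hK0 : 0 < INR K) by (apply lt_0_INR; lia).
assert (hM0 : 0 < INR (mid k K)) by lra.
assert (ev : ln (INR (mid k K)) / L = vmid k K + INR J) by (apply ln_pow_ratio; easy).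
rewrite ev, saw_period, smooth_saw_period.
set (v := vmid k K).
assert (hv : c <= v <= / 2).
{ unfold v, vmid, c. fold L. split.
  - apply Rmult_le_compat_r; [left; now apply Rinv_0_lt_compat|]. apply ln_le; [lra|].
    apply Rmult_le_reg_r with (INR K); [easy|]. unfold Rdiv at 2. rewrite Rmult_assoc, Rinv_l, Rmult_1_r by lra.
    assert (h16 : (17 * K <= 16 * mid k K)%nat).
    { assert (h := Nat.div_mod_eq K 8). assert (h' := Nat.mod_upper_bound K 8 ltac:(easy)). lia. }
    apply le_INR in h16. rewrite !mult_INR in h16. simpl (INR 17) in h16. simpl (INR 16) in h16. lra.
  - apply half_log_le; [lra|now apply Rdiv_lt_0_compat|].
    assert (h := proj1 (mid_spec k K)). apply le_INR in h. rewrite !mult_INR in h.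
    apply Rmult_le_reg_r with (INR K * INR K); [nra|].
    replace ((INR (mid k K) / INR K) ^ 2 * (INR K * INR K)) with (INR (mid k K) * INR (mid k K)) by (field; lra).
    lra. }
assert (hU := h1 N J hN hJY). fold K in hU.
assert (hS := h2 N v hv).
assert (hw := odd_freq_ge1 N).
assert (eint : saw_integral k K = INR (mid k K) * smooth_saw_lim L v).
{ unfold saw_integral, smooth_saw_lim. fold v. fold L.
  assert (e1 : exp L = INR k) by (apply exp_ln; lra).
  assert (e2 : exp (L * (1 - v)) = INR k * INR K / INR (mid k K)).
  { replace (L * (1 - v)) with (L + - (L * v)) by ring. rewrite exp_plus, exp_Ropp, e1.
    replace (L * v) with (ln (INR (mid k K) / INR K)) by (unfold v, vmid; fold L; field; lra).
    rewrite exp_ln by (now apply Rdiv_lt_0_compat). field. lra. }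
  rewrite e1, e2. field. lra. }
replace (saw_sum k N (mid k K) - / 2 * saw N v - INR (mid k K) * smooth_saw L N v) with
 (saw_defect k N K + / 2 * saw_err N v - INR (mid k K) * (smooth_saw L N v - smooth_saw_lim L v)).
2:{ unfold saw_defect, saw_err. rewrite eint. fold v. field. }
assert (hr := saw_err_bound N v ltac:(lra)).
assert (hr2 : / (odd_freq N * v) <= / c) by (apply Rinv_le_contravar; nra).
assert (hb : Rabs (INR (mid k K) * (smooth_saw L N v - smooth_saw_lim L v)) <= INR k * Y * C2).
{ rewrite Rabs_mult, (Rabs_pos_eq (INR _)) by lra.
  assert (hM : INR (mid k K) <= INR k * (Y * INR N)).
  { apply Rle_trans with (INR (k * K)); [apply le_INR; lia|]. rewrite mult_INR. apply Rmult_le_compat_l; lra. }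
  apply Rle_trans with (INR k * (Y * INR N) * (C2 / odd_freq N)).
  - apply Rmult_le_compat; [lra|apply Rabs_pos|easy|easy].
  - apply Rle_trans with (INR k * (Y * INR N) * (C2 / INR N)).
    + apply Rmult_le_compat_l; [nra|]. apply Rmult_le_compat_l; [lra|].
      apply Rinv_le_contravar; [lra|unfold odd_freq; lra].
    + right. field. lra. }
apply Rabs_le_between in hU, hr, hb. apply Rabs_le. lra.
Qed.

Lemma zeta_sum_bound k : (2 <= k)%nat ->
  exists C, 0 < C /\ forall zeta, is_riemann_zeta zeta -> forall N,
  Rabs (psum (fun n => / (PI * INR (S n)) * Im (zeta (0, zeta_height (ln (INR k)) (S n)))) N) <= C.
Proof.
intros hk. destruct (saw_average_bound k hk) as [C [hC h]].
assert (hk0 : 2 <= INR k) by (apply (le_INR 2); easy).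
set (L := ln (INR k)) in *. assert (hL : 0 < L) by (apply ln_pos; lra).
assert (hp := PI2_3_2).
set (al := 2 * PI / L). assert (hal : 0 < al) by (apply Rdiv_lt_0_compat; lra).
assert (hia : 0 < / al) by now apply Rinv_0_lt_compat.
exists (C + (1 + / al)). split; [lra|]. intros zeta hz N.
destruct N as [|N']. { simpl psum. rewrite Rabs_R0. lra. }
set (N := S N') in *.
destruct (h N ltac:(unfold N; lia)) as [M [hM hb]].
assert (hN0 : 1 <= INR N) by (apply (le_INR 1); unfold N; lia).
assert (hfr : forall n, zeta_height L n = al * INR n) by (intros; reflexivity).
rewrite hfr in hM.
assert (hM0 : 0 < INR M) by nra.
assert (err : Rabs (psum (fun n => / (PI * INR (S n)) * (- Im (zeta (0, zeta_height L (S n))) - zeta_im_trap (zeta_height L (S n)) M)) N)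
   <= 1 + / al).
{ apply Rle_trans with (psum (fun _ => (1 + al) / (2 * INR M)) N).
  - apply psum_abs_le. intros n hn.
    assert (hn1 : 1 <= INR (S n)) by (apply (le_INR 1); lia).
    assert (hnN : INR (S n) <= INR N) by (apply le_INR; lia).
    assert (ht : 0 < zeta_height L (S n) <= INR M).
    { rewrite hfr. split; [nra|]. apply Rle_trans with (al * INR N); [apply Rmult_le_compat_l; lra|easy]. }
    assert (ha := zeta_im_approx zeta hz (zeta_height L (S n)) M ht).
    rewrite Rabs_mult, (Rabs_pos_eq (/ _)) by (left; apply Rinv_0_lt_compat; nra).
    apply Rle_trans with (/ INR (S n) * ((1 + zeta_height L (S n)) / (2 * INR M))).
    + apply Rmult_le_compat; [left; apply Rinv_0_lt_compat; nra|apply Rabs_pos| |easy].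
      apply Rinv_le_contravar; nra.
    + rewrite hfr. replace (/ INR (S n) * ((1 + al * INR (S n)) / (2 * INR M))) with
        ((/ INR (S n) + al) / (2 * INR M)) by (field; lra).
      apply Rmult_le_compat_r; [left; apply Rinv_0_lt_compat; lra|]. apply Rplus_le_compat_r.
      rewrite <- Rinv_1. apply Rinv_le_contravar; lra.
  - rewrite psum_const.
    apply Rle_trans with ((1 + al) / 2 * / al); [|replace ((1 + al) / 2 * / al) with (/ 2 * / al + / 2) by (field; lra); lra].
    replace (INR N * ((1 + al) / (2 * INR M))) with ((1 + al) / 2 * (INR N / INR M)) by (field; lra).
    apply Rmult_le_compat_l; [lra|].
    apply Rmult_le_reg_r with (al * INR M); [nra|]. field_simplify; lra. }
assert (e : psum (fun n => / (PI * INR (S n)) * Im (zeta (0, zeta_height L (S n)))) N =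
  - (psum (fun n => / (PI * INR (S n)) * (- Im (zeta (0, zeta_height L (S n))) - zeta_im_trap (zeta_height L (S n)) M)) N
   + psum (fun n => / (PI * INR (S n)) * zeta_im_trap (zeta_height L (S n)) M) N)).
{ rewrite <- psum_plus.
  match goal with |- _ = - ?p => replace (- p) with (-1 * p) by ring end.
  rewrite <- psum_scal. apply psum_ext. intros; ring. }
rewrite e, Rabs_Ropp. eapply Rle_trans; [apply Rabs_triang|lra].
Qed.

Lemma Csum_list_app f l1 l2 : Csum_list f (l1 ++ l2) = (Csum_list f l1 + Csum_list f l2)%C.
Proof.
unfold Csum_list. rewrite map_app, fold_right_app.
induction (map f l1) as [|z l IH]; simpl; [ring|]. rewrite IH. ring.
Qed.

Lemma Csum_list_cons f z l : Csum_list f (z :: l) = (f z + Csum_list f l)%C.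
Proof. easy. Qed.

Definition nonzero_ints (N : nat) : list Z :=
  filter (fun n => negb (n =? 0)%Z) (map (fun j => (Z.of_nat j - Z.of_nat N)%Z) (seq 0 (2 * N + 1))).

Lemma nonzero_ints_S N : nonzero_ints (S N) = ((- Z.of_nat (S N))%Z :: nonzero_ints N ++ Z.of_nat (S N) :: nil)%list.
Proof.
unfold nonzero_ints. replace (2 * S N + 1)%nat with (S (S (2 * N + 1)))%nat by lia.
rewrite seq_S. cbn [Nat.add]. change (seq 0 (S (2 * N + 1))) with (0%nat :: seq 1 (2 * N + 1)).
rewrite map_app, filter_app, <- seq_shift.
cbn [map]. rewrite map_map.
replace (map (fun x => (Z.of_nat (S x) - Z.of_nat (S N))%Z) (seq 0 (2 * N + 1))) with
  (map (fun j => (Z.of_nat j - Z.of_nat N)%Z) (seq 0 (2 * N + 1))) by (apply map_ext; intros; lia).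
replace (Z.of_nat 0 - Z.of_nat (S N))%Z with (- Z.of_nat (S N))%Z by lia.
replace (Z.of_nat (S (2 * N + 1)) - Z.of_nat (S N))%Z with (Z.of_nat (S N)) by lia.
set (l := map _ (seq 0 (2 * N + 1))).
assert (e1 : (- Z.of_nat (S N) =? 0)%Z = false) by (apply Z.eqb_neq; lia).
assert (e2 : (Z.of_nat (S N) =? 0)%Z = false) by (apply Z.eqb_neq; lia).
cbn [filter]. rewrite e1, e2. reflexivity.
Qed.

Lemma Csum_nonzero_ints (f : Z -> C) (g : nat -> R) N :
  (forall n, (f (Z.of_nat (S n)) + f (- Z.of_nat (S n))%Z)%C = (0, g n)) ->
  Csum_list f (nonzero_ints N) = (0, psum g N).
Proof.
intros h. induction N as [|N IH].
- easy.
- rewrite nonzero_ints_S, Csum_list_cons, Csum_list_app, IH, Csum_list_cons.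
  change (Csum_list f nil) with (RtoC 0).
  replace (f (- Z.of_nat (S N))%Z + ((0%R, psum g N) + (f (Z.of_nat (S N)) + 0)))%C with
    ((0%R, psum g N) + (f (Z.of_nat (S N)) + f (- Z.of_nat (S N))%Z))%C by ring.
  rewrite h. rewrite psum_S. unfold Cplus; simpl. f_equal; ring.
Qed.

Lemma C_pure_im (a b : R) : b <> 0 -> (RtoC 2 * RtoC a * RtoC PI * Ci / RtoC b)%C = (0, 2 * a * PI / b).
Proof.
intros hb. unfold Cdiv. rewrite <- RtoC_inv by easy.
unfold Cmult, RtoC, Ci; simpl. f_equal; field; easy.
Qed.

Lemma C_pair_term (x y a : R) : a <> 0 ->
  ((x, y) * (RtoC 1 / RtoC a) + (x, (- y)%R) * (RtoC 1 / RtoC (- a)%R))%C = (0, 2 * y / a).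
Proof.
intros ha. unfold Cdiv. rewrite <- !RtoC_inv by lra.
unfold Cmult, Cplus, RtoC; simpl. f_equal; field; easy.
Qed.

Theorem theorem1p3 :
  forall k : nat, (2 <= k)%nat ->
  exists C0 : R, 0 < C0 /\
    forall zeta : C -> C, is_riemann_zeta zeta ->
    forall l : R, 2 <= l ->
      Cmod (RtoC 1 / (RtoC 2 * RtoC PI * Ci)
            * Csum_list
                (fun n : Z =>
                   zeta (RtoC 2 * RtoC (IZR n) * RtoC PI * Ci
                           / RtoC (ln (INR k)))
                   * (RtoC 1 / RtoC (IZR n)))
                (nonzero_ints_upto (Rpower (INR k) l)))%C <= C0.
Proof.
intros k hk. destruct (zeta_sum_bound k hk) as [C [hC h]].
exists C. split; [easy|]. intros zeta hz l _.
assert (hk0 : 2 <= INR k) by (apply (le_INR 2); easy).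
assert (hL : 0 < ln (INR k)) by (apply ln_pos; lra).
assert (hp := PI_RGT_0).
change (nonzero_ints_upto (Rpower (INR k) l)) with (nonzero_ints (Z.to_nat (Int_part (Rpower (INR k) l)))).
set (N := Z.to_nat _).
rewrite (Csum_nonzero_ints _ (fun n => 2 * Im (zeta (0, zeta_height (ln (INR k)) (S n))) / INR (S n)) N).
- assert (hb := h zeta hz N).
  set (s := psum (fun n => 2 * Im (zeta (0, zeta_height (ln (INR k)) (S n))) / INR (S n)) N).
  assert (e : (RtoC 1 / (RtoC 2 * RtoC PI * Ci) * (0%R, s))%C = RtoC (s / (2 * PI))).
  { replace (0, s) with (Ci * RtoC s)%C by (unfold Cmult, Ci, RtoC; simpl; f_equal; ring).
    unfold Rdiv. rewrite RtoC_mult, RtoC_inv, RtoC_mult by lra. field.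
    split; intros h0; injection h0; lra. }
  rewrite e, Cmod_R.
  replace (s / (2 * PI)) with (psum (fun n => / (PI * INR (S n)) * Im (zeta (0, zeta_height (ln (INR k)) (S n)))) N); [easy|].
  unfold s, Rdiv. rewrite Rmult_comm, <- psum_scal. apply psum_ext. intros n _.
  assert (hn : 0 < INR (S n)) by (apply lt_0_INR; lia). field. lra.
- intros n. assert (hn : 0 < INR (S n)) by (apply lt_0_INR; lia).
  rewrite opp_IZR, <- INR_IZR_INZ.
  rewrite !C_pure_im by lra.
  set (t := zeta_height (ln (INR k)) (S n)).
  assert (ht : 0 < t).
  { unfold t, zeta_height. apply Rmult_lt_0_compat; [apply Rdiv_lt_0_compat; lra|easy]. }
  replace (2 * INR (S n) * PI / ln (INR k)) with t by (unfold t, zeta_height; field; lra).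
  replace (2 * - INR (S n) * PI / ln (INR k)) with (- t) by (unfold t, zeta_height; field; lra).
  destruct (zeta_conj zeta hz t ltac:(lra)) as [e1 e2].
  rewrite (surjective_pairing (zeta (0, t))), (surjective_pairing (zeta (0, - t))).
  change (fst (zeta (0, - t))) with (Re (zeta (0, - t))). change (snd (zeta (0, - t))) with (Im (zeta (0, - t))).
  rewrite e1, e2. apply C_pair_term. lra.
Qed.
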